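(* Let $\mathfrak{M}$ be a weight matrix. (Roumieu case) If $\mathfrak{M}$ is R-regular and has R-moderate growth, then the ring ${}_1\mathcal{E}^{\{\mathfrak{M}\}}$ has property $(\mathscr{D})$. (Beurling case) If $\mathfrak{M}$ is B-regular and has B-moderate growth, then the ring ${}_1\mathcal{E}^{(\mathfrak{M})}$ has property $(\mathscr{D})$.
   Context: A weight sequence is a sequence $M=(M_k)_{k\ge0}$ of positive reals with $M_k=\mu_1\cdots\mu_k$, $M_0=1$, where $(\mu_k)$ is positive and increasing with $\mu_0=1$, and $M_k^{1/k}\to\infty$; lowercase $m_k:=M_k/k!$ (similarly $n_k=N_k/k!$). For a positive sequence $m$ with $m_0=1$, $m_k^{1/k}\to\infty$, $m_{k+1}/m_k\to\infty$, set $h_m(t):=\inf_k m_kt^k$ ($t>0$), $\overline\Gamma_m(t):=\min\{k:h_m(t)=m_kt^k\}$, $\underline\Gamma_m(t):=\min\{k:m_{k+1}/m_k\ge1/t\}$. A weight matrix $\mathfrak{M}$ is a family of weight sequences totally ordered by the pointwise order. With $m_k^{1/k}\to\infty$ for all $M\in\mathfrak{M}$, $\mathfrak{M}$ is R-regular if (a) $\forall M\in\mathfrak{M}\ \exists N\in\mathfrak{M}\ \exists C\ge1\ \forall j: M_{j+1}\le C^{j+1}N_j$ and (b) $\forall M\ \exists N\ \exists C\ge1\ \forall t>0: \overline\Gamma_n(Ct)\le\underline\Gamma_m(t)$; it is B-regular if (a') $\forall M\ \exists N\ \exists C\ge1\ \forall j: N_{j+1}\le C^jM_j$ and (b') $\forall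 M\ \exists N\ \exists C\ge1\ \forall t>0:\overline\Gamma_m(Ct)\le\underline\Gamma_n(t)$. For positive sequences let $\mathrm{mg}(M,N):=\sup_{j,k\ge0,j+k\ge1}(M_{j+k}/(N_jN_k))^{1/(j+k)}\in(0,\infty]$. $\mathfrak{M}$ has R-moderate growth if $\forall M\in\mathfrak{M}\ \exists N\in\mathfrak{M}:\mathrm{mg}(M,N)<\infty$, and B-moderate growth if $\forall M\ \exists N:\mathrm{mg}(N,M)<\infty$. For open $U\subseteq\mathbb{R}^d$ and $\sigma>0$, $\mathcal{B}^M_\sigma(U)$ is the set of $f\in C^\infty(U)$ with $\sup_{x\in U,\alpha}|\partial^\alpha f(x)|/(\sigma^{|\alpha|}M_{|\alpha|})<\infty$; $\mathcal{B}^{\{\mathfrak{M}\}}(U):=\bigcup_{M\in\mathfrak{M}}\bigcup_{\sigma>0}\mathcal{B}^M_\sigma(U)$, $\mathcal{B}^{(\mathfrak{M})}(U):=\bigcap_{M\in\mathfrak{M}}\bigcap_{\sigma>0}\mathcal{B}^M_\sigma(U)$, and $\mathcal{E}^{\{\mathfrak{M}\}}(U)$ (resp. $\mathcal{E}^{(\mathfrak{M})}(U)$) is the set of $f:U\to\mathbb{C}$ with $f|_V\in\mathcal{B}^{\{\mathfrak{M}\}}(V)$ (resp. $\mathcal{B}^{(\mathfrak{M})}(V)$) for every relatively compact open $V\subseteq U$. ${}_d\mathcal{E}^{\{\mathfrak{M}\}}$, ${}_d\mathcal{E}^{(\mathfrak{M})}$ are the rings of germs at $0\in\mathbb{R}^d$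 of such complex valued functions. A subring $\mathcal{S}$ of the ring of germs at $0\in\mathbb{R}^d$ of complex valued $C^\infty$ functions has property $(\mathscr{D})$ if for every complex valued function germ $f$ at $0$: if $f^j,f^{j+1}\in\mathcal{S}$ for some integer $j\ge1$, then $f\in\mathcal{S}$. *)

(* Defs.v *)
From Stdlib Require Import Reals Arith Factorial.
From Coquelicot Require Import Coquelicot.
Open Scope R_scope.

Fixpoint prod_seq (mu : nat -> R) (k : nat) : R :=
  match k with
  | O => 1
  | S k' => prod_seq mu k' * mu (S k')
  end.

Definition root_to_infty (a : nat -> R) : Prop :=
  is_lim_seq (fun k => Rpower (a k) (/ INR k)) p_infty.

Definition weight_sequence (M : nat -> R) : Prop :=
  exists mu : nat -> R,
    mu 0%nat = 1 /\
    (forall k, 0 < mu k) /\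
    (forall k, mu k <= mu (S k)) /\
    (forall k, M k = prod_seq mu k) /\
    root_to_infty M.

Definition lowr (M : nat -> R) : nat -> R := fun k => M k / INR (Factorial.fact k).

Definition weight_matrix (W : (nat -> R) -> Prop) : Prop :=
  (exists M, W M) /\
  (forall M, W M -> weight_sequence M) /\
  (forall M N, W M -> W N -> (forall k, M k <= N k) \/ (forall k, N k <= M k)).

Definition is_min_nat (P : nat -> Prop) (k : nat) : Prop :=
  P k /\ forall j, P j -> (k <= j)%nat.

Definition h_attained (m : nat -> R) (t : R) (k : nat) : Prop :=
  forall j, m k * t ^ k <= m j * t ^ j.

Definition GammaBar (m : nat -> R) (t : R) (k : nat) : Prop :=
  is_min_nat (h_attained m t) k.

Definition GammaUnder (m : nat -> R) (t : R) (k : nat) : Prop :=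
  is_min_nat (fun k => m (S k) / m k >= / t) k.

Definition GammaBar_le_GammaUnder (m : nat -> R) (s : R) (n : nat -> R) (t : R) : Prop :=
  forall k l, GammaBar m s k -> GammaUnder n t l -> (k <= l)%nat.

Definition R_regular (W : (nat -> R) -> Prop) : Prop :=
  (forall M, W M -> root_to_infty (lowr M)) /\
  (forall M, W M -> exists N, W N /\ exists C, C >= 1 /\
      forall j, M (S j) <= C ^ (S j) * N j) /\
  (forall M, W M -> exists N, W N /\ exists C, C >= 1 /\
      forall t, t > 0 -> GammaBar_le_GammaUnder (lowr N) (C * t) (lowr M) t).

Definition B_regular (W : (nat -> R) -> Prop) : Prop :=
  (forall M, W M -> root_to_infty (lowr M)) /\
  (forall M, W M -> exists N, W N /\ exists C, C >= 1 /\
      forall j, N (S j) <= C ^ j * M j) /\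
  (forall M, W M -> exists N, W N /\ exists C, C >= 1 /\
      forall t, t > 0 -> GammaBar_le_GammaUnder (lowr M) (C * t) (lowr N) t).

Definition mg_finite (M N : nat -> R) : Prop :=
  exists C, forall j k, (1 <= j + k)%nat ->
    Rpower (M (j + k)%nat / (N j * N k)) (/ INR (j + k)) <= C.

Definition R_moderate_growth (W : (nat -> R) -> Prop) : Prop :=
  forall M, W M -> exists N, W N /\ mg_finite M N.

Definition B_moderate_growth (W : (nat -> R) -> Prop) : Prop :=
  forall M, W M -> exists N, W N /\ mg_finite N M.

Definition derivs_on (U : R -> Prop) (f : R -> C) (g : nat -> R -> C) : Prop :=
  (forall x, U x -> g 0%nat x = f x) /\
  (forall k x, U x -> is_derive (g k) x (g (S k) x)).

Definition B_Roumieu (W : (nat -> R) -> Prop) (V : R -> Prop) (f : R -> C) : Prop :=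
  exists g, derivs_on V f g /\
  exists M, W M /\ exists sigma, sigma > 0 /\ exists K,
    forall x k, V x -> Cmod (g k x) <= K * (sigma ^ k * M k).

Definition B_Beurling (W : (nat -> R) -> Prop) (V : R -> Prop) (f : R -> C) : Prop :=
  exists g, derivs_on V f g /\
  forall M, W M -> forall sigma, sigma > 0 -> exists K,
    forall x k, V x -> Cmod (g k x) <= K * (sigma ^ k * M k).

Definition rel_compact_open_in (V U : R -> Prop) : Prop :=
  open V /\ exists a b, (forall x, V x -> a <= x <= b) /\
                        (forall x, a <= x <= b -> U x).

Definition E_Roumieu (W : (nat -> R) -> Prop) (U : R -> Prop) (f : R -> C) : Prop :=
  forall V, rel_compact_open_in V U -> B_Roumieu W V f.

Definition E_Beurling (W : (nat -> R) -> Prop) (U : R -> Prop) (f : R -> C) : Prop :=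
  forall V, rel_compact_open_in V U -> B_Beurling W V f.

Definition germ_Roumieu (W : (nat -> R) -> Prop) (f : R -> C) : Prop :=
  exists U, open U /\ U 0 /\ E_Roumieu W U f.

Definition germ_Beurling (W : (nat -> R) -> Prop) (f : R -> C) : Prop :=
  exists U, open U /\ U 0 /\ E_Beurling W U f.

Fixpoint Cpow (z : C) (n : nat) : C :=
  match n with
  | O => RtoC 1
  | S n' => Cmult z (Cpow z n')
  end.

Definition property_D (S : (R -> C) -> Prop) : Prop :=
  forall (f : R -> C) (j : nat), (1 <= j)%nat ->
    S (fun x => Cpow (f x) j) -> S (fun x => Cpow (f x) (Datatypes.S j)) -> S f.

(* Main.v *)
(** Restrict [f] to [[-r, r]] and put [x = r cos t], so that [phi t = f (r cos t)] has a
    cosine series.  Let [p] and [q] be the cosine polynomials of degree [n] that approximate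
    [phi^j] and [phi^(j+1)] up to a small error [delta] on the real line; regularity of the
    weights bounds them on a strip of width about [log (1 / delta) / n].
    There [p^(j+1) - q^j] stays small by Bernstein-Walsh, so [|q|] is controlled by
    [|p|^(1 + 1/j)], and [u = q conj p / (|p|^2 + eta^2)] is close to [phi] on the real line.
    Shifting the contour of the [n]-th Fourier coefficient of [u] into the strip costs the
    integral of [|dbar u|]; by Cauchy-Schwarz this is a power of [delta] times the integral of
    the Laplacian of [log (|p|^2 + eta^2)], and the latter is only logarithmic because the
    means of a subharmonic function are convex in [Im z].  Hence the [n]-th coefficient of
    [phi] is at most a fixed power of the bound for those of [phi^j], up to powers of [n], and
    moderate growth absorbs that power.  Finally the Chebyshev series of [f] can be
    differentiated term by term in the interior, where the differential equation of the
    Chebyshev polynomials gives sharp bounds for their derivatives.  No constant that multiplies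
    [sigma] depends on [sigma], so the Roumieu and Beurling cases are the same. *)
Require Import Defs.
From Stdlib Require Import Reals Lra Lia Psatz Classical Arith Factorial.
From Coquelicot Require Import Coquelicot.
Open Scope R_scope.

(** * Trigonometric polynomials in a strip *)

(** The powers of [f] need not be analytic, [f] may vanish to infinite order, and the class may be
    quasianalytic, so neither holomorphic extensions nor cutoff functions are at hand. The
    substitution [x = r cos t] yields an even periodic function without a cutoff, and the quotient
    is formed anew for each [n] from truncations used for the [n]-th coefficient alone. A second
    parameter [l], the number of derivatives spent, fixes the scale. With
    [X = ln (n / (e C s N_l^(1/l)))] and [Y = l X] the truncation error is about [exp (- Y)], and
    regularity makes the coefficients with [k <= n] decay like [exp (- Y k / (2 n))], so both
    polynomials stay bounded up to height [Y / (2 n)]. The same [Y] governs error and height; this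
    is why a fixed power of the error survives. That power is [1 / (4 j (j + 1))]: half of [Y] pays
    for the growth of [p^(j+1) - q^j], a root of order [j (j + 1)] leads from this difference to the
    quotient, and another half pays for the logarithm. *)

Lemma exp_le a b : a <= b -> exp a <= exp b.
Proof. intros [H | ->]; [left; apply exp_increasing, H | right; auto]. Qed.

Lemma sum_n_delta (c : nat -> C) k N : (k <= N)%nat ->
  sum_n (fun i => if Nat.eq_dec i k then c i else zero) N = c k.
Proof.
induction N as [|N IH]; intros Hk.
- rewrite sum_O; replace k with 0%nat by lia.
  destruct (Nat.eq_dec 0 0); auto; lia.
- rewrite sum_Sn; destruct (Nat.eq_dec (S N) k) as [<-|Hn].
  + rewrite (sum_n_ext_loc _ (fun _ => zero)).
    * unfold sum_n; rewrite sum_n_m_const_zero; apply plus_zero_l.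
    * intros i Hi; destruct (Nat.eq_dec i (S N)); auto; lia.
  + rewrite IH by lia; apply plus_zero_r.
Qed.

Lemma Cmod_sum_n_le (a : nat -> C) (b : nat -> R) N :
  (forall k, (k <= N)%nat -> Cmod (a k) <= b k) ->
  Cmod (sum_n a N) <= sum_n b N.
Proof.
induction N as [|N IH]; intros H.
- rewrite !sum_O; auto.
- rewrite !sum_Sn; apply Rle_trans with (1 := Cmod_triangle _ _).
  apply Rplus_le_compat; auto.
Qed.

(* [Ez m y x] is [exp (i m (x + i y))]. *)
Definition Ez (m y x : R) : C := (exp (- m * y) * cos (m * x), exp (- m * y) * sin (m * x)).

Lemma Ez_mult m m' y x : Cmult (Ez m y x) (Ez m' y x) = Ez (m + m') y x.
Proof.
unfold Ez, Cmult; simpl.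
replace (- (m + m') * y) with (- m * y + - m' * y) by ring.
replace ((m + m') * x) with (m * x + m' * x) by ring.
rewrite exp_plus, cos_plus, sin_plus; f_equal; ring.
Qed.

Lemma Ez_0 y x : Ez 0 y x = RtoC 1.
Proof.
unfold Ez, RtoC; rewrite Ropp_0, !Rmult_0_l, exp_0, cos_0, sin_0; f_equal; ring.
Qed.

Lemma Cmod_Ez m y x : Cmod (Ez m y x) = exp (- m * y).
Proof.
unfold Cmod, Ez; simpl fst; simpl snd.
replace ((exp (- m * y) * cos (m * x)) ^ 2 + (exp (- m * y) * sin (m * x)) ^ 2)
  with (Rsqr (exp (- m * y))).
- apply sqrt_Rsqr; left; apply exp_pos.
- generalize (sin2_cos2 (m * x)); unfold Rsqr; intros E.
  transitivity (exp (- m * y) * exp (- m * y) * 1); [ring | rewrite <- E; ring].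
Qed.

Lemma Ez_per m y : Ez (INR m) y (2 * PI) = Ez (INR m) y 0.
Proof.
unfold Ez; rewrite Rmult_0_r.
replace (INR m * (2 * PI)) with (0 + 2 * INR m * PI) by ring.
rewrite cos_period, sin_period; auto.
Qed.

Lemma Ez_opp_per m y : Ez (- INR m) y (2 * PI) = Ez (- INR m) y 0.
Proof.
unfold Ez; rewrite Rmult_0_r.
replace (- INR m * (2 * PI)) with (- (0 + 2 * INR m * PI)) by ring.
rewrite cos_neg, sin_neg, cos_period, sin_period, cos_0, sin_0.
f_equal; ring.
Qed.

Section RootsOfUnity.

Variable N : nat.
Let M := INR (S N).
Let node (l : nat) := 2 * PI * INR l / M.

Let HM : 0 < M.
Proof. apply lt_0_INR; lia. Qed.

Lemma Ez_node m l : Ez m 0 (node l) = Ez (m * INR l) 0 (2 * PI / M).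
Proof.
unfold Ez, node.
replace (m * INR l * (2 * PI / M)) with (m * (2 * PI * INR l / M)) by (field; lra).
rewrite !Rmult_0_r; auto.
Qed.

Lemma geometric_Ez m n :
  Cmult (Cminus (Ez m 0 (2 * PI / M)) (RtoC 1)) (sum_n (fun l => Ez m 0 (node l)) n)
    = Cminus (Ez m 0 (node (S n))) (RtoC 1).
Proof.
induction n as [|n IH].
- rewrite sum_O; unfold node; simpl INR.
  replace (2 * PI * 0 / M) with 0 by (field; lra).
  replace (2 * PI * 1 / M) with (2 * PI / M) by (field; lra).
  replace (Ez m 0 0) with (RtoC 1); [ring|].
  unfold Ez; rewrite !Rmult_0_r, exp_0, cos_0, sin_0; unfold RtoC; f_equal; ring.
- rewrite sum_Sn; unfold plus; simpl.
  rewrite Cmult_plus_distr_l, IH.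
  rewrite !Ez_node.
  replace (m * INR (S (S n))) with (m + m * INR (S n)) by (rewrite (S_INR (S n)); ring).
  rewrite <- (Ez_mult m (m * INR (S n))); ring.
Qed.

Lemma sum_Ez_zero m : 0 < Rabs m < M -> (exists k, m = INR k \/ m = - INR k) ->
  sum_n (fun l => Ez m 0 (node l)) N = zero.
Proof.
intros Hm [k Hk].
assert (E : Cmult (Cminus (Ez m 0 (2 * PI / M)) (RtoC 1))
  (sum_n (fun l => Ez m 0 (node l)) N) = RtoC 0).
{ rewrite geometric_Ez; unfold node; fold M.
  replace (2 * PI * M / M) with (2 * PI) by (field; lra).
  replace (Ez m 0 (2 * PI)) with (Ez m 0 0).
  - replace (Ez m 0 0) with (RtoC 1); [ring|].
    unfold Ez; rewrite !Rmult_0_r, exp_0, cos_0, sin_0; unfold RtoC; f_equal; ring.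
  - destruct Hk as [-> | ->]; symmetry; [apply Ez_per | apply Ez_opp_per]. }
(* The ratio of the geometric sum is not 1: its real part is [1 - 2 sin^2 (|m| PI / M)], and
   [|m| PI / M] lies strictly between 0 and [PI]. *)
assert (Hz : Cminus (Ez m 0 (2 * PI / M)) (RtoC 1) <> RtoC 0).
{ intros H; apply (f_equal fst) in H; simpl in H.
  rewrite Rmult_0_r, exp_0, Rmult_1_l in H.
  assert (Hc : cos (2 * (Rabs m * PI / M)) = 1).
  { replace (2 * (Rabs m * PI / M)) with (Rabs m * (2 * PI / M)) by (field; lra).
    destruct (Rcase_abs m) as [Hn | Hn].
    - rewrite (Rabs_left _ Hn), Ropp_mult_distr_l_reverse, cos_neg; lra.
    - rewrite (Rabs_right _ Hn); lra. }
  rewrite cos_2a_sin in Hc.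
  generalize PI_RGT_0; intros HPI.
  assert (0 < sin (Rabs m * PI / M)); [|nra].
  apply sin_gt_0.
  - apply Rmult_lt_0_compat; [nra | apply Rinv_0_lt_compat, HM].
  - apply Rmult_lt_reg_r with M; auto.
    unfold Rdiv; rewrite Rmult_assoc, Rinv_l; nra. }
destruct (Ceq_dec (sum_n (fun l => Ez m 0 (node l)) N) (RtoC 0)) as [E0|Hn]; auto.
now elim (Cmult_neq_0 _ _ Hz Hn).
Qed.

(* Discrete Fourier inversion at the [N + 1]-st roots of unity. *)
Lemma coef_bound (c : nat -> C) d k : (k <= N)%nat ->
  (forall x, Cmod (sum_n (fun i => Cmult (c i) (Ez (INR i) 0 x)) N) <= d) ->
  Cmod (c k) <= d.
Proof.
intros Hk H.
assert (E : sum_n (fun l => Cmult (Ez (- INR k) 0 (node l))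
    (sum_n (fun i => Cmult (c i) (Ez (INR i) 0 (node l))) N)) N = Cmult (RtoC M) (c k)).
{ rewrite (sum_n_ext _ (fun l => sum_n (fun i => Cmult (c i) (Ez (INR i - INR k) 0 (node l))) N)).
  2:{ intros l; rewrite <- (sum_n_mult_l (K := C_Ring)); apply sum_n_ext; intros i.
      unfold Rminus; rewrite Rplus_comm, <- Ez_mult; unfold mult; simpl; ring. }
  rewrite sum_n_switch.
  rewrite (sum_n_ext_loc _ (fun i => if Nat.eq_dec i k then Cmult (RtoC M) (c i) else zero)).
  - apply (sum_n_delta (fun i => Cmult (RtoC M) (c i)) k N Hk).
  - intros i Hi; rewrite (sum_n_mult_l (K := C_Ring)).
    destruct (Nat.eq_dec i k) as [->|Hik].
    + rewrite (sum_n_ext _ (fun _ => RtoC 1)).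
      2:{ intros l; rewrite Rminus_diag; apply Ez_0. }
      replace (sum_n (fun _ => RtoC 1) N) with (RtoC M).
      * unfold mult; simpl; ring.
      * unfold M; clear; induction N as [|n IH].
        -- rewrite sum_O; auto.
        -- rewrite sum_Sn, <- IH, (S_INR (S n)), RtoC_plus; auto.
    + rewrite sum_Ez_zero; [apply (mult_zero_r (K := C_Ring)) | |].
      * split.
        -- apply Rabs_pos_lt; intros E; apply Hik, INR_eq; lra.
        -- unfold M; apply Rabs_def1; generalize (pos_INR i) (pos_INR k)
             (le_INR _ _ Hi) (le_INR _ _ Hk); rewrite S_INR; lra.
      * destruct (Nat.le_ge_cases k i) as [L|L].
        -- exists (i - k)%nat; left; rewrite minus_INR; auto.
        -- exists (k - i)%nat; right; rewrite minus_INR; auto; ring. }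
assert (B : Cmod (Cmult (RtoC M) (c k)) <= sum_n (fun _ => d) N).
{ rewrite <- E; apply Cmod_sum_n_le; intros l _.
  rewrite Cmod_mult, Cmod_Ez, Rmult_0_r, exp_0, Rmult_1_l; apply H. }
rewrite Cmod_mult, Cmod_R, Rabs_right in B by lra.
rewrite sum_n_const in B; fold M in B.
apply Rmult_le_reg_l with M; auto.
Qed.

End RootsOfUnity.

(* [F] is a polynomial of degree at most [N] in [exp (i (x + i y))]. *)
Definition is_expoly (N : nat) (F : R -> R -> C) : Prop :=
  exists c : nat -> C, forall y x,
    F y x = sum_n (fun k => Cmult (c k) (Ez (INR k) y x)) N.

(** Each coefficient is at most [d], and exponentials of nonnegative frequency do not grow in the
    upper half plane. This substitute for the maximum principle loses the factor [N + 1], which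
    later counts only as a power of [n]. *)
Lemma is_expoly_bound N F d : is_expoly N F -> (forall x, Cmod (F 0 x) <= d) ->
  forall y x, 0 <= y -> Cmod (F y x) <= INR (S N) * d.
Proof.
intros [c Hc] Hd y x Hy; rewrite Hc, <- sum_n_const.
apply Cmod_sum_n_le; intros k Hk.
assert (Hck : Cmod (c k) <= d).
{ apply (coef_bound N); auto; intros t; rewrite <- Hc; auto. }
rewrite Cmod_mult, Cmod_Ez, <- (Rmult_1_r d).
apply Rmult_le_compat; auto; [apply Cmod_ge_0 | left; apply exp_pos |].
rewrite <- exp_0; apply exp_le; generalize (pos_INR k); nra.
Qed.

Lemma is_expoly_ext N F G : (forall y x, F y x = G y x) -> is_expoly N F -> is_expoly N G.
Proof. intros E [c Hc]; exists c; intros; rewrite <- E; auto. Qed.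

Lemma is_expoly_Ez k N : (k <= N)%nat -> is_expoly N (Ez (INR k)).
Proof.
intros Hk; exists (fun i => if Nat.eq_dec i k then RtoC 1 else RtoC 0); intros y x.
rewrite <- (sum_n_delta (fun i => Ez (INR i) y x) k N Hk).
apply sum_n_ext; intros i; destruct (Nat.eq_dec i k).
- symmetry; apply Cmult_1_l.
- symmetry; apply Cmult_0_l.
Qed.

Lemma is_expoly_plus N F G : is_expoly N F -> is_expoly N G ->
  is_expoly N (fun y x => Cplus (F y x) (G y x)).
Proof.
intros [c Hc] [d Hd]; exists (fun k => Cplus (c k) (d k)); intros y x.
rewrite Hc, Hd; symmetry.
rewrite (sum_n_ext _ (fun k => plus (Cmult (c k) (Ez (INR k) y x)) (Cmult (d k) (Ez (INR k) y x)))).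
- apply (sum_n_plus (G := C_AbelianMonoid)).
- intros k; apply Cmult_plus_distr_r.
Qed.

Lemma is_expoly_scal N a F : is_expoly N F -> is_expoly N (fun y x => Cmult a (F y x)).
Proof.
intros [c Hc]; exists (fun k => Cmult a (c k)); intros y x; rewrite Hc.
rewrite <- (sum_n_mult_l (K := C_Ring)); apply sum_n_ext; intros k; apply Cmult_assoc.
Qed.

Lemma is_expoly_sum N (F : nat -> R -> R -> C) n :
  (forall k, (k <= n)%nat -> is_expoly N (F k)) ->
  is_expoly N (fun y x => sum_n (fun k => F k y x) n).
Proof.
induction n as [|n IH]; intros H.
- apply is_expoly_ext with (F 0%nat); auto; intros; rewrite sum_O; auto.
- apply is_expoly_ext with (fun y x => Cplus (sum_n (fun k => F k y x) n) (F (S n) y x)).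
  + intros; rewrite sum_Sn; auto.
  + apply is_expoly_plus; auto.
Qed.

Lemma is_expoly_mult N M F G : is_expoly N F -> is_expoly M G ->
  is_expoly (N + M) (fun y x => Cmult (F y x) (G y x)).
Proof.
intros [c Hc] [d Hd].
apply is_expoly_ext with (fun y x => sum_n (fun k => Cmult (c k)
   (sum_n (fun l => Cmult (d l) (Ez (INR (k + l)) y x)) M)) N).
- intros y x; rewrite Hc, Hd.
  rewrite <- (sum_n_mult_r (K := C_Ring)); apply sum_n_ext; intros k.
  unfold mult; simpl.
  rewrite <- !(sum_n_mult_l (K := C_Ring)); apply sum_n_ext; intros l.
  rewrite plus_INR, <- Ez_mult; unfold mult; simpl; ring.
- apply is_expoly_sum; intros k Hk; apply is_expoly_scal.
  apply is_expoly_sum; intros l Hl; apply is_expoly_scal, is_expoly_Ez; lia.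
Qed.

Lemma is_expoly_Cpow N F j : is_expoly N F ->
  is_expoly (j * N) (fun y x => Cpow (F y x) j).
Proof.
intros HF; induction j as [|j IH].
- simpl; apply is_expoly_ext with (Ez (INR 0)); [intros; apply Ez_0 | apply is_expoly_Ez; lia].
- apply (is_expoly_mult N (j * N)); auto.
Qed.

Lemma Cpow_mult a b n : Cpow (Cmult a b) n = Cmult (Cpow a n) (Cpow b n).
Proof. induction n as [|n IH]; simpl; [ring | rewrite IH; ring]. Qed.

Lemma Cmod_Cpow a n : Cmod (Cpow a n) = Cmod a ^ n.
Proof. induction n as [|n IH]; simpl; [apply Cmod_1 | rewrite Cmod_mult, IH; auto]. Qed.

Lemma Cpow_add a m n : Cpow a (m + n) = Cmult (Cpow a m) (Cpow a n).
Proof. induction m as [|m IH]; simpl; [ring | rewrite IH; ring]. Qed.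

Lemma Cpow_mul a m n : Cpow a (m * n) = Cpow (Cpow a n) m.
Proof. induction m as [|m IH]; simpl; auto; rewrite Cpow_add, IH; auto. Qed.

Lemma Cpow_Ez m n y x : Cpow (Ez m y x) n = Ez (INR n * m) y x.
Proof.
induction n as [|n IH]; [simpl; rewrite Rmult_0_l, Ez_0; auto|].
simpl Cpow; rewrite IH, Ez_mult, S_INR; f_equal; ring.
Qed.

Definition cosz (k : nat) (y x : R) : C :=
  Cmult (RtoC (/ 2)) (Cplus (Ez (INR k) y x) (Ez (- INR k) y x)).

Definition cospoly (c : nat -> C) (n : nat) (y x : R) : C :=
  sum_n (fun k => Cmult (c k) (cosz k y x)) n.

Lemma cosz_real k x : cosz k 0 x = RtoC (cos (INR k * x)).
Proof.
unfold cosz, Ez, RtoC, Cmult, Cplus; simpl fst; simpl snd.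
rewrite !Rmult_0_r, exp_0, Ropp_mult_distr_l_reverse, cos_neg, sin_neg.
f_equal; field.
Qed.

Lemma Cmod_cosz k y x : Cmod (cosz k y x) <= exp (INR k * Rabs y).
Proof.
unfold cosz; rewrite Cmod_mult, Cmod_R, Rabs_right by lra.
assert (H : forall e, Rabs e = 1 -> exp (- (e * INR k) * y) <= exp (INR k * Rabs y)).
{ intros e He; apply exp_le.
  replace (- (e * INR k) * y) with (INR k * (- (e * y))) by ring.
  apply Rmult_le_compat_l; [apply pos_INR|].
  apply Rle_trans with (1 := Rle_abs _).
  rewrite Rabs_Ropp, Rabs_mult, He; lra. }
generalize (Cmod_triangle (Ez (INR k) y x) (Ez (- INR k) y x)); rewrite !Cmod_Ez.
generalize (H 1 Rabs_R1) (H (-1) ltac:(rewrite Rabs_left; lra)).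
replace (- (1 * INR k)) with (- INR k) by ring.
replace (- (-1 * INR k)) with (- - INR k) by ring.
lra.
Qed.

(** Multiplication by [Ez n] moves the frequencies from [[-n, n]] to [[0, 2 n]]. *)
Lemma is_expoly_cospoly c n :
  is_expoly (2 * n) (fun y x => Cmult (cospoly c n y x) (Ez (INR n) y x)).
Proof.
apply is_expoly_ext with (fun y x => sum_n (fun k => Cmult (Cmult (c k) (RtoC (/ 2)))
  (Cplus (Ez (INR (n + k)) y x) (Ez (INR (n - k)) y x))) n).
- intros y x; unfold cospoly; rewrite <- (sum_n_mult_r (K := C_Ring)).
  apply sum_n_ext_loc; intros k Hk; unfold mult, cosz; simpl.
  rewrite plus_INR, minus_INR by auto; unfold Rminus; rewrite <- !Ez_mult; ring.
- apply is_expoly_sum; intros k Hk; apply is_expoly_scal, is_expoly_plus;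
    apply is_expoly_Ez; lia.
Qed.

(* Bernstein-Walsh for the trigonometric polynomial [p^(j+1) - q^j]. *)
Lemma strip_bound j n c d delta :
  let E y x := Cminus (Cpow (cospoly c n y x) (S j)) (Cpow (cospoly d n y x) j) in
  (forall x, Cmod (E 0 x) <= delta) ->
  forall y x, 0 <= y ->
    Cmod (E y x) <= INR (S (S j * (2 * n))) * delta * exp (INR (S j) * INR n * y).
Proof.
intros E HE y x Hy.
(* A shift by [(j + 1) n] makes all frequencies nonnegative. The power [q^j] needs only [j n] of it,
   hence the spare factor [Ez n] in front of it. *)
set (F := fun y x => Cmult (E y x) (Ez (INR (S j) * INR n) y x)).
assert (HF : is_expoly (S j * (2 * n)) F).
{ set (P := fun y x => Cmult (cospoly c n y x) (Ez (INR n) y x)).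
  set (Q := fun y x => Cmult (cospoly d n y x) (Ez (INR n) y x)).
  apply is_expoly_ext with (fun y x => Cplus (Cpow (P y x) (S j))
     (Cmult (RtoC (-1)) (Cmult (Ez (INR n) y x) (Cpow (Q y x) j)))).
  - intros y' x'; unfold F, E, P, Q; rewrite !Cpow_mult, !Cpow_Ez.
    rewrite S_INR, Rmult_plus_distr_r, Rmult_1_l, <- Ez_mult.
    replace (RtoC (-1)) with (Copp (RtoC 1)) by (rewrite <- RtoC_opp; auto).
    ring.
  - apply is_expoly_plus; [apply is_expoly_Cpow, is_expoly_cospoly |].
    apply is_expoly_scal.
    replace (S j * (2 * n))%nat with (2 * n + j * (2 * n))%nat by lia.
    apply is_expoly_mult; [apply is_expoly_Ez; lia | apply is_expoly_Cpow, is_expoly_cospoly]. }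
assert (B : Cmod (F y x) <= INR (S (S j * (2 * n))) * delta).
{ apply is_expoly_bound; auto; intros t; unfold F.
  rewrite Cmod_mult, Cmod_Ez, Rmult_0_r, exp_0, Rmult_1_r; auto. }
unfold F in B; rewrite Cmod_mult, Cmod_Ez in B.
apply Rmult_le_reg_r with (exp (- (INR (S j) * INR n) * y)); [apply exp_pos|].
rewrite Rmult_assoc, <- exp_plus.
replace (INR (S j) * INR n * y + - (INR (S j) * INR n) * y) with 0 by ring.
rewrite exp_0; lra.
Qed.

(** * Contour shift *)

Definition cont2 (f : R -> R -> R) : Prop := forall y x, continuity_2d_pt f y x.

Lemma cont2_const c : cont2 (fun _ _ => c).
Proof. intros y x; apply continuity_2d_pt_const. Qed.

Lemma cont2_opp f : cont2 f -> cont2 (fun y x => - f y x).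
Proof. intros H y x; apply continuity_2d_pt_opp, H. Qed.

Lemma cont2_plus f g : cont2 f -> cont2 g -> cont2 (fun y x => f y x + g y x).
Proof. intros Hf Hg y x; apply continuity_2d_pt_plus; auto. Qed.

Lemma cont2_minus f g : cont2 f -> cont2 g -> cont2 (fun y x => f y x - g y x).
Proof. intros Hf Hg y x; apply continuity_2d_pt_minus; auto. Qed.

Lemma cont2_mult f g : cont2 f -> cont2 g -> cont2 (fun y x => f y x * g y x).
Proof. intros Hf Hg y x; apply continuity_2d_pt_mult; auto. Qed.

Lemma cont2_div f g : cont2 f -> cont2 g -> (forall y x, g y x <> 0) ->
  cont2 (fun y x => f y x / g y x).
Proof.
intros Hf Hg Hn y x; apply continuity_2d_pt_mult; auto.
apply continuity_2d_pt_inv; auto.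
Qed.

Lemma cont2_pow f n : cont2 f -> cont2 (fun y x => f y x ^ n).
Proof.
intros Hf; induction n as [|n IH]; simpl;
  [apply cont2_const | apply cont2_mult; auto].
Qed.

Lemma cont2_ln f : cont2 f -> (forall y x, 0 < f y x) -> cont2 (fun y x => ln (f y x)).
Proof.
intros Hf Hp y x; apply (continuity_1d_2d_pt_comp ln); auto.
apply derivable_continuous_pt; exists (/ f y x); apply derivable_pt_lim_ln, Hp.
Qed.

Lemma cont2_fun1 (f : R -> R) : (forall y, continuous f y) -> cont2 (fun y _ => f y).
Proof.
intros Hf y x; apply (continuity_1d_2d_pt_comp f (fun y _ => y)).
- apply continuity_pt_filterlim, Hf.
- apply continuity_2d_pt_id1.
Qed.

Lemma cont2_fun2 (f : R -> R) : (forall y, continuous f y) -> cont2 (fun _ x => f x).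
Proof.
intros Hf y x; apply (continuity_1d_2d_pt_comp f (fun _ x => x)).
- apply continuity_pt_filterlim, Hf.
- apply continuity_2d_pt_id2.
Qed.

Lemma cont2_continuous f y x : cont2 f -> continuous (f y) x.
Proof.
intros Hf P HP.
generalize (proj1 (continuity_2d_pt_filterlim f y x) (Hf y x) P HP).
intros [e He]; exists e; intros z Hz; apply (He (y, z)); split; auto.
apply ball_center.
Qed.

Lemma cont2_ex_RInt f y a b : cont2 f -> ex_RInt (f y) a b.
Proof.
intros Hf; apply (ex_RInt_continuous (f y)).
intros; apply cont2_continuous; auto.
Qed.

Ltac Rring := match goal with |- ?a = ?b => change (@eq R a b) end; ring.

Lemma RInt_Rconst c a b : RInt (fun _ => c) a b = (b - a) * c.
Proof. apply (RInt_const a b c). Qed.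

Lemma RInt_periodic_derivative (f f' : R -> R) a b :
  (forall x, is_derive f x (f' x)) -> (forall x, continuous f' x) ->
  f a = f b -> RInt f' a b = 0.
Proof.
intros Hd Hc E; apply is_RInt_unique.
replace 0 with (minus (f b) (f a)).
- apply (is_RInt_derive f f'); auto.
- rewrite E; apply Rminus_diag.
Qed.

Lemma is_derive_RInt_cont2 f f' a b y :
  (forall y x, is_derive (fun t => f t x) y (f' y x)) -> cont2 f -> cont2 f' ->
  is_derive (fun y => RInt (f y) a b) y (RInt (f' y) a b).
Proof.
intros Hd Hf Hf'.
assert (E : RInt (f' y) a b = RInt (fun t => Derive (fun u => f u t) y) a b).
{ apply RInt_ext; intros x _; symmetry; apply is_derive_unique, Hd. }
rewrite E; apply (is_derive_RInt_param f).
- apply filter_forall; intros z t _; eexists; apply Hd.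
- intros t _; apply continuity_2d_pt_ext with (f := f'); auto.
  intros u v; symmetry; apply is_derive_unique, Hd.
- apply filter_forall; intros z; apply cont2_ex_RInt; auto.
Qed.

(* [a + i b] is a holomorphic function of [x + i y] with derivative [a' + i b'];
   the first argument of the functions is the imaginary part [y]. *)
Record holo (a b a' b' : R -> R -> R) : Prop := {
  holo_ax : forall y x, is_derive (fun t => a y t) x (a' y x);
  holo_bx : forall y x, is_derive (fun t => b y t) x (b' y x);
  holo_ay : forall y x, is_derive (fun t => a t x) y (- b' y x);
  holo_by : forall y x, is_derive (fun t => b t x) y (a' y x);
  holo_a : cont2 a;
  holo_b : cont2 b;
  holo_a' : cont2 a';
  holo_b' : cont2 b' }.

Ltac cont2_tac := repeat first
  [ assumption | apply cont2_const | apply cont2_div | apply cont2_plus | apply cont2_minus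
  | apply cont2_opp | apply cont2_mult | apply cont2_pow ].

(** This is the Cauchy-Schwarz step before integration. With [r = p'] the left side is the size of
    [dbar u], and [4 |r|^2 eta^2 / W^2] is the Laplacian of [ln W]. Cauchy-Schwarz for [q] and [r]
    gives [2 B t] with [t = |r| eta / W]; the product is split with weight [y1], so that integrating
    [1 / y1] over a strip of height [y1] costs a constant. *)
Lemma Rabs_Im_le q1 q2 r1 r2 W eta B y1 :
  0 < W -> 0 < eta -> 0 <= B -> 0 < y1 ->
  (q1 ^ 2 + q2 ^ 2) * eta ^ 2 <= B ^ 2 * W ^ 2 ->
  Rabs (2 * (q2 * r1 - q1 * r2) * eta ^ 2 / W ^ 2)
    <= B * (/ y1 + y1 / 4 * (4 * (r1 ^ 2 + r2 ^ 2) * eta ^ 2 / W ^ 2)).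
Proof.
intros HW He HB Hy Hq.
set (d := q2 * r1 - q1 * r2).
set (t := sqrt (r1 ^ 2 + r2 ^ 2) * eta / W).
assert (Ht2 : t ^ 2 = (r1 ^ 2 + r2 ^ 2) * eta ^ 2 / W ^ 2).
{ unfold t; replace ((sqrt (r1 ^ 2 + r2 ^ 2) * eta / W) ^ 2)
    with ((sqrt (r1 ^ 2 + r2 ^ 2) ^ 2) * eta ^ 2 / W ^ 2) by (field; lra).
  rewrite pow2_sqrt; nra. }
assert (Ht : 0 <= t).
{ apply Rmult_le_pos; [apply Rmult_le_pos; [apply sqrt_pos | lra] |
    left; apply Rinv_0_lt_compat, HW]. }
assert (Hd : Rabs (d * eta ^ 2 / W ^ 2) <= B * t).
{ apply Rsqr_incr_0_var; [| apply Rmult_le_pos; lra].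
  rewrite <- Rsqr_abs; unfold Rsqr.
  replace (B * t * (B * t)) with (B ^ 2 * t ^ 2) by ring; rewrite Ht2.
  replace (d * eta ^ 2 / W ^ 2 * (d * eta ^ 2 / W ^ 2))
    with (d ^ 2 * eta ^ 2 * (eta ^ 2 / W ^ 4)) by (field; lra).
  replace (B ^ 2 * ((r1 ^ 2 + r2 ^ 2) * eta ^ 2 / W ^ 2))
    with (B ^ 2 * W ^ 2 * (r1 ^ 2 + r2 ^ 2) * (eta ^ 2 / W ^ 4)) by (field; lra).
  apply Rmult_le_compat_r.
  - apply Rmult_le_pos; [nra | left; apply Rinv_0_lt_compat, pow_lt, HW].
  - apply Rle_trans with ((q1 ^ 2 + q2 ^ 2) * (r1 ^ 2 + r2 ^ 2) * eta ^ 2).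
    + apply Rmult_le_compat_r; [nra|]; unfold d.
      generalize (pow2_ge_0 (q1 * r1 + q2 * r2)); nra.
    + generalize (Rmult_le_compat_r (r1 ^ 2 + r2 ^ 2) _ _ ltac:(nra) Hq); nra. }
replace (2 * d * eta ^ 2 / W ^ 2) with (2 * (d * eta ^ 2 / W ^ 2)) by (field; lra).
rewrite Rabs_mult, (Rabs_right 2) by lra.
replace (4 * (r1 ^ 2 + r2 ^ 2) * eta ^ 2 / W ^ 2) with (4 * t ^ 2)
  by (rewrite Ht2; field; lra).
apply Rle_trans with (B * (2 * t)); [lra|].
apply Rmult_le_compat_l; auto.
(* AM-GM *)
replace (/ y1 + y1 / 4 * (4 * t ^ 2)) with (2 * t + (1 - y1 * t) ^ 2 / y1) by (field; lra).
assert (0 <= (1 - y1 * t) ^ 2 / y1).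
{ apply Rmult_le_pos; [apply pow2_ge_0 | left; apply Rinv_0_lt_compat, Hy]. }
lra.
Qed.

Ltac derw A := match type of A with is_derive _ ?x ?l =>
  match goal with |- context [Derive ?g x] =>
    replace (Derive g x) with l by (symmetry; apply is_derive_unique; exact A) end end.

Section ContourShift.

Variables (p1 p2 p1' p2' p1'' p2'' q1 q2 q1' q2' : R -> R -> R) (eta : R).
Hypothesis Hp : holo p1 p2 p1' p2'.
Hypothesis Hp' : holo p1' p2' p1'' p2''.
Hypothesis Hq : holo q1 q2 q1' q2'.
Hypothesis Heta : 0 < eta.
Hypothesis per : forall y, p1 y 0 = p1 y (2 * PI) /\ p2 y 0 = p2 y (2 * PI) /\
  p1' y 0 = p1' y (2 * PI) /\ p2' y 0 = p2' y (2 * PI) /\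
  q1 y 0 = q1 y (2 * PI) /\ q2 y 0 = q2 y (2 * PI).

(** [u1 + i u2 = q conj p / W], [Wx] and [Wy] are the partial derivatives of [W], [dbar] is the
    imaginary part of [(d_x + i d_y) u], and [lap] is the Laplacian of [ln W]. The imaginary part
    suffices because only the integral of [u1] is shifted. *)
Let W y x := p1 y x ^ 2 + p2 y x ^ 2 + eta ^ 2.
Let u1 y x := (q1 y x * p1 y x + q2 y x * p2 y x) / W y x.
Let u2 y x := (q2 y x * p1 y x - q1 y x * p2 y x) / W y x.
Let Wy y x := 2 * (p2 y x * p1' y x - p1 y x * p2' y x).
Let Wx y x := 2 * (p1 y x * p1' y x + p2 y x * p2' y x).
Let dbar y x := 2 * (q2 y x * p1' y x - q1 y x * p2' y x) * eta ^ 2 / W y x ^ 2.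
Let lap y x := 4 * (p1' y x ^ 2 + p2' y x ^ 2) * eta ^ 2 / W y x ^ 2.

Lemma W_pos y x : 0 < W y x.
Proof. unfold W; nra. Qed.

Let W_neq y x : W y x <> 0.
Proof. generalize (W_pos y x); lra. Qed.

Let W2_neq y x : W y x ^ 2 <> 0.
Proof. apply pow_nonzero, W_neq. Qed.

Let cW : cont2 W.
Proof. destruct Hp; unfold W; cont2_tac. Qed.

Let cu1 : cont2 u1.
Proof. destruct Hp, Hq; unfold u1; cont2_tac; auto. Qed.

Let clap : cont2 lap.
Proof. destruct Hp, Hp'; unfold lap; cont2_tac; auto. Qed.

Let cdbar : cont2 dbar.
Proof. destruct Hp, Hq; unfold dbar; cont2_tac; auto. Qed.

(** [u2x] and [Lx] are the explicit [x]-derivatives of [u2] and of [Wx / W]. Both integrate to zero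
    over a period, which removes them from the [y]-derivatives of the means. *)
Let u2x y x :=
  ((q2' y x * p1 y x + q2 y x * p1' y x - (q1' y x * p2 y x + q1 y x * p2' y x)) * W y x
   - (q2 y x * p1 y x - q1 y x * p2 y x) * Wx y x) / W y x ^ 2.
Let Lx y x :=
  (2 * (p1' y x ^ 2 + p1 y x * p1'' y x + p2' y x ^ 2 + p2 y x * p2'' y x) * W y x
    - Wx y x ^ 2) / W y x ^ 2.

Let cu2x : cont2 u2x.
Proof. destruct Hp, Hp', Hq; unfold u2x, Wx; cont2_tac; auto. Qed.

Let cLx : cont2 Lx.
Proof. destruct Hp, Hp', Hq; unfold Lx, Wx; cont2_tac; auto. Qed.

Ltac exd := repeat split; try (eexists; eassumption); auto.

Let du2x y x : is_derive (u2 y) x (u2x y x).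
Proof.
generalize (holo_ax _ _ _ _ Hp y x) (holo_bx _ _ _ _ Hp y x)
  (holo_ax _ _ _ _ Hq y x) (holo_bx _ _ _ _ Hq y x); intros A1 A2 A3 A4.
unfold u2, W, u2x, Wx; auto_derive.
- exd; apply W_neq.
- derw A1; derw A2; derw A3; derw A4.
  unfold W; field; apply W_neq.
Qed.

Let dLx y x : is_derive (fun x => Wx y x / W y x) x (Lx y x).
Proof.
generalize (holo_ax _ _ _ _ Hp y x) (holo_bx _ _ _ _ Hp y x)
  (holo_ax _ _ _ _ Hp' y x) (holo_bx _ _ _ _ Hp' y x); intros A1 A2 A3 A4.
unfold Lx, W, Wx; auto_derive.
- exd; apply W_neq.
- derw A1; derw A2; derw A3; derw A4.
  unfold W; field; apply W_neq.
Qed.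

(* [d_x + i d_y] kills [q], so only [conj p / W] contributes to [dbar]. *)
Let du1y y x : is_derive (fun y => u1 y x) y (dbar y x - u2x y x).
Proof.
generalize (holo_ay _ _ _ _ Hp y x) (holo_by _ _ _ _ Hp y x)
  (holo_ay _ _ _ _ Hq y x) (holo_by _ _ _ _ Hq y x); intros A1 A2 A3 A4.
unfold u1, W, u2x, dbar, Wx; auto_derive.
- exd; apply W_neq.
- derw A1; derw A2; derw A3; derw A4.
  unfold W; field; apply W_neq.
Qed.

Let dLy y x : is_derive (fun y => Wy y x / W y x) y (lap y x - Lx y x).
Proof.
generalize (holo_ay _ _ _ _ Hp y x) (holo_by _ _ _ _ Hp y x)
  (holo_ay _ _ _ _ Hp' y x) (holo_by _ _ _ _ Hp' y x); intros A1 A2 A3 A4.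
unfold Lx, lap, W, Wx, Wy; auto_derive.
- exd; apply W_neq.
- derw A1; derw A2; derw A3; derw A4.
  unfold W; field; apply W_neq.
Qed.

Let dlnW y x : is_derive (fun y => ln (W y x)) y (Wy y x / W y x).
Proof.
generalize (holo_ay _ _ _ _ Hp y x) (holo_by _ _ _ _ Hp y x); intros A1 A2.
unfold Wy, W; auto_derive.
- exd; apply W_pos.
- derw A1; derw A2.
  unfold W; field; apply W_neq.
Qed.

Let cLy : cont2 (fun y x => Wy y x / W y x).
Proof. destruct Hp; unfold Wy; cont2_tac; auto. Qed.

Let clnW : cont2 (fun y x => ln (W y x)).
Proof. apply cont2_ln; auto; apply W_pos. Qed.

Let P := 2 * PI.
Let HP : 0 < P.
Proof. unfold P; generalize PI_RGT_0; lra. Qed.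

(** [J' = G] and [G' = L >= 0], so [J] is the convex mean of [ln W] and [L] is the Laplacian carried
    by a horizontal line; [I] is the integral to be shifted. *)
Let I y := RInt (u1 y) 0 P.
Let G y := RInt (fun x => Wy y x / W y x) 0 P.
Let J y := RInt (fun x => ln (W y x)) 0 P.
Let L y := RInt (lap y) 0 P.

Let dI y : is_derive I y (RInt (dbar y) 0 P).
Proof.
replace (RInt (dbar y) 0 P) with (RInt (fun x => dbar y x - u2x y x) 0 P).
- apply (is_derive_RInt_cont2 u1 (fun y x => dbar y x - u2x y x)); auto.
  cont2_tac.
- rewrite (RInt_minus (dbar y) (u2x y)); try (apply cont2_ex_RInt; auto).
  rewrite (RInt_periodic_derivative (u2 y) (u2x y)); auto.
  + unfold minus, plus, opp; simpl; ring.
  + intros x; apply (cont2_continuous u2x); auto.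
  + destruct (per y) as (E1 & E2 & _ & _ & E3 & E4).
    unfold u2, W, P; rewrite E1, E2, E3, E4; auto.
Qed.

Let dG y : is_derive G y (L y).
Proof.
unfold L; replace (RInt (lap y) 0 P) with (RInt (fun x => lap y x - Lx y x) 0 P).
- apply (is_derive_RInt_cont2 (fun y x => Wy y x / W y x) (fun y x => lap y x - Lx y x)); auto.
  cont2_tac.
- rewrite (RInt_minus (lap y) (Lx y)); try (apply cont2_ex_RInt; auto).
  rewrite (RInt_periodic_derivative (fun x => Wx y x / W y x) (Lx y)); auto.
  + unfold minus, plus, opp; simpl; ring.
  + intros x; apply (cont2_continuous Lx); auto.
  + destruct (per y) as (E1 & E2 & E3 & E4 & _ & _).
    unfold Wx, W, P; rewrite E1, E2, E3, E4; auto.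
Qed.

Let dJ y : is_derive J y (G y).
Proof.
exact (is_derive_RInt_cont2 (fun y x => ln (W y x)) _ 0 P y dlnW clnW cLy).
Qed.

Let L_ge0 y : 0 <= L y.
Proof.
apply RInt_ge_0; [lra | apply cont2_ex_RInt; auto |].
intros x _; unfold lap.
apply Rmult_le_pos; [nra | left; apply Rinv_0_lt_compat, pow_lt, W_pos].
Qed.

Lemma mvt (f f' : R -> R) a b : (forall x, is_derive f x (f' x)) -> a <= b ->
  exists c, a <= c <= b /\ f b - f a = f' c * (b - a).
Proof.
intros H ab.
destruct (MVT_gen f a b f') as [c [Hc E]].
- intros; auto.
- intros x _; apply continuity_pt_filterlim, (ex_derive_continuous f); eexists; apply H.
- rewrite Rmin_left, Rmax_right in Hc by lra; exists c; auto.
Qed.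

Let G_incr a b : a <= b -> G a <= G b.
Proof.
intros ab; destruct (mvt G L a b dG ab) as [c [_ E]].
generalize (Rmult_le_pos (L c) (b - a) (L_ge0 c)); lra.
Qed.

Variables (B y1 Wmax : R).
Hypothesis HB : 0 <= B.
Hypothesis Hy1 : 0 < y1.
Hypothesis HqW : forall y x, 0 <= y <= y1 ->
  (q1 y x ^ 2 + q2 y x ^ 2) * eta ^ 2 <= B ^ 2 * W y x ^ 2.
Hypothesis HWmax : forall y x, - y1 <= y <= 2 * y1 -> W y x <= Wmax.

Let J_bounds y : - y1 <= y <= 2 * y1 -> P * ln (eta ^ 2) <= J y <= P * ln Wmax.
Proof.
intros Hy; unfold J.
replace (P * ln (eta ^ 2)) with (RInt (fun _ => ln (eta ^ 2)) 0 P)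
  by (rewrite RInt_Rconst; Rring).
replace (P * ln Wmax) with (RInt (fun _ => ln Wmax) 0 P)
  by (rewrite RInt_Rconst; Rring).
split; apply RInt_le; try lra; try apply ex_RInt_const;
  try (apply (cont2_ex_RInt (fun y x => ln (W y x))); auto).
- intros x _; apply ln_le; [apply pow_lt, Heta | unfold W; nra].
- intros x _; apply ln_le; [apply W_pos | auto].
Qed.

(* Convexity of [J], which is bounded on [-y1, 2 y1]. *)
Let G_bound : y1 * (G y1 - G 0) <= 2 * P * ln (Wmax / eta ^ 2).
Proof.
destruct (mvt J G y1 (2 * y1) dJ ltac:(lra)) as [c [Hc Ec]].
destruct (mvt J G (- y1) 0 dJ ltac:(lra)) as [d [Hd Ed]].
generalize (J_bounds y1 ltac:(lra)) (J_bounds (2 * y1) ltac:(lra))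
  (J_bounds (- y1) ltac:(lra)) (J_bounds 0 ltac:(lra)); intros B1 B2 B3 B4.
assert (0 < Wmax) by (apply Rlt_le_trans with (W 0 0); [apply W_pos | apply HWmax; lra]).
unfold Rdiv; rewrite ln_mult, ln_Rinv;
  [| apply pow_lt, Heta | lra | apply Rinv_0_lt_compat, pow_lt, Heta].
generalize (G_incr y1 c ltac:(lra)) (G_incr d 0 ltac:(lra)); intros G1 G2.
assert (y1 * G y1 <= P * ln Wmax - P * ln (eta ^ 2)) by nra.
assert (y1 * - G 0 <= P * ln Wmax - P * ln (eta ^ 2)) by nra.
lra.
Qed.

Let I'_bound y : 0 <= y <= y1 ->
  Rabs (RInt (dbar y) 0 P) <= B * (P / y1 + y1 / 4 * L y).
Proof.
intros Hy.
set (g := fun x => B * (/ y1 + y1 / 4 * lap y x)).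
assert (Eg : ex_RInt g 0 P).
{ apply (cont2_ex_RInt (fun _ x => g x) 0); unfold g.
  apply cont2_mult; [apply cont2_const | apply cont2_plus; [apply cont2_const |
    apply cont2_mult; [apply cont2_const |]]].
  intros z x; apply (continuity_1d_2d_pt_comp (lap y) (fun _ x => x)).
  - apply continuity_pt_filterlim, (cont2_continuous lap); auto.
  - apply continuity_2d_pt_id2. }
replace (B * (P / y1 + y1 / 4 * L y)) with (RInt g 0 P).
- apply (Rle_trans _ (RInt (fun x => Rabs (dbar y x)) 0 P)).
  + apply abs_RInt_le; [lra | apply cont2_ex_RInt; auto].
  + apply RInt_le; [lra | | auto |].
    * apply (ex_RInt_continuous (fun x => Rabs (dbar y x))); intros x _.
      apply (continuous_comp (dbar y) Rabs); [apply cont2_continuous; auto |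
        apply continuous_Rabs].
    * intros x _; unfold g, dbar, lap.
      apply Rabs_Im_le; auto; apply W_pos.
- assert (HL : is_RInt (lap y) 0 P (L y)) by apply (RInt_correct (lap y)), cont2_ex_RInt, clap.
  clearbody L; apply is_RInt_unique.
  replace (B * (P / y1 + y1 / 4 * L y))
    with (scal B (plus (scal (P - 0) (/ y1)) (scal (y1 / 4) (L y)))).
  + apply (is_RInt_scal (fun x => / y1 + y1 / 4 * lap y x)).
    apply (is_RInt_plus (fun _ => / y1) (fun x => y1 / 4 * lap y x)).
    * apply (is_RInt_const 0 P (/ y1)).
    * apply (is_RInt_scal (lap y)), HL.
  + unfold plus, scal; simpl; unfold mult; simpl; unfold Rdiv; ring.
Qed.

Lemma contour_shift :
  Rabs (RInt (u1 0) 0 (2 * PI) - RInt (u1 y1) 0 (2 * PI))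
    <= PI * B * (2 + ln (Wmax / eta ^ 2)).
Proof.
fold P; fold (I 0) (I y1).
(* The integral of [|I'|] over the height is never formed: the function
   [B (P y / y1 + y1 / 4 G y) - e I y] has a nonnegative derivative, so its values at [0] and [y1]
   are compared. The two signs [e] give the absolute value. *)
assert (key : forall e, Rabs e = 1 ->
  e * (I y1 - I 0) <= B * (P + y1 / 4 * (G y1 - G 0))).
{ intros e He.
  destruct (mvt (fun y => B * (P / y1 * y + y1 / 4 * G y) - e * I y)
    (fun y => B * (P / y1 + y1 / 4 * L y) - e * RInt (dbar y) 0 P) 0 y1) as [c [Hc E]];
    [| lra |].
  - intros y; auto_derive.
    + repeat split; eexists; [apply dG | apply dI].
    + derw (dG y); derw (dI y); ring.
  - generalize (I'_bound c Hc); intros Hb.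
    assert (e * RInt (dbar c) 0 P <= Rabs (RInt (dbar c) 0 P)).
    { rewrite <- (Rmult_1_l (Rabs _)), <- He, <- Rabs_mult; apply Rle_abs. }
    assert (0 <= (B * (P / y1 + y1 / 4 * L c) - e * RInt (dbar c) 0 P) * (y1 - 0))
      by (apply Rmult_le_pos; lra).
    replace (P / y1 * y1) with P in E by (field; lra).
    nra. }
assert (HG : B * (P + y1 / 4 * (G y1 - G 0)) <= PI * B * (2 + ln (Wmax / eta ^ 2))).
{ apply Rle_trans with (B * (P + 2 * P * ln (Wmax / eta ^ 2) / 4)).
  - apply Rmult_le_compat_l; [auto | lra].
  - right; unfold P; field. }
generalize (key 1 ltac:(rewrite Rabs_R1; auto))
  (key (-1) ltac:(rewrite Rabs_left; lra)); intros K1 K2.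
apply Rabs_le; lra.
Qed.

End ContourShift.

(** * Complex form of the contour shift *)

Definition holoC (F F' : R -> R -> C) : Prop :=
  holo (fun y x => fst (F y x)) (fun y x => snd (F y x))
       (fun y x => fst (F' y x)) (fun y x => snd (F' y x)).

Lemma holoC_const c : holoC (fun _ _ => c) (fun _ _ => RtoC 0).
Proof.
split; try (intros y x; apply (is_derive_const (V := R_NormedModule)));
  try apply cont2_const; intros y x; simpl.
rewrite Ropp_0; apply (is_derive_const (V := R_NormedModule)).
Qed.

Lemma holoC_plus F F' G G' : holoC F F' -> holoC G G' ->
  holoC (fun y x => Cplus (F y x) (G y x)) (fun y x => Cplus (F' y x) (G' y x)).
Proof.
intros [] []; split; simpl; try (cont2_tac; fail); intros y x; simpl.
- apply (is_derive_plus (V := R_NormedModule)); auto.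
- apply (is_derive_plus (V := R_NormedModule)); auto.
- rewrite Ropp_plus_distr; apply (is_derive_plus (V := R_NormedModule)); auto.
- apply (is_derive_plus (V := R_NormedModule)); auto.
Qed.

Lemma is_derive_eq (f : R -> R) x l l' : l = l' -> is_derive f x l -> is_derive f x l'.
Proof. intros ->; auto. Qed.

Lemma is_derive_Rmult (f g : R -> R) x f' g' : is_derive f x f' -> is_derive g x g' ->
  is_derive (fun t => f t * g t) x (f' * g x + f x * g').
Proof.
intros Hf Hg; apply (is_derive_mult f g x f' g' Hf Hg); intros; apply Rmult_comm.
Qed.

Lemma holoC_mult F F' G G' : holoC F F' -> holoC G G' ->
  holoC (fun y x => Cmult (F y x) (G y x))
        (fun y x => Cplus (Cmult (F' y x) (G y x)) (Cmult (F y x) (G' y x))).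
Proof.
intros [] []; split; simpl; try (cont2_tac; fail); intros y x; simpl.
- eapply is_derive_eq; [|apply (is_derive_minus (V := R_NormedModule));
    apply is_derive_Rmult; auto].
  unfold minus, plus, opp; simpl; ring.
- eapply is_derive_eq; [|apply (is_derive_plus (V := R_NormedModule));
    apply is_derive_Rmult; auto].
  unfold minus, plus, opp; simpl; ring.
- eapply is_derive_eq; [|apply (is_derive_minus (V := R_NormedModule));
    apply is_derive_Rmult; auto].
  unfold minus, plus, opp; simpl; ring.
- eapply is_derive_eq; [|apply (is_derive_plus (V := R_NormedModule));
    apply is_derive_Rmult; auto].
  unfold minus, plus, opp; simpl; ring.
Qed.

Lemma holoC_Ez m : holoC (Ez m) (fun y x => Cmult (0, m) (Ez m y x)).
Proof.
assert (E : forall a : R, cont2 (fun y _ => exp (a * y))).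
{ intros a; apply (cont2_fun1 (fun y => exp (a * y))); intros y.
  apply (ex_derive_continuous (fun y => exp (a * y))); auto_derive; auto. }
assert (Co : cont2 (fun _ x => cos (m * x))).
{ apply (cont2_fun2 (fun x => cos (m * x))); intros y.
  apply (ex_derive_continuous (fun y => cos (m * y))); auto_derive; auto. }
assert (Si : cont2 (fun _ x => sin (m * x))).
{ apply (cont2_fun2 (fun x => sin (m * x))); intros y.
  apply (ex_derive_continuous (fun y => sin (m * y))); auto_derive; auto. }
split; simpl; try (cont2_tac; auto; fail);
  intros y x; simpl; auto_derive; auto; ring.
Qed.

(** The second derivative occurs because the Laplacian of [ln W] differentiates [p'] once more;
    periodicity of [F] and [F'] cancels the boundary terms. *)
Definition periodic_holo (F : R -> R -> C) : Prop :=
  exists F' F'', holoC F F' /\ holoC F' F'' /\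
    (forall y, F y 0 = F y (2 * PI)) /\ (forall y, F' y 0 = F' y (2 * PI)).

Lemma periodic_holo_const c : periodic_holo (fun _ _ => c).
Proof.
exists (fun _ _ => RtoC 0), (fun _ _ => RtoC 0); split; [|split]; auto using holoC_const.
Qed.

Lemma periodic_holo_plus F G : periodic_holo F -> periodic_holo G -> periodic_holo (fun y x => Cplus (F y x) (G y x)).
Proof.
intros (F' & F'' & A1 & A2 & A3 & A4) (G' & G'' & B1 & B2 & B3 & B4).
eexists; eexists; split; [|split]; [eapply holoC_plus; eauto .. |].
split; intros y; cbv beta; congruence.
Qed.

Lemma periodic_holo_mult F G : periodic_holo F -> periodic_holo G -> periodic_holo (fun y x => Cmult (F y x) (G y x)).
Proof.
intros (F' & F'' & A1 & A2 & A3 & A4) (G' & G'' & B1 & B2 & B3 & B4).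
eexists; eexists; split; [|split].
- eapply holoC_mult; eauto.
- eapply holoC_plus; eapply holoC_mult; eauto.
- split; intros y; cbv beta; congruence.
Qed.

Lemma periodic_holo_Ez m : (forall y, Ez m y (2 * PI) = Ez m y 0) -> periodic_holo (Ez m).
Proof.
intros H; eexists; eexists; split; [apply holoC_Ez | split].
- eapply holoC_mult; [apply holoC_const | apply holoC_Ez].
- split; intros y; cbv beta; rewrite H; auto.
Qed.

Lemma periodic_holo_ext F G : (forall y x, F y x = G y x) -> periodic_holo F -> periodic_holo G.
Proof.
intros E (F' & F'' & H & A2 & A3 & A4); exists F', F''; split; [split | split];
  try apply H; auto.
- intros y x; apply is_derive_ext with (2 := holo_ax _ _ _ _ H y x); intros; rewrite E; auto.
- intros y x; apply is_derive_ext with (2 := holo_bx _ _ _ _ H y x); intros; rewrite E; auto.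
- intros y x; apply is_derive_ext with (2 := holo_ay _ _ _ _ H y x); intros; rewrite E; auto.
- intros y x; apply is_derive_ext with (2 := holo_by _ _ _ _ H y x); intros; rewrite E; auto.
- intros y x; apply continuity_2d_pt_ext with (2 := holo_a _ _ _ _ H y x); intros; rewrite E; auto.
- intros y x; apply continuity_2d_pt_ext with (2 := holo_b _ _ _ _ H y x); intros; rewrite E; auto.
- split; auto; intros; rewrite <- !E; auto.
Qed.

Lemma periodic_holo_cospoly c n : periodic_holo (cospoly c n).
Proof.
assert (H : forall k, periodic_holo (fun y x => Cmult (c k) (cosz k y x))).
{ intros k; apply periodic_holo_mult; [apply periodic_holo_const|].
  apply periodic_holo_mult; [apply periodic_holo_const | apply periodic_holo_plus; apply periodic_holo_Ez; intros;
    [apply Ez_per | apply Ez_opp_per]]. }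
induction n as [|n IH].
- apply periodic_holo_ext with (2 := H 0%nat); intros; unfold cospoly; rewrite sum_O; auto.
- apply periodic_holo_ext with (2 := periodic_holo_plus _ _ IH (H (S n))).
  intros; unfold cospoly; rewrite sum_Sn; auto.
Qed.

Lemma Cmod_sqr z : Cmod z ^ 2 = fst z ^ 2 + snd z ^ 2.
Proof. unfold Cmod; apply pow2_sqrt; nra. Qed.

Lemma contour_shift_C p q eta B y1 Wmax :
  periodic_holo p -> periodic_holo q -> 0 < eta -> 0 <= B -> 0 < y1 ->
  (forall y x, 0 <= y <= y1 -> Cmod (q y x) * eta <= B * (Cmod (p y x) ^ 2 + eta ^ 2)) ->
  (forall y x, - y1 <= y <= 2 * y1 -> Cmod (p y x) ^ 2 + eta ^ 2 <= Wmax) ->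
  let u y x := fst (Cmult (q y x) (Cconj (p y x))) / (Cmod (p y x) ^ 2 + eta ^ 2) in
  cont2 u /\
  Rabs (RInt (u 0) 0 (2 * PI) - RInt (u y1) 0 (2 * PI))
    <= PI * B * (2 + ln (Wmax / eta ^ 2)).
Proof.
intros (p' & p'' & Hp & Hp' & P1 & P2) (q' & q'' & Hq & _ & P3 & _) He HB Hy Hq1 HW u.
set (u1 := fun y x => (fst (q y x) * fst (p y x) + snd (q y x) * snd (p y x))
   / (fst (p y x) ^ 2 + snd (p y x) ^ 2 + eta ^ 2)).
assert (E : forall y x, u y x = u1 y x).
{ intros y x; unfold u, u1; rewrite Cmod_sqr; simpl; f_equal; ring. }
split.
- intros y x; apply continuity_2d_pt_ext with (f := u1); [intros; symmetry; apply E|].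
  revert y x; change (cont2 u1); destruct Hp, Hq; unfold u1; cont2_tac; intros; nra.
- rewrite (RInt_ext (u 0) (u1 0)), (RInt_ext (u y1) (u1 y1)); try (intros; apply E).
  assert (per : forall y, fst (p y 0) = fst (p y (2 * PI)) /\ snd (p y 0) = snd (p y (2 * PI)) /\
    fst (p' y 0) = fst (p' y (2 * PI)) /\ snd (p' y 0) = snd (p' y (2 * PI)) /\
    fst (q y 0) = fst (q y (2 * PI)) /\ snd (q y 0) = snd (q y (2 * PI))).
  { intros y; rewrite P1, P2, P3; repeat split. }
  apply (contour_shift _ _ _ _ _ _ _ _ _ _ eta Hp Hp' Hq He per B y1 Wmax HB Hy).
  + intros y x Hy'; rewrite <- !Cmod_sqr.
    generalize (Hq1 y x Hy') (Cmod_ge_0 (q y x)); intros H0 H1.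
    rewrite <- !Rpow_mult_distr; apply pow_incr; split; auto; nra.
  + intros y x Hy'; rewrite <- Cmod_sqr; auto.
Qed.

(** * Regularized division *)

Lemma pow_le_reg (a b : R) n : (1 <= n)%nat -> 0 <= b -> a ^ n <= b ^ n -> a <= b.
Proof.
intros Hn Hb H; destruct (Rle_lt_dec a b) as [|L]; auto.
exfalso; apply (Rlt_irrefl (b ^ n)); apply Rlt_le_trans with (2 := H).
destruct n as [|n]; [lia|].
clear H Hn; induction n as [|n IH]; [simpl; lra|].
change (b * b ^ S n < a * a ^ S n).
apply Rle_lt_trans with (b * a ^ S n).
- apply Rmult_le_compat_l; lra.
- apply Rmult_lt_compat_r; [apply pow_lt|]; lra.
Qed.

Lemma pow_ge_1 a n : 1 <= a -> 1 <= a ^ n.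
Proof. intros H; apply pow_R1_Rle, H. Qed.

Lemma pow_ge_self a n : (1 <= n)%nat -> 1 <= a -> a <= a ^ n.
Proof.
intros Hn Ha; replace a with (a ^ 1) at 1 by ring.
apply Rle_pow; auto.
Qed.

Lemma Cpow_diff_bound a b A d n : Cmod a <= A -> Cmod b <= A -> 1 <= A ->
  Cmod (Cminus a b) <= d -> Cmod (Cminus (Cpow a n) (Cpow b n)) <= INR n * A ^ n * d.
Proof.
intros Ha Hb HA Hd.
assert (Hd0 : 0 <= d) by (apply Rle_trans with (2 := Hd); apply Cmod_ge_0).
induction n as [|n IH].
- simpl; replace (Cminus (RtoC 1) (RtoC 1)) with (RtoC 0) by ring.
  rewrite Cmod_0; lra.
- simpl Cpow; replace (Cminus (Cmult a (Cpow a n)) (Cmult b (Cpow b n)))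
    with (Cplus (Cmult a (Cminus (Cpow a n) (Cpow b n))) (Cmult (Cminus a b) (Cpow b n))) by ring.
  apply Rle_trans with (1 := Cmod_triangle _ _).
  rewrite !Cmod_mult, Cmod_Cpow.
  assert (H1 : Cmod a * Cmod (Cminus (Cpow a n) (Cpow b n)) <= A * (INR n * A ^ n * d)).
  { apply Rmult_le_compat; auto; apply Cmod_ge_0. }
  assert (H2 : Cmod (Cminus a b) * Cmod b ^ n <= d * A ^ S n).
  { apply Rmult_le_compat; auto; try apply pow_le; try apply Cmod_ge_0.
    apply Rle_trans with (A ^ n); [apply pow_incr; split; auto; apply Cmod_ge_0 |].
    apply Rle_pow; auto. }
  rewrite S_INR; simpl in *; lra.
Qed.

Section Core.

Variables (j n k : nat) (c d : nat -> C) (phi : R -> C) (A delta beta y0 : R) (lam : C).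
Hypothesis Hj : (1 <= j)%nat.
Hypothesis Hbeta : 0 < beta <= 1.
Hypothesis HA : 1 <= A.
Hypothesis Hy0 : 0 < y0.
Hypothesis Hlam : Cmod lam = 1.
Hypothesis Hphi : forall x, Cmod (phi x) <= A.
Hypothesis Hphij : forall x, Cmod (phi x) ^ j <= A.
Hypothesis HphiS : forall x, Cmod (phi x) ^ S j <= A.
Hypothesis Hphic : cont2 (fun _ x => fst (Cmult lam (Cmult (phi x) (Ez (INR k) 0 x)))).
Hypothesis Hp : forall y x, Rabs y <= y0 -> Cmod (cospoly c n y x) <= A.
Hypothesis Hq : forall y x, Rabs y <= y0 -> Cmod (cospoly d n y x) <= A.
Hypothesis Hpd : forall x, Cmod (Cminus (Cpow (phi x) j) (cospoly c n 0 x)) <= delta.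
Hypothesis Hqd : forall x, Cmod (Cminus (Cpow (phi x) (S j)) (cospoly d n 0 x)) <= delta.
(** The left side is the Bernstein-Walsh bound for [p^(j+1) - q^j] at height [y0]. The right side is
    [eta^(j+1)] for the regularizing [eta = beta^j], that is, the level below which [|p|^(j+1)] is
    not distinguished from zero. *)
Hypothesis HE : INR (S (S j * (2 * n))) * (INR (2 * S j) * A ^ S j * delta)
    * exp (INR (S j) * INR n * y0) <= beta ^ (j * S j).

Let p := cospoly c n.
Let q := cospoly d n.
Let eta := beta ^ j.
Let W y x := Cmod (p y x) ^ 2 + eta ^ 2.

Let eta_pos : 0 < eta.
Proof. apply pow_lt; lra. Qed.

Let W_pos y x : 0 < W y x.
Proof. unfold W; generalize (pow2_ge_0 (Cmod (p y x))); nra. Qed.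

Let delta_pos : 0 <= delta.
Proof. apply Rle_trans with (2 := Hpd 0); apply Cmod_ge_0. Qed.

(** Both powers approximate [phi^(j (j+1))]. *)
Let E_real x : Cmod (Cminus (Cpow (p 0 x) (S j)) (Cpow (q 0 x) j)) <= INR (2 * S j) * A ^ S j * delta.
Proof.
assert (H0 : Rabs 0 <= y0) by (rewrite Rabs_R0; lra).
replace (Cminus (Cpow (p 0 x) (S j)) (Cpow (q 0 x) j)) with
  (Cplus (Cminus (Cpow (p 0 x) (S j)) (Cpow (Cpow (phi x) j) (S j)))
         (Cminus (Cpow (Cpow (phi x) (S j)) j) (Cpow (q 0 x) j)))
  by (rewrite <- !Cpow_mul, (Nat.mul_comm j (S j)); ring).
apply Rle_trans with (1 := Cmod_triangle _ _).
assert (H1 : Cmod (Cminus (Cpow (p 0 x) (S j)) (Cpow (Cpow (phi x) j) (S j)))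
  <= INR (S j) * A ^ S j * delta).
{ apply Cpow_diff_bound; [apply Hp; auto | rewrite Cmod_Cpow; apply Hphij | auto |].
  rewrite <- Cmod_opp; replace (Copp (Cminus (p 0 x) (Cpow (phi x) j)))
    with (Cminus (Cpow (phi x) j) (p 0 x)) by ring; apply Hpd. }
assert (H2 : Cmod (Cminus (Cpow (Cpow (phi x) (S j)) j) (Cpow (q 0 x) j))
  <= INR (S j) * A ^ S j * delta).
{ apply Rle_trans with (INR j * A ^ j * delta).
  - apply Cpow_diff_bound; [rewrite Cmod_Cpow; apply HphiS | apply Hq; auto | auto | apply Hqd].
  - apply Rmult_le_compat_r; auto; apply Rmult_le_compat; try apply pos_INR.
    + apply pow_le; lra.
    + apply le_INR; lia.
    + apply Rle_pow; auto. }
rewrite mult_INR; simpl INR at 1; lra.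
Qed.

Let rho := INR (2 * S j) * A ^ S j * delta.

Let rho_pos : 0 <= rho.
Proof.
unfold rho; apply Rmult_le_pos; auto; apply Rmult_le_pos; [apply pos_INR | apply pow_le; lra].
Qed.

Let E_strip y x : 0 <= y <= y0 ->
  Cmod (Cminus (Cpow (p y x) (S j)) (Cpow (q y x) j)) <= beta ^ (j * S j).
Proof.
intros Hy; apply Rle_trans with (2 := HE).
apply Rle_trans with (1 := strip_bound j n c d rho E_real y x (proj1 Hy)).
apply Rmult_le_compat_l.
- apply Rmult_le_pos; [apply pos_INR | apply rho_pos].
- apply exp_le, Rmult_le_compat_l; [apply Rmult_le_pos; apply pos_INR | lra].
Qed.

Let w y x := sqrt (W y x).

Let w_facts y x : 0 < w y x /\ w y x ^ 2 = W y x /\ Cmod (p y x) <= w y x /\ eta <= w y x.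
Proof.
assert (H : w y x ^ 2 = W y x) by (apply pow2_sqrt; left; apply W_pos).
assert (H0 : 0 < w y x) by (apply sqrt_lt_R0, W_pos).
repeat split; auto; apply pow_le_reg with 2%nat; try lra; auto;
  rewrite H; unfold W; generalize (pow2_ge_0 (Cmod (p y x))); nra.
Qed.

(** [|p|^(j+1)] and the error [beta^(j (j+1)) = eta^(j+1)] are each at most [w^(j+1)], as [w]
    dominates both [|p|] and [eta]. *)
Let q_pow y x : 0 <= y <= y0 -> Cmod (q y x) ^ j <= 2 * w y x ^ S j.
Proof.
intros Hy; destruct (w_facts y x) as (w0 & _ & wp & we).
rewrite <- Cmod_Cpow.
replace (Cpow (q y x) j) with (Cplus (Cpow (p y x) (S j))
  (Copp (Cminus (Cpow (p y x) (S j)) (Cpow (q y x) j)))) by ring.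
apply Rle_trans with (1 := Cmod_triangle _ _).
rewrite Cmod_opp, Cmod_Cpow.
assert (Cmod (p y x) ^ S j <= w y x ^ S j) by (apply pow_incr; split; auto; apply Cmod_ge_0).
assert (beta ^ (j * S j) <= w y x ^ S j)
  by (rewrite pow_mult; apply pow_incr; split; auto; left; apply eta_pos).
generalize (E_strip y x Hy); lra.
Qed.

(** In the [j]-th power of the claim, [eta^j = beta^j eta^(j-1) <= beta^j w^(j-1)]: one factor [eta]
    turns into [beta^j], the others are absorbed by [w]. This dictates the choice [eta = beta^j],
    and the factor [beta] gained here is what makes [dbar u] small in the contour shift. *)
Let q_eta y x : 0 <= y <= y0 -> Cmod (q y x) * eta <= 2 * beta * W y x.
Proof.
intros Hy; destruct (w_facts y x) as (w0 & wW & wp & we).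
rewrite <- wW; apply pow_le_reg with j; auto.
{ apply Rmult_le_pos; [lra | apply pow_le; lra]. }
rewrite !Rpow_mult_distr; fold eta.
rewrite <- pow_mult.
apply Rle_trans with (2 * w y x ^ S j * eta ^ j).
{ apply Rmult_le_compat_r; [apply pow_le; lra | auto]. }
destruct j as [|i] eqn:Ej; [lia|]; rewrite <- Ej in *.
replace (2 * j)%nat with (S j + i)%nat by lia.
rewrite pow_add, Ej; change (eta ^ S i) with (eta * eta ^ i); rewrite <- Ej.
assert (H1 : eta ^ i <= w y x ^ i) by (apply pow_incr; lra).
assert (H2 : 2 <= 2 ^ j) by (apply pow_ge_self; auto; lra).
assert (H3 : 0 < w y x ^ S j) by (apply pow_lt; auto).
assert (H4 : 0 < eta ^ i) by (apply pow_lt; auto).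
replace (2 * w y x ^ S j * (eta * eta ^ i)) with (w y x ^ S j * eta * (2 * eta ^ i)) by ring.
replace (2 ^ j * eta * (w y x ^ S j * w y x ^ i))
  with (w y x ^ S j * eta * (2 ^ j * w y x ^ i)) by ring.
apply Rmult_le_compat_l; [apply Rmult_le_pos; lra|].
apply Rmult_le_compat; lra.
Qed.

Let delta_small : delta <= beta ^ (j * S j).
Proof.
apply Rle_trans with (2 := HE).
fold rho.
assert (H1 : 1 <= exp (INR (S j) * INR n * y0)).
{ rewrite <- exp_0; apply exp_le.
  apply Rmult_le_pos; [apply Rmult_le_pos; apply pos_INR | lra]. }
assert (H2 : 1 <= INR (S (S j * (2 * n)))) by (rewrite S_INR; generalize (pos_INR (S j * (2 * n))); lra).
assert (H3 : delta <= rho).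
{ unfold rho; rewrite <- (Rmult_1_l delta) at 1; apply Rmult_le_compat_r; auto.
  assert (1 <= INR (2 * S j)) by (apply (le_INR 1); lia).
  assert (1 <= A ^ S j) by (apply pow_ge_1; auto).
  nra. }
assert (H4 : rho <= INR (S (S j * (2 * n))) * rho) by nra.
nra.
Qed.

Let u y x := fst (Cmult (Cmult lam (Cmult (q y x) (Ez (INR k) y x))) (Cconj (p y x))) / W y x.

(** On the upper line the decay comes from [Ez k] alone. The quotient stays bounded, since
    [|q|^j <= 2 w^(j+1)] and [w <= 2 A] give [|q| <= 4 A w]. *)
Let u_y1 y x : 0 <= y <= y0 -> Rabs (u y x) <= 4 * A * exp (- INR k * y).
Proof.
intros Hy; destruct (w_facts y x) as (w0 & wW & wp & we).
unfold u, Rdiv; rewrite Rabs_mult, (Rabs_right (/ W y x)).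
2:{ left; apply Rinv_0_lt_compat, W_pos. }
apply Rmult_le_reg_r with (W y x); [apply W_pos|].
rewrite Rmult_assoc, Rinv_l, Rmult_1_r by (generalize (W_pos y x); lra).
apply Rle_trans with (1 := Rmax_l _ (Rabs (snd (Cmult (Cmult lam (Cmult (q y x) (Ez (INR k) y x))) (Cconj (p y x)))))).
apply Rle_trans with (1 := Rmax_Cmod _).
rewrite !Cmod_mult, Hlam, Cmod_Ez, Cmod_conj, Rmult_1_l.
assert (Hqw : Cmod (q y x) <= 4 * A * w y x).
{ apply pow_le_reg with j; auto.
  - apply Rmult_le_pos; lra.
  - apply Rle_trans with (1 := q_pow y x Hy).
    rewrite Rpow_mult_distr; simpl.
    assert (w y x <= 2 * A).
    { apply pow_le_reg with 2%nat; try lra; auto; rewrite wW; unfold W.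
      assert (Cmod (p y x) <= A) by (apply Hp; rewrite Rabs_right; lra).
      assert (eta <= 1) by (unfold eta; rewrite <- (pow1 j); apply pow_incr; lra).
      generalize (Cmod_ge_0 (p y x)); nra. }
    assert (4 * A <= (4 * A) ^ j) by (apply pow_ge_self; auto; lra).
    assert (0 < w y x ^ j) by (apply pow_lt; auto).
    nra. }
rewrite <- wW.
generalize (exp_pos (- INR k * y)) (Cmod_ge_0 (p y x)) (Cmod_ge_0 (q y x)); intros X1 X2 X3.
replace (4 * A * exp (- INR k * y) * w y x ^ 2) with
  ((4 * A * w y x * exp (- INR k * y)) * w y x) by ring.
apply Rmult_le_compat; auto; [apply Rmult_le_pos; lra | apply Rmult_le_compat_r; lra].
Qed.

Let W_conj y x : RtoC (W y x) = Cplus (Cmult (p y x) (Cconj (p y x))) (RtoC (eta ^ 2)).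
Proof.
unfold W; rewrite Cmod_sqr; unfold RtoC, Cplus, Cmult, Cconj; simpl; f_equal; ring.
Qed.

(* [u] regularizes [phi^(j+1) / phi^j]; where [|phi|] is small so is [u]. *)
Let u_phi x : Rabs (u 0 x - fst (Cmult lam (Cmult (phi x) (Ez (INR k) 0 x)))) <= 3 * A * beta.
Proof.
destruct (w_facts 0 x) as (w0 & wW & wp & we).
(* [q conj p - phi W = conj p (q - phi p) - phi eta^2]. The first term is small because [q] and
   [phi p] both approximate [phi^(j+1)]; the second is the cost of the regularization. *)
set (z := Cmult (Cmult lam (Ez (INR k) 0 x))
  (Cminus (Cmult (Cconj (p 0 x)) (Cminus (q 0 x) (Cmult (phi x) (p 0 x))))
          (Cmult (phi x) (RtoC (eta ^ 2))))).
assert (Hz : u 0 x - fst (Cmult lam (Cmult (phi x) (Ez (INR k) 0 x))) = fst z / W 0 x).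
{ unfold u.
  replace (fst (Cmult lam (Cmult (phi x) (Ez (INR k) 0 x)))) with
   (fst (Cmult (Cmult lam (Cmult (phi x) (Ez (INR k) 0 x))) (RtoC (W 0 x))) / W 0 x).
  2:{ unfold Cmult at 1, RtoC; simpl fst; simpl snd; field; generalize (W_pos 0 x); lra. }
  rewrite W_conj; unfold z.
  match goal with |- fst ?a / _ - fst ?b / _ = fst ?e / _ =>
    replace e with (Cminus a b) by ring end.
  unfold Cminus; simpl; field; generalize (W_pos 0 x); lra. }
rewrite Hz; unfold Rdiv; rewrite Rabs_mult, (Rabs_right (/ W 0 x)).
2:{ left; apply Rinv_0_lt_compat, W_pos. }
apply Rmult_le_reg_r with (W 0 x); [apply W_pos|].
rewrite Rmult_assoc, Rinv_l, Rmult_1_r by (generalize (W_pos 0 x); lra).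
apply Rle_trans with (1 := Rmax_l _ (Rabs (snd z))).
apply Rle_trans with (1 := Rmax_Cmod _).
unfold z; rewrite !Cmod_mult, Hlam, Cmod_Ez, Rmult_0_r, exp_0, !Rmult_1_l.
unfold Cminus at 1; apply Rle_trans with (1 := Cmod_triangle _ _).
rewrite Cmod_opp, !Cmod_mult, Cmod_conj, Cmod_R, (Rabs_right (eta ^ 2)) by nra.
generalize (Cmod_ge_0 (phi x)) (Cmod_ge_0 (p 0 x)); intros F0 P0.
assert (Hd : delta <= beta * eta).
{ apply Rle_trans with (1 := delta_small).
  unfold eta; change (beta * beta ^ j) with (beta ^ S j).
  replace (j * S j)%nat with (S j + (j * S j - S j))%nat by nia.
  rewrite pow_add; apply Rle_trans with (beta ^ S j * 1); [|lra].
  apply Rmult_le_compat_l; [apply pow_le; lra|].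
  rewrite <- (pow1 (j * S j - S j)); apply pow_incr; lra. }
assert (B1 : Cmod (Cminus (q 0 x) (Cmult (phi x) (p 0 x))) <= 2 * A * delta).
{ replace (Cminus (q 0 x) (Cmult (phi x) (p 0 x))) with
   (Cplus (Copp (Cminus (Cpow (phi x) (S j)) (q 0 x)))
          (Cmult (phi x) (Cminus (Cpow (phi x) j) (p 0 x)))) by (simpl; ring).
  apply Rle_trans with (1 := Cmod_triangle _ _).
  rewrite Cmod_opp, Cmod_mult.
  generalize (Hpd x) (Hqd x) (Hphi x); intros D1 D2 D3.
  assert (Cmod (phi x) * Cmod (Cminus (Cpow (phi x) j) (p 0 x)) <= A * delta)
    by (apply Rmult_le_compat; auto; apply Cmod_ge_0).
  unfold p, q in *; nra. }
assert (B2 : Cmod (p 0 x) * Cmod (Cminus (q 0 x) (Cmult (phi x) (p 0 x))) <= A * beta * W 0 x).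
{ apply Rle_trans with (Cmod (p 0 x) * (2 * A * (beta * eta))).
  - apply Rmult_le_compat_l; auto; apply Rle_trans with (1 := B1).
    apply Rmult_le_compat_l; lra.
  - replace (Cmod (p 0 x) * (2 * A * (beta * eta))) with
      (A * beta * (2 * Cmod (p 0 x) * eta)) by ring.
    apply Rmult_le_compat_l; [nra|]; unfold W.
    generalize (pow2_ge_0 (Cmod (p 0 x) - eta)); lra. }
(* Where [|phi| > 2 beta], the power [|phi|^j] is at least [2 eta] and dominates [delta]. Hence
   [|phi|^j <= 2 |p|], and [W] is at least a quarter of [|phi|^(2 j)]. *)
assert (B3 : Cmod (phi x) * eta ^ 2 <= 2 * beta * W 0 x).
{ destruct (Rle_lt_dec (Cmod (phi x)) (2 * beta)) as [L|L].
  - apply Rmult_le_compat; try nra; unfold W; nra.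
  - assert (L1 : 2 * eta <= Cmod (phi x) ^ j).
    { apply Rle_trans with ((2 * beta) ^ j); [|apply pow_incr; lra].
      rewrite Rpow_mult_distr; apply Rmult_le_compat_r; [left; apply eta_pos | apply pow_ge_self; auto; lra]. }
    assert (L2 : Cmod (phi x) ^ j <= 2 * Cmod (p 0 x)).
    { assert (Cmod (phi x) ^ j <= Cmod (p 0 x) + delta).
      { rewrite <- Cmod_Cpow.
        replace (Cpow (phi x) j) with (Cplus (p 0 x) (Cminus (Cpow (phi x) j) (p 0 x))) by ring.
        apply Rle_trans with (1 := Cmod_triangle _ _), Rplus_le_compat_l, Hpd. }
      assert (beta * eta <= eta) by nra; lra. }
    assert (L3 : (Cmod (phi x) ^ j) ^ 2 <= 4 * W 0 x).
    { apply Rle_trans with ((2 * Cmod (p 0 x)) ^ 2).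
      - apply pow_incr; split; auto; apply pow_le; auto.
      - unfold W; nra. }
    apply Rmult_le_reg_l with 4; [lra|].
    apply Rle_trans with (2 * beta * (Cmod (phi x) ^ j) ^ 2); [| nra].
    assert (Hi : exists i, j = S i) by (exists (j - 1)%nat; lia).
    destruct Hi as [i Hi].
    assert (Ephi : Cmod (phi x) ^ j = Cmod (phi x) * Cmod (phi x) ^ i) by (rewrite Hi; auto).
    assert (Eeta : eta = beta * beta ^ i) by (unfold eta; rewrite Hi; auto).
    assert (L4 : 0 <= beta ^ i <= Cmod (phi x) ^ i).
    { split; [apply pow_le; lra | apply pow_incr; lra]. }
    assert (L5 : (2 * eta) * (2 * eta) <= (2 * beta * Cmod (phi x) ^ i) * Cmod (phi x) ^ j).
    { apply Rmult_le_compat; auto; try (generalize eta_pos; lra); rewrite Eeta; nra. }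
    assert (L6 : Cmod (phi x) * ((2 * eta) * (2 * eta)) <=
      Cmod (phi x) * ((2 * beta * Cmod (phi x) ^ i) * Cmod (phi x) ^ j))
      by (apply Rmult_le_compat_l; auto).
    apply Rle_trans with (Cmod (phi x) * ((2 * eta) * (2 * eta))); [right; ring|].
    apply Rle_trans with (1 := L6); right; rewrite Ephi; ring. }
assert (0 <= (A - 1) * (beta * W 0 x)).
{ apply Rmult_le_pos; [lra | apply Rmult_le_pos; [lra | left; apply W_pos]]. }
lra.
Qed.

(** The three terms come from replacing [phi] by [u] on the real line, from [u] on the upper line,
    and from the shift between them. The shift stops at height [y0 / 2], because the convexity
    argument needs [p] bounded from [- y0 / 2] up to [y0]. The unit [lam] lets a statement about
    real integrals reach both the real and the imaginary part of a coefficient. *)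
Lemma core_estimate :
  Rabs (RInt (fun x => fst (Cmult lam (Cmult (phi x) (Ez (INR k) 0 x)))) 0 (2 * PI))
   <= 2 * PI * (3 * A * beta) + 2 * PI * (4 * A * exp (- INR k * (y0 / 2)))
      + PI * (2 * beta) * (2 + ln ((A ^ 2 + 1) / eta ^ 2)).
Proof.
generalize PI_RGT_0; intros HPI.
assert (nq : periodic_holo (fun y x => Cmult lam (Cmult (q y x) (Ez (INR k) y x)))).
{ apply periodic_holo_mult; [apply periodic_holo_const | apply periodic_holo_mult; [apply periodic_holo_cospoly |]].
  apply periodic_holo_Ez; intros; apply Ez_per. }
destruct (contour_shift_C p _ eta (2 * beta) (y0 / 2) (A ^ 2 + 1) (periodic_holo_cospoly c n) nq)
  as [cu Hu]; auto; try lra.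
- intros y x Hy; rewrite !Cmod_mult, Hlam, Cmod_Ez, Rmult_1_l.
  apply Rle_trans with (2 := q_eta y x ltac:(lra)).
  apply Rmult_le_compat_r; [lra|].
  rewrite <- (Rmult_1_r (Cmod (q y x))) at 2; apply Rmult_le_compat_l; [apply Cmod_ge_0|].
  rewrite <- exp_0; apply exp_le; generalize (pos_INR k); nra.
- intros y x Hy; assert (Cmod (p y x) <= A) by (apply Hp, Rabs_le; lra).
  assert (eta <= 1) by (unfold eta; rewrite <- (pow1 j); apply pow_incr; lra).
  generalize (Cmod_ge_0 (p y x)); nra.
- change (Rabs (RInt (u 0) 0 (2 * PI) - RInt (u (y0 / 2)) 0 (2 * PI))
   <= PI * (2 * beta) * (2 + ln ((A ^ 2 + 1) / eta ^ 2))) in Hu.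
  change (cont2 u) in cu.
  set (v := fun x => fst (Cmult lam (Cmult (phi x) (Ez (INR k) 0 x)))) in *.
  assert (ev : ex_RInt v 0 (2 * PI)) by (apply (cont2_ex_RInt (fun _ x => v x) 0); auto).
  assert (eu : forall y, ex_RInt (u y) 0 (2 * PI)) by (intros; apply cont2_ex_RInt; auto).
  assert (bnd : forall g M, ex_RInt g 0 (2 * PI) -> (forall x, Rabs (g x) <= M) ->
     Rabs (RInt g 0 (2 * PI)) <= 2 * PI * M).
  { intros g M Hg HM; replace (2 * PI * M) with ((2 * PI - 0) * M) by ring.
    apply abs_RInt_le_const; auto; lra. }
  assert (B1 : Rabs (RInt (u 0) 0 (2 * PI) - RInt v 0 (2 * PI)) <= 2 * PI * (3 * A * beta)).
  { change (RInt (u 0) 0 (2 * PI) - RInt v 0 (2 * PI)) with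
      (minus (RInt (u 0) 0 (2 * PI)) (RInt v 0 (2 * PI))).
    rewrite <- RInt_minus; auto.
    apply bnd; [apply (ex_RInt_minus (u 0) v); auto | intros x; apply u_phi]. }
  assert (B2 : Rabs (RInt (u (y0 / 2)) 0 (2 * PI)) <= 2 * PI * (4 * A * exp (- INR k * (y0 / 2)))).
  { apply bnd; auto; intros x; apply u_y1; lra. }
  replace (RInt v 0 (2 * PI)) with (- (RInt (u 0) 0 (2 * PI) - RInt v 0 (2 * PI))
    + (RInt (u (y0 / 2)) 0 (2 * PI) + (RInt (u 0) 0 (2 * PI) - RInt (u (y0 / 2)) 0 (2 * PI)))) by ring.
  apply Rle_trans with (1 := Rabs_triang _ _); rewrite Rabs_Ropp.
  generalize (Rabs_triang (RInt (u (y0 / 2)) 0 (2 * PI))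
    (RInt (u 0) 0 (2 * PI) - RInt (u (y0 / 2)) 0 (2 * PI))); lra.
Qed.

End Core.

(** * Weight sequences *)

Lemma weight_pos M : weight_sequence M -> forall k, 0 < M k.
Proof.
intros (mu & _ & Hp & _ & HM & _) k; rewrite HM.
induction k as [|k IH]; simpl; [lra | apply Rmult_lt_0_compat; auto].
Qed.

Lemma weight_0 M : weight_sequence M -> M 0%nat = 1.
Proof. intros (mu & _ & _ & _ & HM & _); rewrite HM; auto. Qed.

Lemma fact_pos k : 0 < INR (fact k).
Proof. apply INR_fact_lt_0. Qed.

Lemma lowr_pos M : (forall k, 0 < M k) -> forall k, 0 < lowr M k.
Proof. intros H k; apply Rdiv_lt_0_compat; auto; apply fact_pos. Qed.

Lemma finite_bound (f : nat -> R) N : exists K, 1 <= K /\ forall k, (k < N)%nat -> f k <= K.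
Proof.
induction N as [|N [K [HK H]]]; [exists 1; split; [lra | intros; lia]|].
exists (Rmax K (f N)); split; [apply Rle_trans with (1 := HK), Rmax_l |].
intros k Hk; destruct (Nat.eq_dec k N) as [->|]; [apply Rmax_r|].
apply Rle_trans with (2 := Rmax_l _ _), H; lia.
Qed.

Lemma Rpower_root x k : 0 < x -> (1 <= k)%nat -> Rpower x (/ INR k) ^ k = x.
Proof.
intros Hx Hk; rewrite <- Rpower_pow by apply exp_pos.
rewrite Rpower_mult, Rinv_l, Rpower_1; auto.
apply not_0_INR; lia.
Qed.

Lemma root_to_infty_dominates a : (forall k, 0 < a k) -> root_to_infty a ->
  forall A, 0 < A -> exists K, 1 <= K /\ forall k, A ^ k <= K * a k.
Proof.
intros Ha Hr A HA.
destruct (proj2 (is_lim_seq_spec _ _) Hr A) as [N HN].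
(* All indices up to [N] go into the constant, so in the other case [k >= 1] and [/ INR k] is a true
   reciprocal. *)
destruct (finite_bound (fun k => A ^ k / a k) (S N)) as [K [HK HKk]].
exists K; split; auto; intros k.
destruct (le_lt_dec (S N) k) as [L|L].
- apply Rle_trans with (a k); [|generalize (Ha k); nra].
  rewrite <- (Rpower_root (a k) k) by (auto; lia).
  apply pow_incr; split; [lra | left; apply HN; lia].
- apply Rmult_le_reg_r with (/ a k); [apply Rinv_0_lt_compat; auto|].
  replace (K * a k * / a k) with K by (field; generalize (Ha k); lra).
  apply (HKk k L).
Qed.

Lemma least_nat (P : nat -> Prop) : (exists k, P k) -> exists k, is_min_nat P k.
Proof.
intros [k Hk]; revert Hk; induction k as [k IH] using (well_founded_induction lt_wf).
intros Hk; destruct (classic (exists i, (i < k)%nat /\ P i)) as [[i [Hi HP]]|H].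
- apply (IH i); auto.
- exists k; split; auto; intros i HP.
  destruct (le_lt_dec k i); auto; elim H; exists i; auto.
Qed.

Lemma argmin_nat (f : nat -> R) N : exists k, forall i, (i <= N)%nat -> f k <= f i.
Proof.
induction N as [|N [k Hk]].
- exists 0%nat; intros i Hi; replace i with 0%nat by lia; lra.
- destruct (Rle_lt_dec (f k) (f (S N))) as [L|L].
  + exists k; intros i Hi; destruct (Nat.eq_dec i (S N)) as [->|]; auto; apply Hk; lia.
  + exists (S N); intros i Hi; destruct (Nat.eq_dec i (S N)) as [->|]; [lra|].
    apply Rle_trans with (f k); [lra | apply Hk; lia].
Qed.

Lemma two_pow_unbounded K : exists N, forall k, (N <= k)%nat -> K < 2 ^ k.
Proof.
destruct (Pow_x_infinity 2 ltac:(rewrite Rabs_right; lra) (K + 1)) as [N HN].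
exists N; intros k Hk; generalize (HN k Hk).
rewrite Rabs_right by (apply Rle_ge, pow_le; lra); lra.
Qed.

(** * Regularity and log-convex majorants *)

Section Gamma.

Variable m : nat -> R.
Hypothesis Hm : forall k, 0 < m k.
Hypothesis Hr : root_to_infty m.

(** The regularity condition speaks about minimizing indices as a relation, so their existence has
    to be supplied before it yields anything. Here [m k s^k] eventually exceeds [m 0], which
    confines the minimum to finitely many indices. *)
Lemma GammaBar_exists s : 0 < s -> exists k, GammaBar m s k.
Proof.
intros Hs; apply least_nat.
destruct (root_to_infty_dominates m Hm Hr (2 / s)) as [K [HK HKm]]; [apply Rdiv_lt_0_compat; lra|].
destruct (two_pow_unbounded (K * m 0%nat)) as [N HN].
destruct (argmin_nat (fun k => m k * s ^ k) N) as [k Hk].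
exists k; intros i; destruct (le_lt_dec i N) as [L|L]; [apply Hk; auto|].
apply Rle_trans with (1 := Hk 0%nat ltac:(lia)); simpl; rewrite Rmult_1_r.
apply Rmult_le_reg_l with K; [lra|].
left; apply Rlt_le_trans with (1 := HN i ltac:(lia)).
replace (2 ^ i) with ((2 / s) ^ i * s ^ i) by (rewrite <- Rpow_mult_distr; f_equal; field; lra).
rewrite <- Rmult_assoc; apply Rmult_le_compat_r; auto; apply pow_le; lra.
Qed.

(** Otherwise all quotients stay below [1 / t] and [m] grows at most geometrically. *)
Lemma GammaUnder_exists t : 0 < t -> exists k, GammaUnder m t k.
Proof.
intros Ht; apply least_nat; apply NNPP; intros Hn.
assert (H : forall k, m k <= m 0%nat * (/ t) ^ k).
{ induction k as [|k IH]; simpl; [lra|].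
  assert (m (S k) / m k < / t).
  { apply Rnot_ge_lt; intros H; apply Hn; exists k; auto. }
  replace (m (S k)) with (m (S k) / m k * m k) by (field; generalize (Hm k); lra).
  apply Rle_trans with (/ t * m k).
  - apply Rmult_le_compat_r; [left; auto | lra].
  - rewrite (Rmult_comm (/ t) (_ ^ _)), <- Rmult_assoc, (Rmult_comm (/ t)).
    apply Rmult_le_compat_r; auto; left; apply Rinv_0_lt_compat, Ht. }
destruct (root_to_infty_dominates m Hm Hr (2 / t)) as [K [HK HKm]]; [apply Rdiv_lt_0_compat; lra|].
destruct (two_pow_unbounded (K * m 0%nat)) as [N HN].
generalize (HN N (le_n _)) (HKm N) (H N).
unfold Rdiv; rewrite Rpow_mult_distr.
assert (0 < (/ t) ^ N) by (apply pow_lt, Rinv_0_lt_compat, Ht).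
nra.
Qed.

(** The lowercase sequences need not be log-convex. [hat], the product of the running maxima of the
    quotients, is a log-convex sequence, and it majorizes [m] when [m 0 = 1]. *)
Fixpoint rmax (i : nat) : R :=
  match i with
  | O => m 1%nat / m 0%nat
  | S i' => Rmax (rmax i') (m (S i) / m i)
  end.

Fixpoint hat (l : nat) : R :=
  match l with O => 1 | S l' => hat l' * rmax l' end.

Lemma rmax_pos i : 0 < rmax i.
Proof.
induction i as [|i IH]; simpl; [apply Rdiv_lt_0_compat; auto |].
apply Rlt_le_trans with (1 := IH), Rmax_l.
Qed.

Lemma rmax_ge i : m (S i) / m i <= rmax i.
Proof. destruct i; simpl; [lra | apply Rmax_r]. Qed.

Lemma rmax_mono i k : (i <= k)%nat -> rmax i <= rmax k.
Proof.
induction 1 as [|k _ IH]; [lra|]; apply Rle_trans with (1 := IH); simpl; apply Rmax_l.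
Qed.

Lemma rmax_attained i : exists p, (p <= i)%nat /\ m (S p) / m p = rmax i.
Proof.
induction i as [|i [p [Hp E]]]; [exists 0%nat; auto|].
simpl; destruct (Rle_dec (rmax i) (m (S (S i)) / m (S i))) as [L|L].
- exists (S i); rewrite Rmax_right; auto.
- exists p; rewrite Rmax_left by lra; auto.
Qed.

Lemma hat_pos l : 0 < hat l.
Proof.
induction l as [|l IH]; simpl; [lra | apply Rmult_lt_0_compat; auto using rmax_pos].
Qed.

Lemma le_hat l : m 0%nat = 1 -> m l <= hat l.
Proof.
intros H0; induction l as [|l IH]; simpl; [lra|].
replace (m (S l)) with (m l * (m (S l) / m l)) by (field; generalize (Hm l); lra).
apply Rmult_le_compat; auto using rmax_ge; left; auto.
apply Rdiv_lt_0_compat; auto.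
Qed.

Lemma hat_le_pow l d i : (l + d <= S i)%nat -> hat (l + d) <= hat l * rmax i ^ d.
Proof.
intros Hd; induction d as [|d IH]; [rewrite Nat.add_0_r; simpl; lra|].
replace (l + S d)%nat with (S (l + d)) by lia; simpl.
rewrite (Rmult_comm (rmax i)), <- Rmult_assoc.
apply Rmult_le_compat; [left; apply hat_pos | left; apply rmax_pos | apply IH; lia |].
apply rmax_mono; lia.
Qed.

(** Monotonicity of [hat l ^ (1 / l)], written without roots; the induction step uses that [hat l]
    is at most the [l]-th power of any later running maximum. *)
Lemma hat_log_convex l d : hat l ^ (l + d) <= hat (l + d) ^ l.
Proof.
induction d as [|d IH]; [rewrite Nat.add_0_r; lra|].
replace (l + S d)%nat with (S (l + d)) by lia; simpl.
rewrite Rpow_mult_distr, Rmult_comm.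
apply Rmult_le_compat; auto; [apply pow_le | |]; try (left; apply hat_pos).
generalize (hat_le_pow 0 l (l + d) ltac:(lia)); simpl; lra.
Qed.

End Gamma.

(* Taking [t = 1 / rmax i] in the regularity condition compares the running
   maxima of [m (i+1) / m i] with the slopes of the log-convex minorant of [n]. *)
Lemma regular_hat m n C : (forall k, 0 < m k) -> (forall k, 0 < n k) ->
  root_to_infty m -> root_to_infty n -> n 0%nat = 1 -> 1 <= C ->
  (forall t, t > 0 -> GammaBar_le_GammaUnder n (C * t) m t) ->
  forall l, hat m l <= C ^ l * n l.
Proof.
intros Hm Hn Rm Rn n0 HC H l.
induction l as [l IH] using (well_founded_induction lt_wf).
destruct l as [|i]; [simpl; lra|].
set (t := / rmax m i).
assert (Ht : 0 < t) by (apply Rinv_0_lt_compat, rmax_pos, Hm).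
destruct (GammaBar_exists n Hn Rn (C * t)) as [kb Hkb]; [nra|].
destruct (GammaUnder_exists m Hm Rm t Ht) as [ku Hku].
(* The quotient reaches [1 / t] at some index [p <= i], so both Gamma values are at most [i].
   Minimality of [kb] tested against [S i], with the induction hypothesis at [kb], then gives the
   claim. *)
assert (Hku_i : (ku <= i)%nat).
{ destruct (rmax_attained m i) as [p [Hp E]].
  apply Nat.le_trans with p; auto; apply (proj2 Hku).
  unfold t; rewrite Rinv_inv, E; lra. }
assert (Hk : (kb <= i)%nat) by (apply Nat.le_trans with ku; auto; apply (H t Ht); auto).
generalize (proj1 Hkb (S i)); intros Hmin.
generalize (IH kb ltac:(lia)); intros IHk.
set (d := (S i - kb)%nat).
assert (Ed : S i = (kb + d)%nat) by (unfold d; lia).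
rewrite Ed in *.
apply Rle_trans with (1 := hat_le_pow m Hm kb d i ltac:(lia)).
apply Rle_trans with (C ^ kb * n kb * rmax m i ^ d).
{ apply Rmult_le_compat_r; auto; apply pow_le; left; apply rmax_pos; auto. }
apply Rmult_le_reg_r with (t ^ (kb + d)); [apply pow_lt; auto|].
replace (C ^ (kb + d) * n (kb + d)%nat * t ^ (kb + d)) with
  (n (kb + d)%nat * (C * t) ^ (kb + d)) by (rewrite Rpow_mult_distr; ring).
apply Rle_trans with (2 := Hmin); right.
rewrite Rpow_mult_distr, pow_add.
replace (C ^ kb * n kb * rmax m i ^ d * (t ^ kb * t ^ d)) with
 (n kb * (C ^ kb * t ^ kb) * (rmax m i ^ d * t ^ d)) by ring.
rewrite <- (Rpow_mult_distr (rmax m i)); unfold t at 2; rewrite Rinv_r, pow1; [ring|].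
generalize (rmax_pos m Hm i); lra.
Qed.

Lemma ln_fact_le k : (1 <= k)%nat -> ln (INR (fact k)) <= INR k * ln (INR k).
Proof.
induction 1 as [|k Hk IH]; [simpl; rewrite ln_1; lra|].
rewrite fact_simpl, mult_INR, ln_mult;
  [| apply lt_0_INR; lia | apply fact_pos].
assert (0 < INR k) by (apply lt_0_INR; lia).
assert (ln (INR k) <= ln (INR (S k))) by (apply ln_le; [auto | apply le_INR; lia]).
rewrite (S_INR k) at 2; nra.
Qed.

Lemma ln_le_sub x : 0 < x -> ln x <= x - 1.
Proof.
intros Hx; rewrite <- (ln_exp (x - 1)); apply ln_le; auto.
generalize (exp_ineq1_le (x - 1)); lra.
Qed.

Lemma ln_fact_ge k : (1 <= k)%nat -> INR k * ln (INR k) - INR k <= ln (INR (fact k)).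
Proof.
induction 1 as [|k Hk IH]; [simpl; rewrite ln_1; lra|].
rewrite fact_simpl, mult_INR, ln_mult;
  [| apply lt_0_INR; lia | apply fact_pos].
assert (Hk0 : 0 < INR k) by (apply lt_0_INR; lia).
assert (H : INR k * (ln (INR (S k)) - ln (INR k)) <= 1).
{ rewrite <- ln_div by (try apply lt_0_INR; lia).
  generalize (ln_le_sub (INR (S k) / INR k) ltac:(apply Rdiv_lt_0_compat; [apply lt_0_INR; lia | auto])).
  rewrite S_INR; replace ((INR k + 1) / INR k - 1) with (/ INR k) by (field; lra).
  intros H; apply Rle_trans with (INR k * / INR k); [apply Rmult_le_compat_l; lra|].
  rewrite Rinv_r; lra. }
rewrite S_INR in *; lra.
Qed.

Lemma ln_pow_nat x n : 0 < x -> ln (x ^ n) = INR n * ln x.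
Proof.
intros Hx; rewrite <- Rpower_pow by auto; unfold Rpower; rewrite ln_exp; auto.
Qed.

(* [M_i^(1/i) / i <= C e N_l^(1/l) / l] for [i <= l], in logarithmic form *)
Definition almost_increasing (M N : nat -> R) (C : R) : Prop :=
  forall i l, (1 <= i <= l)%nat ->
    INR l * ln (M i) <= INR i * (INR l * (ln (INR i) - ln (INR l) + ln C + 1) + ln (N l)).

(** The chain is [m_i^(1/i) <= hat_i^(1/i) <= hat_l^(1/l) <= C n_l^(1/l)]; turning factorials into
    powers by a crude Stirling bound costs the factor [e]. *)
Lemma regular_almost_increasing M N C :
  weight_sequence M -> weight_sequence N ->
  root_to_infty (lowr M) -> root_to_infty (lowr N) -> 1 <= C ->
  (forall t, t > 0 -> GammaBar_le_GammaUnder (lowr N) (C * t) (lowr M) t) ->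
  almost_increasing M N C.
Proof.
intros WM WN RM RN HC H i l Hil.
generalize (weight_pos M WM) (weight_pos N WN); intros PM PN.
generalize (lowr_pos M PM) (lowr_pos N PN); intros pm pn.
assert (m0 : lowr M 0%nat = 1) by (unfold lowr; rewrite weight_0; auto; simpl; field).
assert (n0 : lowr N 0%nat = 1) by (unfold lowr; rewrite weight_0; auto; simpl; field).
assert (Hh : lowr M i ^ l <= (C ^ l * lowr N l) ^ i).
{ apply Rle_trans with (hat (lowr M) i ^ l).
  - apply pow_incr; split; [left; auto | apply le_hat; auto].
  - replace l with (i + (l - i))%nat by lia.
    apply Rle_trans with (1 := hat_log_convex _ pm i (l - i)).
    apply pow_incr; split; [left; apply hat_pos; auto |].
    apply (regular_hat (lowr M) (lowr N)); auto. }
apply ln_le in Hh; [| apply pow_lt; auto].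
rewrite !ln_pow_nat in Hh;
  [| apply Rmult_lt_0_compat; auto; apply pow_lt; lra | auto].
rewrite ln_mult, ln_pow_nat in Hh; [| lra | apply pow_lt; lra | auto].
unfold lowr in Hh; unfold Rdiv in Hh.
rewrite !ln_mult, !ln_Rinv in Hh; auto using fact_pos;
  try (apply Rinv_0_lt_compat, fact_pos).
generalize (ln_fact_le i ltac:(lia)) (ln_fact_ge l ltac:(lia)); intros F1 F2.
assert (0 < INR i) by (apply lt_0_INR; lia).
assert (0 < INR l) by (apply lt_0_INR; lia).
assert (INR l * ln (INR (fact i)) <= INR l * (INR i * ln (INR i))) by (apply Rmult_le_compat_l; lra).
assert (INR i * (INR l * ln (INR l) - INR l) <= INR i * ln (INR (fact l))) by (apply Rmult_le_compat_l; lra).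
lra.
Qed.

(** * Iterated moderate growth *)

Lemma mg_finite_bound M N : (forall k, 0 < M k) -> (forall k, 0 < N k) -> mg_finite M N ->
  exists C, 1 <= C /\ forall j k, (1 <= j + k)%nat -> M (j + k)%nat <= C ^ (j + k) * (N j * N k).
Proof.
intros PM PN [C0 H]; exists (Rmax 1 C0); split; [apply Rmax_l|].
intros j k Hjk.
assert (P : 0 < N j * N k) by (apply Rmult_lt_0_compat; auto).
apply Rmult_le_reg_r with (/ (N j * N k)); [apply Rinv_0_lt_compat, P|].
rewrite Rmult_assoc, Rinv_r, Rmult_1_r by lra.
rewrite <- (Rpower_root (M (j + k)%nat * / (N j * N k)) (j + k)); auto.
- apply pow_incr; split; [left; apply exp_pos|].
  apply Rle_trans with (2 := Rmax_r _ _), H; auto.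
- apply Rmult_lt_0_compat; auto; apply Rinv_0_lt_compat, P.
Qed.

(** The factor is a power of two because moderate growth is applied [p] times, each time with two
    equal indices. *)
Definition doubling (p : nat) (M N : nat -> R) : Prop :=
  exists C, 1 <= C /\ forall l, M (2 ^ p * l)%nat <= C ^ (2 ^ p * l) * N l ^ (2 ^ p).

Lemma doubling_0 M : doubling 0 M M.
Proof.
exists 1; split; [lra|]; intros l; rewrite pow1; simpl.
rewrite Nat.add_0_r; lra.
Qed.

Lemma doubling_S p M N N' : weight_sequence M -> weight_sequence N -> weight_sequence N' ->
  mg_finite M N -> doubling p N N' -> doubling (S p) M N'.
Proof.
intros WM WN WN' Hmg [D [HD H]].
destruct (mg_finite_bound M N (weight_pos M WM) (weight_pos N WN) Hmg) as [C [HC HM]].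
exists (C * D); split; [nra|]; intros l.
(* The moderate growth bound excludes the index sum 0. *)
destruct (Nat.eq_dec l 0) as [->|Hl].
{ rewrite Nat.mul_0_r, (weight_0 M WM), (weight_0 N' WN'), pow1; simpl; lra. }
assert (E : (2 ^ S p * l = 2 ^ p * l + 2 ^ p * l)%nat) by (rewrite Nat.pow_succ_r'; ring).
assert (Hpos : (1 <= 2 ^ p * l)%nat).
{ generalize (Nat.pow_nonzero 2 p ltac:(lia)); intros; nia. }
rewrite E; apply Rle_trans with (1 := HM (2 ^ p * l)%nat (2 ^ p * l)%nat ltac:(lia)).
rewrite Rpow_mult_distr, Rmult_assoc; apply Rmult_le_compat_l; [apply pow_le; lra|].
replace (2 ^ S p)%nat with (2 ^ p + 2 ^ p)%nat by (simpl; lia).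
rewrite !pow_add.
replace (D ^ (2 ^ p * l) * D ^ (2 ^ p * l) * (N' l ^ (2 ^ p) * N' l ^ (2 ^ p)))
 with ((D ^ (2 ^ p * l) * N' l ^ (2 ^ p)) * (D ^ (2 ^ p * l) * N' l ^ (2 ^ p))) by ring.
generalize (weight_pos N WN (2 ^ p * l)%nat); intros HN.
apply Rmult_le_compat; auto; lra.
Qed.

(* [M] controls the powers of [f] and [M'] the function [f] itself. *)
Definition linked (p : nat) (M M' : nat -> R) : Prop :=
  exists N N1, weight_sequence N /\ weight_sequence N1 /\
    (exists C, 1 <= C /\ almost_increasing M N C) /\ doubling p N N1 /\ mg_finite N1 M'.

Lemma doubling_R W : weight_matrix W -> R_moderate_growth W ->
  forall p M, W M -> exists N, W N /\ doubling p M N.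
Proof.
intros (_ & HW & _) Hmg; induction p as [|p IH]; intros M WM.
- exists M; split; auto; apply doubling_0.
- destruct (Hmg M WM) as (N & WN & HN); destruct (IH N WN) as (N' & WN' & H).
  exists N'; split; auto; apply doubling_S with N; auto.
Qed.

Lemma doubling_B W : weight_matrix W -> B_moderate_growth W ->
  forall p N, W N -> exists M, W M /\ doubling p M N.
Proof.
intros (_ & HW & _) Hmg; induction p as [|p IH]; intros N WN.
- exists N; split; auto; apply doubling_0.
- destruct (IH N WN) as (N0 & WN0 & H); destruct (Hmg N0 WN0) as (M & WM & HM).
  exists M; split; auto; apply doubling_S with N0; auto.
Qed.

(** The chain [M], [N], [N1], [M'] is built from left to right under the Roumieu quantifiers and
    from right to left under the Beurling ones; the inequalities along it are the same. *)
Lemma linked_R W : weight_matrix W -> R_regular W -> R_moderate_growth W ->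
  forall p M, W M -> exists M', W M' /\ linked p M M'.
Proof.
intros HW (Hr & _ & Hreg) Hmg p M WM; generalize (proj1 (proj2 HW)); intros Hw.
destruct (Hreg M WM) as (N & WN & C & HC & H).
destruct (doubling_R W HW Hmg p N WN) as (N1 & WN1 & HN1).
destruct (Hmg N1 WN1) as (M' & WM' & HM').
exists M'; split; auto; exists N, N1; repeat split; auto.
exists C; split; [lra|]; apply regular_almost_increasing; auto; lra.
Qed.

Lemma linked_B W : weight_matrix W -> B_regular W -> B_moderate_growth W ->
  forall p M', W M' -> exists M, W M /\ linked p M M'.
Proof.
intros HW (Hr & _ & Hreg) Hmg p M' WM'; generalize (proj1 (proj2 HW)); intros Hw.
destruct (Hmg M' WM') as (N1 & WN1 & HN1).
destruct (doubling_B W HW Hmg p N1 WN1) as (N & WN & HN).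
destruct (Hreg N WN) as (M & WM & C & HC & H).
exists M; split; auto; exists N, N1; repeat split; auto.
exists C; split; [lra|]; apply regular_almost_increasing; auto; lra.
Qed.

(** * Chebyshev polynomials and cosine series *)

(* [Td k l] is the [l]-th derivative of the [k]-th Chebyshev polynomial. *)
Fixpoint Td (k l : nat) (x : R) : R :=
  match k with
  | O => match l with O => 1 | S _ => 0 end
  | S k' =>
    match k' with
    | O => match l with O => x | S O => 1 | S (S _) => 0 end
    | S k'' => 2 * x * Td k' l x + 2 * INR l * Td k' (pred l) x - Td k'' l x
    end
  end.

Lemma nat_ind2 (P : nat -> Prop) : P 0%nat -> P 1%nat ->
  (forall k, P k -> P (S k) -> P (S (S k))) -> forall k, P k.
Proof.
intros H0 H1 H k; enough (P k /\ P (S k)) by tauto.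
induction k as [|k [A B]]; auto.
Qed.

Lemma Td_SS k l x :
  Td (S (S k)) l x = 2 * x * Td (S k) l x + 2 * INR l * Td (S k) (pred l) x - Td k l x.
Proof. reflexivity. Qed.

Lemma is_derive_Td k : forall l x, is_derive (Td k l) x (Td k (S l) x).
Proof.
induction k as [| |k IH0 IH1] using nat_ind2; intros l x.
- destruct l; apply (is_derive_const (V := R_NormedModule)).
- destruct l as [|[|l]]; try apply (is_derive_const (V := R_NormedModule)).
  apply (is_derive_id (K := R_AbsRing)).
- replace (Td (S (S k)) (S l) x) with (2 * Td (S k) l x + 2 * x * Td (S k) (S l) x
    + 2 * INR l * Td (S k) (S (pred l)) x - Td k (S l) x).
  + apply is_derive_ext with
      (fun x => 2 * x * Td (S k) l x + 2 * INR l * Td (S k) (pred l) x - Td k l x);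
      [intros; reflexivity|].
    generalize (IH1 l x) (IH1 (pred l) x) (IH0 l x).
    generalize (Td (S k) l) (Td (S k) (pred l)) (Td k l)
      (Td (S k) (S l) x) (Td (S k) (S (pred l)) x) (Td k (S l) x).
    intros f g h f' g' h' D1 D2 D3; auto_derive.
    * repeat split; eexists; eassumption.
    * derw D1; derw D2; derw D3; ring.
  (* At [l = 0] the default [pred 0 = 0] is harmless, since it comes with the factor [INR 0]. *)
  + rewrite Td_SS, S_INR; destruct l as [|l]; simpl Init.Nat.pred; [change (INR 0) with 0|]; ring.
Qed.

Lemma Td_cos k : forall t, Td k 0 (cos t) = cos (INR k * t).
Proof.
induction k as [| |k IH0 IH1] using nat_ind2; intros t.
- simpl; rewrite Rmult_0_l, cos_0; auto.
- simpl; rewrite Rmult_1_l; auto.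
- rewrite Td_SS, IH0, IH1.
  replace (INR (S (S k)) * t) with (INR (S k) * t + t) by (rewrite (S_INR (S k)); ring).
  replace (INR k * t) with (INR (S k) * t - t) by (rewrite (S_INR k); ring).
  rewrite cos_plus, cos_minus; simpl INR; ring.
Qed.

Lemma derive_cos_mult k t : is_derive (fun t => cos (INR k * t)) t (- INR k * sin (INR k * t)).
Proof. auto_derive; auto; ring. Qed.

Lemma is_derive_comp_cos (f : R -> R) f' t : is_derive f (cos t) f' ->
  is_derive (fun t => f (cos t)) t (- sin t * f').
Proof.
intros H; apply (is_derive_comp (V := R_NormedModule) f cos t f' (- sin t) H).
apply is_derive_cos.
Qed.

Lemma Td1_sin k t : sin t * Td k 1 (cos t) = INR k * sin (INR k * t).
Proof.
assert (E : - sin t * Td k 1 (cos t) = - INR k * sin (INR k * t)).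
{ rewrite <- (is_derive_unique _ _ _ (is_derive_comp_cos _ _ t (is_derive_Td k 0 (cos t)))).
  rewrite <- (is_derive_unique _ _ _ (derive_cos_mult k t)).
  apply Derive_ext; intros; apply Td_cos. }
lra.
Qed.

(** The Chebyshev equation, obtained by differentiating [Td1_sin] once more in [t]. *)
Lemma Td_ode0 k x : -1 <= x <= 1 ->
  (1 - x ^ 2) * Td k 2 x - x * Td k 1 x + INR k ^ 2 * Td k 0 x = 0.
Proof.
intros Hx; rewrite <- (cos_acos x Hx); set (t := acos x).
assert (D1 : is_derive (fun t => sin t * Td k 1 (cos t)) t
  (cos t * Td k 1 (cos t) + sin t * (- sin t * Td k 2 (cos t)))).
{ apply (is_derive_Rmult sin (fun t => Td k 1 (cos t)));
    [apply is_derive_sin | apply is_derive_comp_cos, is_derive_Td]. }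
assert (D2 : is_derive (fun t => INR k * sin (INR k * t)) t (INR k * (INR k * cos (INR k * t)))).
{ auto_derive; auto; ring. }
assert (D3 : cos t * Td k 1 (cos t) + sin t * (- sin t * Td k 2 (cos t))
  = INR k * (INR k * cos (INR k * t))).
{ rewrite <- (is_derive_unique _ _ _ D1), <- (is_derive_unique _ _ _ D2).
  apply Derive_ext, Td1_sin. }
clear D1; rename D3 into D1.
rewrite <- Td_cos in D1.
generalize (sin2_cos2 t); unfold Rsqr; intros E.
replace (1 - cos t ^ 2) with (sin t * sin t) by (rewrite <- E; ring).
lra.
Qed.

(** The induction differentiates the identity, which must therefore hold in a neighbourhood of [x];
    hence the open interval. *)
Lemma Td_ode k l x : -1 < x < 1 ->
  (1 - x ^ 2) * Td k (S (S l)) x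
    = (2 * INR l + 1) * x * Td k (S l) x + (INR l ^ 2 - INR k ^ 2) * Td k l x.
Proof.
revert x; induction l as [|l IH]; intros x Hx.
- generalize (Td_ode0 k x ltac:(lra)); simpl INR; lra.
- set (F := fun x => (1 - x ^ 2) * Td k (S (S l)) x
    - (2 * INR l + 1) * x * Td k (S l) x - (INR l ^ 2 - INR k ^ 2) * Td k l x).
  assert (D : Derive F x = 0).
  { rewrite (Derive_ext_loc F (fun _ => 0)); [apply Derive_const|].
    assert (Hd : 0 < Rmin (x + 1) (1 - x)) by (apply Rmin_pos; lra).
    exists (mkposreal _ Hd); intros z Hz.
    unfold ball in Hz; simpl in Hz; unfold AbsRing_ball, abs, minus, plus, opp in Hz; simpl in Hz.
    generalize (Rmin_l (x + 1) (1 - x)) (Rmin_r (x + 1) (1 - x)); intros.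
    apply Rabs_def2 in Hz; unfold F; rewrite IH by lra; ring. }
  assert (D2 : is_derive F x ((1 - x ^ 2) * Td k (S (S (S l))) x - 2 * x * Td k (S (S l)) x
    - (2 * INR l + 1) * (Td k (S l) x + x * Td k (S (S l)) x)
    - (INR l ^ 2 - INR k ^ 2) * Td k (S l) x)).
  { generalize (is_derive_Td k (S (S l)) x) (is_derive_Td k (S l) x) (is_derive_Td k l x).
    intros E1 E2 E3; unfold F; auto_derive.
    - repeat split; eexists; eassumption.
    - derw E1; derw E2; derw E3; ring. }
  apply is_derive_unique in D2; rewrite D in D2; rewrite S_INR; lra.
Qed.

(** Away from the endpoints the factor [1 - x^2 >= 3 / 4] can be divided out of the Chebyshev
    equation, so that each derivative costs about [k + l]. Up to the endpoints the cost would be of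
    order [k^2], too much for the weights. *)
Lemma Td_bound k l x : -1/2 <= x <= 1/2 -> Rabs (Td k l x) <= 2 ^ l * INR (k + l) ^ l.
Proof.
intros Hx; revert l; apply nat_ind2.
- rewrite <- (cos_acos x) by lra; rewrite Td_cos; simpl.
  generalize (COS_bound (INR k * acos x)); intros; apply Rabs_le; lra.
- generalize (Td1_sin k (acos x)); rewrite cos_acos by lra; intros E.
  generalize (sin2_cos2 (acos x)); rewrite cos_acos by lra; unfold Rsqr; intros E2.
  generalize (SIN_bound (INR k * acos x)) (pos_INR k); intros B K0.
  apply pow_le_reg with 2%nat; [lia | |].
  + apply Rmult_le_pos; [lra | apply pow_le, pos_INR].
  + rewrite RPow_abs, Rabs_right by (apply Rle_ge, pow2_ge_0).
    rewrite plus_INR; simpl INR.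
    assert (sin (acos x) * sin (acos x) * (Td k 1 x * Td k 1 x) <= INR k * INR k).
    { replace (sin (acos x) * sin (acos x) * (Td k 1 x * Td k 1 x))
       with ((sin (acos x) * Td k 1 x) * (sin (acos x) * Td k 1 x)) by ring.
      rewrite E.
      replace (INR k * sin (INR k * acos x) * (INR k * sin (INR k * acos x))) with
       (INR k * INR k * (sin (INR k * acos x) * sin (INR k * acos x))) by ring.
      rewrite <- (Rmult_1_r (INR k * INR k)) at 2; apply Rmult_le_compat_l; nra. }
    assert (3 / 4 <= sin (acos x) * sin (acos x)) by nra.
    assert (3 / 4 * (Td k 1 x * Td k 1 x) <= INR k * INR k).
    { apply Rle_trans with (2 := H); apply Rmult_le_compat_r; auto; apply Rle_0_sqr. }
    nra.
- intros l IH0 IH1.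
  generalize (Td_ode k l x ltac:(lra)); intros E.
  set (s := INR (k + S (S l))).
  assert (Hs : s = INR k + INR l + 2) by (unfold s; rewrite plus_INR, !S_INR; ring).
  generalize (pos_INR k) (pos_INR l); intros K0 L0.
  assert (B1 : Rabs (Td k (S l) x) <= 2 ^ S l * s ^ S l).
  { apply Rle_trans with (1 := IH1); apply Rmult_le_compat_l; [apply pow_le; lra|].
    apply pow_incr; split; [apply pos_INR | apply le_INR; lia]. }
  assert (B0 : Rabs (Td k l x) <= 2 ^ l * s ^ l).
  { apply Rle_trans with (1 := IH0); apply Rmult_le_compat_l; [apply pow_le; lra|].
    apply pow_incr; split; [apply pos_INR | apply le_INR; lia]. }
  assert (C1 : Rabs ((2 * INR l + 1) * x * Td k (S l) x) <= s * (2 ^ S l * s ^ S l)).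
  { rewrite !Rabs_mult; apply Rmult_le_compat; auto using Rabs_pos.
    - apply Rmult_le_pos; apply Rabs_pos.
    - rewrite (Rabs_right (2 * INR l + 1)) by lra.
      assert (Rabs x <= 1 / 2) by (apply Rabs_le; lra); nra. }
  assert (C0 : Rabs ((INR l ^ 2 - INR k ^ 2) * Td k l x) <= s ^ 2 * (2 ^ l * s ^ l)).
  { rewrite Rabs_mult; apply Rmult_le_compat; auto using Rabs_pos.
    apply Rabs_le; split; nra. }
  (* The right side is [3 2^l s^(l+2)], and division by [3 / 4] returns exactly [2^(l+2) s^(l+2)];
     this fits the base 2 to the interval [[-1/2, 1/2]]. *)
  assert (X : 3 / 4 * Rabs (Td k (S (S l)) x) <= s * (2 ^ S l * s ^ S l) + s ^ 2 * (2 ^ l * s ^ l)).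
  { apply Rle_trans with (Rabs ((1 - x ^ 2) * Td k (S (S l)) x)).
    - rewrite Rabs_mult; apply Rmult_le_compat_r; [apply Rabs_pos|].
      rewrite Rabs_right; nra.
    - rewrite E; apply Rle_trans with (1 := Rabs_triang _ _); lra. }
  simpl pow in *; lra.
Qed.

Lemma series_dominated (u v : nat -> R) : (forall k, Rabs (u k) <= v k) -> ex_series v ->
  ex_series u /\ forall n, Rabs (Series u - sum_n u n) <= Series v - sum_n v n.
Proof.
intros H Hv.
assert (Hu : ex_series u) by (apply (ex_series_le (K := R_AbsRing) (V := R_CompleteNormedModule)) with v; auto).
split; auto; intros n.
assert (L : is_lim_seq (fun N => Rabs (sum_n u N - sum_n u n)) (Rabs (Series u - sum_n u n))).
{ apply (is_lim_seq_abs _ (Series u - sum_n u n)).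
  apply is_lim_seq_minus'; [apply (Series_correct u Hu) | apply is_lim_seq_const]. }
assert (L' : is_lim_seq (fun N => sum_n v N - sum_n v n) (Series v - sum_n v n)).
{ apply is_lim_seq_minus'; [apply (Series_correct v Hv) | apply is_lim_seq_const]. }
refine (is_lim_seq_le_loc _ _ (Finite _) (Finite _) _ L L').
exists n; intros N HN; induction HN as [|N HN IH].
- rewrite !Rminus_diag, Rabs_R0; lra.
- rewrite !sum_Sn; unfold plus; simpl.
  replace (sum_n u N + u (S N) - sum_n u n) with ((sum_n u N - sum_n u n) + u (S N)) by ring.
  apply Rle_trans with (1 := Rabs_triang _ _); generalize (H (S N)); lra.
Qed.

Lemma series_tail_lim (v : nat -> R) : ex_series v ->
  forall eps, 0 < eps -> exists N, forall n, (N <= n)%nat -> Series v - sum_n v n < eps.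
Proof.
intros Hv eps He.
assert (L : is_lim_seq (sum_n v) (Series v)) by apply (Series_correct v Hv).
destruct (proj2 (is_lim_seq_spec _ _) L (mkposreal eps He)) as [N HN].
exists N; intros n Hn; generalize (HN n Hn); simpl; intros H.
apply Rabs_def2 in H; lra.
Qed.

(** * Cosine coefficients and integration by parts *)

Definition cont (f : R -> R) : Prop := forall x, continuous f x.

Lemma cont_const c : cont (fun _ => c).
Proof. intros x; apply continuous_const. Qed.

Lemma cont_plus f g : cont f -> cont g -> cont (fun x => f x + g x).
Proof. intros Hf Hg x; apply (continuous_plus (V := R_NormedModule)); auto. Qed.

Lemma cont_minus f g : cont f -> cont g -> cont (fun x => f x - g x).
Proof. intros Hf Hg x; apply (continuous_minus (V := R_NormedModule)); auto. Qed.

Lemma cont_mult f g : cont f -> cont g -> cont (fun x => f x * g x).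
Proof. intros Hf Hg x; apply (continuous_mult (K := R_AbsRing)); auto. Qed.

Lemma cont_cosk k : cont (fun x => cos (INR k * x)).
Proof.
intros x; apply (ex_derive_continuous (fun x => cos (INR k * x))); auto_derive; auto.
Qed.

Lemma cont_cos : cont cos.
Proof. intros x; apply continuous_cos. Qed.

Lemma cont_pow f n : cont f -> cont (fun x => f x ^ n).
Proof. intros Hf; induction n; simpl; [apply cont_const | apply cont_mult; auto]. Qed.

Lemma cont_ex_RInt f a b : cont f -> ex_RInt f a b.
Proof. intros Hf; apply (ex_RInt_continuous (V := R_CompleteNormedModule)); auto. Qed.

Lemma cont_comp_cos h : (forall x, -1 <= x <= 1 -> continuous h x) -> cont (fun t => h (cos t)).
Proof.
intros H t; apply (continuous_comp cos h); [apply cont_cos | apply H, COS_bound].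
Qed.

Lemma RInt_Rplus f g a b : cont f -> cont g ->
  RInt (fun x => f x + g x) a b = RInt f a b + RInt g a b.
Proof. intros; apply (RInt_plus f g); apply cont_ex_RInt; auto. Qed.

Lemma RInt_Rminus f g a b : cont f -> cont g ->
  RInt (fun x => f x - g x) a b = RInt f a b - RInt g a b.
Proof. intros; apply (RInt_minus f g); apply cont_ex_RInt; auto. Qed.

Lemma RInt_Rscal c f a b : cont f ->
  RInt (fun x => c * f x) a b = c * RInt f a b.
Proof. intros; apply (RInt_scal f); apply cont_ex_RInt; auto. Qed.

Lemma Rabs_RInt_le f a b B : a <= b -> cont f -> (forall x, a <= x <= b -> Rabs (f x) <= B) ->
  Rabs (RInt f a b) <= (b - a) * B.
Proof. intros; apply abs_RInt_le_const; auto; apply cont_ex_RInt; auto. Qed.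

Definition alpha (Phi : R -> R) (k : nat) : R := RInt (fun t => Phi t * cos (INR k * t)) 0 PI.

Lemma cont_alpha Phi k : cont Phi -> cont (fun t => Phi t * cos (INR k * t)).
Proof. intros H; apply cont_mult; auto using cont_cosk. Qed.

Lemma alpha_ext f g k : (forall t, 0 <= t <= PI -> f t = g t) -> alpha f k = alpha g k.
Proof.
intros H; apply RInt_ext; intros t.
rewrite Rmin_left, Rmax_right by (generalize PI_RGT_0; lra).
intros Ht; rewrite H; auto; lra.
Qed.

Lemma alpha_minus f g k : cont f -> cont g ->
  alpha (fun t => f t - g t) k = alpha f k - alpha g k.
Proof.
intros Hf Hg; unfold alpha; rewrite <- RInt_Rminus by (apply cont_alpha; auto).
apply RInt_ext; intros; Rring.
Qed.

Lemma alpha_plus f g k : cont f -> cont g ->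
  alpha (fun t => f t + g t) k = alpha f k + alpha g k.
Proof.
intros Hf Hg; unfold alpha; rewrite <- RInt_Rplus by (apply cont_alpha; auto).
apply RInt_ext; intros; Rring.
Qed.

Lemma alpha_scal c f k : cont f -> alpha (fun t => c * f t) k = c * alpha f k.
Proof.
intros Hf; unfold alpha; rewrite <- RInt_Rscal by (apply cont_alpha; auto).
apply RInt_ext; intros; Rring.
Qed.

Lemma alpha_bound f k B : cont f -> (forall t, 0 <= t <= PI -> Rabs (f t) <= B) ->
  Rabs (alpha f k) <= PI * B.
Proof.
intros Hf HB; replace (PI * B) with ((PI - 0) * B) by ring.
apply Rabs_RInt_le; [generalize PI_RGT_0; lra | apply cont_alpha; auto |].
intros t Ht; rewrite Rabs_mult.
assert (Rabs (cos (INR k * t)) <= 1) by (apply Rabs_le; generalize (COS_bound (INR k * t)); lra).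
generalize (HB t Ht) (Rabs_pos (f t)) (Rabs_pos (cos (INR k * t))); nra.
Qed.

(* Integration by parts; the factor [sin] is absorbed by the neighbouring frequencies. *)
Lemma alpha_derive (g g' : R -> R) k :
  (forall x, -1 <= x <= 1 -> is_derive g x (g' x)) ->
  (forall x, -1 <= x <= 1 -> continuous g' x) ->
  INR (S k) * alpha (fun t => g (cos t)) (S k)
    = / 2 * (alpha (fun t => g' (cos t)) k - alpha (fun t => g' (cos t)) (S (S k))).
Proof.
intros Hg Hc.
assert (Hg0 : forall x, -1 <= x <= 1 -> continuous g x).
{ intros x Hx; apply (ex_derive_continuous g); eexists; apply Hg; auto. }
generalize (cont_comp_cos g Hg0) (cont_comp_cos g' Hc); intros C C'.
set (F' := fun t => / 2 * (g' (cos t) * cos (INR (S (S k)) * t) - g' (cos t) * cos (INR k * t))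
   + INR (S k) * (g (cos t) * cos (INR (S k) * t))).
assert (CF : cont F').
{ apply cont_plus; apply cont_mult; try apply cont_const;
    [apply cont_minus |]; apply cont_alpha; auto. }
assert (D : forall t, is_derive (fun t => g (cos t) * sin (INR (S k) * t)) t (F' t)).
{ intros t; generalize (is_derive_comp_cos g _ t (Hg (cos t) (COS_bound t))); intros D.
  assert (D2 : is_derive (fun t => sin (INR (S k) * t)) t (INR (S k) * cos (INR (S k) * t)))
    by (generalize (INR (S k)); intros a; auto_derive; auto; ring).
  eapply is_derive_eq; [| apply (is_derive_Rmult (fun t => g (cos t)) _ t _ _ D D2)].
  unfold F'.
  replace (INR (S (S k)) * t) with (INR (S k) * t + t) by (rewrite (S_INR (S k)); ring).
  replace (INR k * t) with (INR (S k) * t - t) by (rewrite (S_INR k); ring).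
  rewrite cos_plus, cos_minus; match goal with |- ?a = ?b => change (@eq R a b) end; field. }
assert (Z : RInt F' 0 PI = 0).
{ apply (RInt_periodic_derivative _ _ _ _ D CF).
  rewrite Rmult_0_r, sin_0.
  replace (INR (S k) * PI) with (IZR (Z.of_nat (S k)) * PI) by (rewrite <- INR_IZR_INZ; auto).
  rewrite (sin_eq_0_1 (IZR (Z.of_nat (S k)) * PI)); [ring | eexists; reflexivity]. }
unfold F' in Z; rewrite RInt_Rplus, !RInt_Rscal, RInt_Rminus in Z;
  try (apply cont_mult; [apply cont_const|]);
  try apply cont_minus; try (apply cont_alpha; auto).
unfold alpha; lra.
Qed.

(** Every integration by parts divides by the current frequency and passes to its two neighbours. In
    [l] steps no divisor is smaller than [k - l + 1], so [q] is a lower bound for all of them. *)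
Lemma alpha_decay (g : nat -> R -> R) (B : nat -> R) :
  (forall i x, -1 <= x <= 1 -> is_derive (g i) x (g (S i) x)) ->
  (forall i x, -1 <= x <= 1 -> Rabs (g i x) <= B i) ->
  forall l i k q, 0 < q -> q <= INR k - INR l + 1 ->
    Rabs (alpha (fun t => g i (cos t)) k) * q ^ l <= PI * B (i + l)%nat.
Proof.
intros Hg HB.
assert (Hc : forall i x, -1 <= x <= 1 -> continuous (g i) x).
{ intros i x Hx; apply (ex_derive_continuous (g i)); eexists; apply Hg; auto. }
induction l as [|l IH]; intros i k q Hq Hk.
- rewrite Nat.add_0_r, pow_O, Rmult_1_r; apply alpha_bound.
  + apply cont_comp_cos; auto.
  + intros; apply HB, COS_bound.
- destruct k as [|k]; [rewrite S_INR in Hk; simpl INR in Hk; generalize (pos_INR l); lra|].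
  generalize (alpha_derive (g i) (g (S i)) k (Hg i) (Hc (S i))); intros E.
  rewrite !S_INR in Hk.
  generalize (IH (S i) k q Hq ltac:(lra)) (IH (S i) (S (S k)) q Hq ltac:(rewrite !S_INR; lra)).
  replace (S i + l)%nat with (i + S l)%nat by lia; intros I1 I2.
  set (a := alpha (fun t => g i (cos t)) (S k)) in *.
  set (b := alpha (fun t => g (S i) (cos t)) k) in *.
  set (c := alpha (fun t => g (S i) (cos t)) (S (S k))) in *.
  assert (E' : INR (S k) * Rabs a <= / 2 * (Rabs b + Rabs c)).
  { rewrite <- (Rabs_right (INR (S k))) by (apply Rle_ge, pos_INR).
    rewrite <- Rabs_mult, E, Rabs_mult, (Rabs_right (/ 2)) by lra.
    apply Rmult_le_compat_l; [lra|].
    apply Rle_trans with (1 := Rabs_triang _ _); rewrite Rabs_Ropp; lra. }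
  assert (Hqk : q * Rabs a <= INR (S k) * Rabs a).
  { apply Rmult_le_compat_r; [apply Rabs_pos|]; rewrite S_INR; generalize (pos_INR l); lra. }
  simpl pow; assert (0 < q ^ l) by (apply pow_lt; auto).
  assert (q * Rabs a * q ^ l <= / 2 * (Rabs b + Rabs c) * q ^ l)
    by (apply Rmult_le_compat_r; lra).
  lra.
Qed.

(** * Uniqueness of cosine coefficients *)

Definition orthogonal (Phi : R -> R) : Prop := forall k, alpha Phi k = 0.

Lemma orthogonal_cos Phi : cont Phi -> orthogonal Phi -> orthogonal (fun t => Phi t * cos t).
Proof.
intros HC H k; destruct k as [|k].
- transitivity (alpha Phi 1); [| apply H].
  apply RInt_ext; intros t _; simpl INR.
  rewrite Rmult_0_l, cos_0, Rmult_1_l; Rring.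
- replace (alpha (fun t => Phi t * cos t) (S k))
    with (/ 2 * (alpha Phi (S (S k)) + alpha Phi k)); [rewrite !H; ring|].
  unfold alpha; rewrite <- RInt_Rplus, <- RInt_Rscal;
    try apply cont_plus; try (apply cont_alpha; auto).
  apply RInt_ext; intros t _.
  replace (INR (S (S k)) * t) with (INR (S k) * t + t) by (rewrite (S_INR (S k)); ring).
  replace (INR k * t) with (INR (S k) * t - t) by (rewrite (S_INR k); ring).
  rewrite cos_plus, cos_minus; match goal with |- ?a = ?b => change (@eq R a b) end; field.
Qed.

(** For [d > 0] this quadratic polynomial in [cos t] exceeds 1 exactly where [|cos t - x0| < d]. The
    division by 4 keeps it positive, since [|cos t - x0| <= 2] when [x0] is a cosine. *)
Definition peak (d x0 t : R) : R := 1 + (d ^ 2 - (cos t - x0) ^ 2) / 4.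

Lemma cont_peak d x0 : cont (peak d x0).
Proof.
unfold peak, Rdiv; apply cont_plus; [apply cont_const|].
apply cont_mult; [| apply cont_const].
apply cont_minus; [apply cont_const|].
apply cont_pow, cont_minus; [apply cont_cos | apply cont_const].
Qed.

Lemma orthogonal_peak Phi d x0 n : cont Phi -> orthogonal Phi ->
  orthogonal (fun t => Phi t * peak d x0 t ^ n).
Proof.
intros HC H; induction n as [|n IH].
- intros k; rewrite <- (H k); apply alpha_ext; intros; simpl; ring.
- set (Psi := fun t => Phi t * peak d x0 t ^ n) in *.
  assert (HPsi : cont Psi) by (apply cont_mult; auto; apply cont_pow, cont_peak).
  assert (H1 := orthogonal_cos Psi HPsi IH).
  assert (HP1 : cont (fun t => Psi t * cos t)) by (apply cont_mult; auto; apply cont_cos).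
  assert (H2 := orthogonal_cos _ HP1 H1).
  assert (HP2 : cont (fun t => Psi t * cos t * cos t)) by (apply cont_mult; auto; apply cont_cos).
  intros k.
  transitivity (alpha (fun t => (1 + (d ^ 2 - x0 ^ 2) / 4) * Psi t
    + (x0 / 2 * (Psi t * cos t) - / 4 * (Psi t * cos t * cos t))) k).
  { apply alpha_ext; intros t _; unfold Psi; simpl pow; unfold peak; field. }
  rewrite alpha_plus, alpha_minus, !alpha_scal, IH, H1, H2; try ring; auto;
    repeat first [apply cont_minus | apply cont_mult; [apply cont_const|]]; auto.
Qed.

Lemma cont_bounded f : cont f -> exists B, 0 < B /\ forall t, 0 <= t <= PI -> Rabs (f t) <= B.
Proof.
intros Hf.
destruct (continuity_ab_maj (fun t => Rabs (f t)) 0 PI) as [M [HM _]].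
- generalize PI_RGT_0; lra.
- intros c _; apply continuity_pt_filterlim, (continuous_comp f Rabs); auto.
  apply continuous_Rabs.
- exists (Rabs (f M) + 1); split; [generalize (Rabs_pos (f M)); lra|].
  intros t Ht; generalize (HM t Ht); lra.
Qed.

(* Rudin's peak-kernel argument at an interior point where [Phi] is positive. *)
Lemma orthogonal_not_pos Phi t0 : cont Phi -> orthogonal Phi -> 0 < t0 < PI -> Phi t0 <= 0.
Proof.
intros HC H Ht0; apply Rnot_lt_le; intros Hpos.
assert (Hc : 0 < Phi t0 / 2) by lra.
destruct (HC t0 (fun y => Phi t0 / 2 < y)) as [e1 He1].
{ apply (open_gt (Phi t0 / 2) (Phi t0)); lra. }
set (e := Rmin (e1 / 2) (Rmin (t0 / 2) ((PI - t0) / 2))).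
assert (Hee : 0 < e /\ e <= e1 / 2 /\ e <= t0 / 2 /\ e <= (PI - t0) / 2).
{ generalize (cond_pos e1); intros; unfold e.
  repeat split.
  - apply Rmin_pos; [lra | apply Rmin_pos; lra].
  - apply Rmin_l.
  - apply Rle_trans with (1 := Rmin_r _ _), Rmin_l.
  - apply Rle_trans with (1 := Rmin_r _ _), Rmin_r. }
destruct Hee as (e0 & ee1 & et & ep).
assert (Hnear : forall t, Rabs (t - t0) <= e -> Phi t0 / 2 < Phi t).
{ intros t Ht; apply (He1 t); unfold ball; simpl; unfold AbsRing_ball, abs, minus, plus, opp; simpl.
  change (Rabs (t - t0) < e1); generalize (cond_pos e1); lra. }
set (x0 := cos t0).
set (d := Rmin (x0 - cos (t0 + e)) (cos (t0 - e) - x0)).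
assert (C1 : cos (t0 + e) < x0) by (apply cos_decreasing_1; lra).
assert (C2 : x0 < cos (t0 - e)) by (apply cos_decreasing_1; lra).
assert (Hd : 0 < d) by (apply Rmin_pos; lra).
assert (Hfar : forall t, 0 <= t <= PI -> e <= Rabs (t - t0) -> d <= Rabs (cos t - x0)).
{ intros t Ht He; destruct (Rle_lt_dec t t0) as [L|L].
  - rewrite Rabs_left1 in He by lra.
    apply Rle_trans with (cos (t0 - e) - x0); [apply Rmin_r|].
    assert (cos (t0 - e) <= cos t) by (apply cos_decr_1; lra).
    rewrite Rabs_right; lra.
  - rewrite Rabs_right in He by lra.
    apply Rle_trans with (x0 - cos (t0 + e)); [apply Rmin_l|].
    assert (cos t <= cos (t0 + e)) by (apply cos_decr_1; lra).
    rewrite Rabs_left1; lra. }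
assert (Hpk0 : forall t, 0 < peak d x0 t).
{ intros t; unfold peak; generalize (COS_bound t) (COS_bound t0); fold x0; intros; nra. }
assert (Hpk1 : forall t, 0 <= t <= PI -> e <= Rabs (t - t0) -> peak d x0 t <= 1).
{ intros t Ht He; unfold peak; generalize (Hfar t Ht He); intros F.
  assert (d ^ 2 <= (cos t - x0) ^ 2).
  { rewrite <- (pow2_abs (cos t - x0)); apply pow_incr; lra. }
  lra. }
set (s := Rmin e (d / 2)).
assert (Hs : 0 < s) by (apply Rmin_pos; lra).
assert (Hse : s <= e) by apply Rmin_l.
assert (Hsd : s <= d / 2) by apply Rmin_r.
(* The value of [peak] where [|cos t - x0| = d / 2]. *)
set (Q := 1 + 3 * d ^ 2 / 16).
assert (HQ : forall t, Rabs (t - t0) <= s -> Q <= peak d x0 t).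
{ intros t Ht; unfold peak, Q.
  assert (Rabs (cos t - x0) <= Rabs (t - t0)).
  { unfold x0; destruct (MVT_gen cos t0 t (fun x => - sin x)) as [c [_ E]].
    - intros; apply is_derive_cos.
    - intros; apply continuity_pt_filterlim, continuous_cos.
    - rewrite E, Rabs_mult.
      assert (Rabs (- sin c) <= 1) by (apply Rabs_le; generalize (SIN_bound c); lra).
      generalize (Rabs_pos (t - t0)); nra. }
  assert ((cos t - x0) ^ 2 <= (d / 2) ^ 2).
  { rewrite <- (pow2_abs (cos t - x0)); apply pow_incr; split; [apply Rabs_pos | lra]. }
  lra. }
destruct (cont_bounded Phi HC) as [B [HB0 HB]].
(* The integral is zero, while the integrand is at least [- B] everywhere: far from [t0] the kernel
   is at most 1, and near [t0] the function is positive. The inner interval contributes a multiple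
   of [Q^n], which therefore stays bounded. *)
assert (Key : forall n, Phi t0 / 2 * Q ^ n * (2 * s) <= PI * B).
{ intros n.
  set (F := fun t => Phi t * peak d x0 t ^ n).
  assert (CF : cont F) by (apply cont_mult; auto; apply cont_pow, cont_peak).
  assert (Z : RInt F 0 PI = 0).
  { transitivity (alpha (fun t => Phi t * peak d x0 t ^ n) 0);
      [| apply (orthogonal_peak Phi d x0 n HC H)].
    apply RInt_ext; intros t _; simpl INR; rewrite Rmult_0_l, cos_0; unfold F; Rring. }
  assert (Low : forall t, 0 <= t <= PI -> - B <= F t).
  { intros t Ht; unfold F; destruct (Rle_lt_dec e (Rabs (t - t0))) as [L|L].
    - assert (0 <= peak d x0 t ^ n <= 1).
      { split; [apply pow_le; left; auto | rewrite <- (pow1 n); apply pow_incr; split; auto; left; auto]. }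
      generalize (HB t Ht); intros HBt; apply Rabs_le_between in HBt; nra.
    - assert (0 < peak d x0 t ^ n) by (apply pow_lt; auto).
      generalize (Hnear t ltac:(lra)); intros; nra. }
  assert (S1 : - B * (t0 - s) <= RInt F 0 (t0 - s)).
  { replace (- B * (t0 - s)) with (RInt (fun _ => - B) 0 (t0 - s))
      by (rewrite RInt_Rconst; Rring).
    apply RInt_le; try lra; try apply cont_ex_RInt; auto using cont_const.
    intros t Ht; apply Low; lra. }
  assert (S3 : - B * (PI - (t0 + s)) <= RInt F (t0 + s) PI).
  { replace (- B * (PI - (t0 + s))) with (RInt (fun _ => - B) (t0 + s) PI)
      by (rewrite RInt_Rconst; Rring).
    apply RInt_le; try lra; try apply cont_ex_RInt; auto using cont_const.
    intros t Ht; apply Low; lra. }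
  assert (S2 : Phi t0 / 2 * Q ^ n * (2 * s) <= RInt F (t0 - s) (t0 + s)).
  { replace (Phi t0 / 2 * Q ^ n * (2 * s)) with (RInt (fun _ => Phi t0 / 2 * Q ^ n) (t0 - s) (t0 + s))
      by (rewrite RInt_Rconst; Rring).
    apply RInt_le; try lra; try apply cont_ex_RInt; auto using cont_const.
    intros t Ht; assert (Rabs (t - t0) <= s) by (apply Rabs_le; lra).
    unfold F; apply Rmult_le_compat; try lra.
    - apply pow_le; unfold Q; nra.
    - left; apply Hnear; lra.
    - apply pow_incr; split; [unfold Q; nra | apply HQ; auto]. }
  rewrite <- (RInt_Chasles F 0 (t0 - s) PI), <- (RInt_Chasles F (t0 - s) (t0 + s) PI) in Z;
    try (apply cont_ex_RInt; auto).
  unfold plus in Z; simpl in Z.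
  nra. }
destruct (Pow_x_infinity Q) with (b := PI * B / (Phi t0 * s) + 1) as [N HN].
{ rewrite Rabs_right; unfold Q; nra. }
generalize (HN N (le_n _)) (Key N); intros K1 K2.
rewrite Rabs_right in K1 by (apply Rle_ge, pow_le; unfold Q; nra).
assert (P : 0 < Phi t0 * s) by nra.
assert (Q ^ N <= PI * B / (Phi t0 * s)).
{ apply Rmult_le_reg_r with (Phi t0 * s); auto.
  replace (PI * B / (Phi t0 * s) * (Phi t0 * s)) with (PI * B) by (field; split; lra); lra. }
lra.
Qed.

Lemma orthogonal_zero Phi : cont Phi -> orthogonal Phi -> forall t, 0 <= t <= PI -> Phi t = 0.
Proof.
intros HC H.
assert (Hin : forall t, 0 < t < PI -> Phi t = 0).
{ intros t Ht; apply Rle_antisym; [apply orthogonal_not_pos; auto|].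
  assert (C' : cont (fun t => -1 * Phi t)) by (apply cont_mult; auto using cont_const).
  assert (O' : orthogonal (fun t => -1 * Phi t)).
  { intros k; rewrite alpha_scal, H by auto; ring. }
  generalize (orthogonal_not_pos _ t C' O' Ht); lra. }
intros t Ht; apply NNPP; intros Hn.
destruct (HC t (fun y => y <> 0)) as [e He].
{ apply (open_neq 0 (Phi t) Hn). }
generalize PI_RGT_0 (cond_pos e); intros HPI e0.
(* Moving [t] towards [PI / 2] by the fraction [c] of the distance reaches the open interval, also
   from an endpoint, without leaving the [e]-neighbourhood. *)
set (c := Rmin (/ 2) (e / (2 * PI))).
assert (c0 : 0 < c) by (apply Rmin_pos; [lra | apply Rdiv_lt_0_compat; lra]).
assert (c1 : c <= / 2) by apply Rmin_l.
assert (c2 : c * (2 * PI) <= e).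
{ apply Rle_trans with (e / (2 * PI) * (2 * PI)); [|right; field; lra].
  apply Rmult_le_compat_r; [lra | apply Rmin_r]. }
apply (He (t + (PI / 2 - t) * c)).
- unfold ball; simpl; unfold AbsRing_ball, abs, minus, plus, opp; simpl.
  replace (t + (PI / 2 - t) * c + - t) with ((PI / 2 - t) * c) by ring.
  rewrite Rabs_mult, (Rabs_right c) by lra.
  assert (Rabs (PI / 2 - t) <= PI / 2) by (apply Rabs_le; lra).
  apply Rle_lt_trans with (PI / 2 * c); [apply Rmult_le_compat_r; lra | nra].
- apply Hin; split; nra.
Qed.

Lemma RInt_cosk k : RInt (fun t => cos (INR (S k) * t)) 0 PI = 0.
Proof.
apply (RInt_periodic_derivative (fun t => / INR (S k) * sin (INR (S k) * t))).
- intros t; assert (INR (S k) <> 0) by (apply not_0_INR; lia); revert H.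
  generalize (INR (S k)); intros a Ha; auto_derive; auto; field; auto.
- apply cont_cosk.
- rewrite Rmult_0_r, sin_0.
  replace (INR (S k) * PI) with (IZR (Z.of_nat (S k)) * PI) by (rewrite <- INR_IZR_INZ; auto).
  rewrite (sin_eq_0_1 (IZR (Z.of_nat (S k)) * PI)); [ring | eexists; reflexivity].
Qed.

(** The reciprocals of the squared norms of [cos (k t)] on [[0, PI]]. *)
Definition kap (k : nat) : R := match k with O => / PI | S _ => 2 / PI end.

Lemma kap_pos k : 0 < kap k.
Proof.
generalize PI_RGT_0; intros H; destruct k; simpl;
  [apply Rinv_0_lt_compat, H | apply Rdiv_lt_0_compat; lra].
Qed.

Lemma kap_le k : kap k <= 1.
Proof.
assert (H : 2 <= PI) by (generalize PI2_1; lra).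
destruct k; simpl.
- rewrite <- Rinv_1; apply Rinv_le_contravar; lra.
- apply Rmult_le_reg_r with PI; [lra|]; replace (2 / PI * PI) with 2 by (field; lra); lra.
Qed.

Lemma alpha_cosk k l :
  alpha (fun t => cos (INR l * t)) k = if Nat.eq_dec l k then / kap k else 0.
Proof.
assert (Half : forall i j, (i <= j)%nat -> RInt (fun t => cos (INR i * t) * cos (INR j * t)) 0 PI
  = / 2 * (RInt (fun t => cos (INR (i + j) * t)) 0 PI + RInt (fun t => cos (INR (j - i) * t)) 0 PI)).
{ intros i j Hij; rewrite <- RInt_Rplus, <- RInt_Rscal; try apply cont_plus; try apply cont_cosk.
  apply RInt_ext; intros t _; rewrite plus_INR, minus_INR by auto.
  replace ((INR i + INR j) * t) with (INR j * t + INR i * t) by ring.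
  replace ((INR j - INR i) * t) with (INR j * t - INR i * t) by ring.
  rewrite cos_plus, cos_minus; match goal with |- ?a = ?b => change (@eq R a b) end; field. }
assert (Zero : RInt (fun t => cos (INR 0 * t)) 0 PI = PI).
{ rewrite (RInt_ext _ (fun _ => 1)).
  - rewrite RInt_Rconst; Rring.
  - intros t _; simpl INR; rewrite Rmult_0_l, cos_0; auto. }
generalize PI_RGT_0; intros HPI.
assert (Main : forall i j, (i <= j)%nat -> RInt (fun t => cos (INR i * t) * cos (INR j * t)) 0 PI
  = if Nat.eq_dec i j then / kap j else 0).
{ intros i j Hij; rewrite Half by auto.
  destruct (Nat.eq_dec i j) as [<-|Hn].
  - rewrite Nat.sub_diag, Zero; destruct i as [|i].
    + simpl Nat.add; rewrite Zero; simpl; field; lra.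
    + simpl Nat.add; rewrite RInt_cosk; simpl; field; lra.
  - destruct (i + j)%nat eqn:E1; [lia|]; destruct (j - i)%nat eqn:E2; [lia|].
    rewrite !RInt_cosk; Rring. }
destruct (Nat.le_ge_cases l k) as [L|L]; unfold alpha.
- apply Main; auto.
- rewrite (RInt_ext _ (fun t => cos (INR k * t) * cos (INR l * t))) by (intros; Rring).
  rewrite Main by auto.
  destruct (Nat.eq_dec k l), (Nat.eq_dec l k); subst; auto; lia.
Qed.

Lemma cont_cossum a n : cont (fun t => sum_n (fun l => a l * cos (INR l * t)) n).
Proof.
induction n as [|n IH].
- intros t; apply continuous_ext with (fun t => a 0%nat * cos (INR 0 * t)).
  + intros; rewrite sum_O; auto.
  + apply (cont_mult _ _ (cont_const _) (cont_cosk 0)).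
- intros t; apply continuous_ext with
    (fun t => sum_n (fun l => a l * cos (INR l * t)) n + a (S n) * cos (INR (S n) * t)).
  + intros; rewrite sum_Sn; auto.
  + apply cont_plus; auto; apply (cont_mult _ _ (cont_const _) (cont_cosk (S n))).
Qed.

Lemma alpha_cossum a n k : (k <= n)%nat ->
  alpha (fun t => sum_n (fun l => a l * cos (INR l * t)) n) k = a k / kap k.
Proof.
assert (H : forall n, alpha (fun t => sum_n (fun l => a l * cos (INR l * t)) n) k
   = sum_n (fun l => if Nat.eq_dec l k then a l / kap k else 0) n).
{ clear; induction n as [|n IH].
  - rewrite sum_O.
    rewrite (alpha_ext _ (fun t => a 0%nat * cos (INR 0 * t))) by (intros; rewrite sum_O; auto).
    rewrite alpha_scal, alpha_cosk by apply cont_cosk.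
    destruct (Nat.eq_dec 0 k); unfold Rdiv; Rring.
  - rewrite sum_Sn, <- IH.
    rewrite (alpha_ext _ (fun t => sum_n (fun l => a l * cos (INR l * t)) n
      + a (S n) * cos (INR (S n) * t))) by (intros; rewrite sum_Sn; auto).
    rewrite alpha_plus, alpha_scal, alpha_cosk; try apply cont_cosk; try apply cont_cossum.
    + unfold plus; simpl plus; destruct (Nat.eq_dec (S n) k); unfold Rdiv; simpl; Rring.
    + apply (cont_mult _ _ (cont_const _) (cont_cosk (S n))). }
intros Hk; rewrite H; clear H; induction n as [|n IH].
- rewrite sum_O; destruct (Nat.eq_dec 0 k) as [<-|]; auto; lia.
- rewrite sum_Sn; unfold plus; simpl plus; destruct (Nat.eq_dec (S n) k) as [E|E].
  + rewrite (sum_n_ext_loc _ (fun _ => 0)).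
    * rewrite sum_n_const, <- E; simpl; Rring.
    * intros l Hl; destruct (Nat.eq_dec l k); auto; lia.
  + rewrite IH by lia; simpl; Rring.
Qed.

Definition cosseries (a : nat -> R) (t : R) : R := Series (fun k => a k * cos (INR k * t)).

Lemma Rabs_cosk a k t : Rabs (a k * cos (INR k * t)) <= Rabs (a k).
Proof.
rewrite Rabs_mult.
assert (Rabs (cos (INR k * t)) <= 1) by (apply Rabs_le; generalize (COS_bound (INR k * t)); lra).
generalize (Rabs_pos (a k)); nra.
Qed.

Lemma cosseries_tail a : ex_series (fun k => Rabs (a k)) -> forall n t,
  Rabs (cosseries a t - sum_n (fun k => a k * cos (INR k * t)) n)
    <= Series (fun k => Rabs (a k)) - sum_n (fun k => Rabs (a k)) n.
Proof.
intros Ha n t; apply (series_dominated _ _ (fun k => Rabs_cosk a k t) Ha).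
Qed.

Lemma cont_cosseries a : ex_series (fun k => Rabs (a k)) -> cont (cosseries a).
Proof.
intros Ha t; apply continuity_pt_filterlim; intros eps He.
destruct (series_tail_lim _ Ha (eps / 3)) as [n Hn]; [lra|].
specialize (Hn n (le_n _)).
assert (Hc : continuity_pt (fun t => sum_n (fun k => a k * cos (INR k * t)) n) t)
  by (apply continuity_pt_filterlim, cont_cossum).
destruct (Hc (eps / 3)) as [d [Hd H]]; [lra|].
exists d; split; auto; intros x Hx.
generalize (H x Hx); simpl; unfold R_dist; clear H; intros H.
generalize (cosseries_tail a Ha n x) (cosseries_tail a Ha n t); intros T1 T2.
apply Rabs_def2 in H; apply Rabs_le_between in T1; apply Rabs_le_between in T2.
apply Rabs_def1; lra.
Qed.

Definition fcoef (Phi : R -> R) (k : nat) : R := kap k * alpha Phi k.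

(** The series is not integrated term by term. Replacing [Phi] by a partial sum of degree at least
    [k] keeps the [k]-th coefficient, and the partial sums are uniformly close to the series, so the
    difference of [Phi] and the series has no nonzero coefficient. *)
Lemma fourier_cos Phi : cont Phi -> ex_series (fun k => Rabs (fcoef Phi k)) ->
  forall t, 0 <= t <= PI -> Phi t = cosseries (fcoef Phi) t.
Proof.
intros HC Ha t Ht.
set (a := fcoef Phi) in *.
assert (HS := cont_cosseries a Ha).
enough (Phi t - cosseries a t = 0) by lra.
revert t Ht; apply (orthogonal_zero (fun t => Phi t - cosseries a t)); [apply cont_minus; auto|].
intros k; apply NNPP; intros Hn.
set (b := alpha (fun t => Phi t - cosseries a t) k) in *.
assert (Hb : 0 < Rabs b) by (apply Rabs_pos_lt; auto).
generalize PI_RGT_0; intros HPI.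
destruct (series_tail_lim _ Ha (Rabs b / PI)) as [N HN]; [apply Rdiv_lt_0_compat; lra|].
set (n := Nat.max N k); specialize (HN n ltac:(lia)).
set (Sn := fun t => sum_n (fun l => a l * cos (INR l * t)) n).
assert (CS : cont Sn) by apply cont_cossum.
assert (E : b = alpha (fun t => Sn t - cosseries a t) k).
{ unfold b; rewrite !alpha_minus by auto.
  unfold Sn; rewrite alpha_cossum by lia; unfold a, fcoef; field.
  generalize (kap_pos k); lra. }
assert (Hbound : Rabs b <= PI * (Series (fun k => Rabs (a k)) - sum_n (fun k => Rabs (a k)) n)).
{ rewrite E; apply alpha_bound; [apply cont_minus; auto|].
  intros t Ht; rewrite Rabs_minus_sym; apply cosseries_tail; auto. }
apply (Rmult_lt_compat_l PI) in HN; auto.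
replace (PI * (Rabs b / PI)) with (Rabs b) in HN by (field; lra); lra.
Qed.

Lemma pos_series_bounded (v : nat -> R) B : (forall k, 0 <= v k) ->
  (forall N, sum_n v N <= B) -> ex_series v /\ Series v <= B.
Proof.
intros Hv HB.
assert (Hinc : forall n, sum_n v n <= sum_n v (S n)).
{ intros n; rewrite sum_Sn; unfold plus; simpl; generalize (Hv (S n)); lra. }
destruct (ex_finite_lim_seq_incr (sum_n v) B Hinc HB) as [l Hl].
assert (Hs : is_series v l) by exact Hl.
split; [exists l; auto|].
rewrite (is_series_unique _ _ Hs).
exact (is_lim_seq_le _ _ (Finite l) (Finite B) HB Hl (is_lim_seq_const B)).
Qed.

Lemma sum_inv_sq N : sum_n (fun k => / INR (S k) ^ 2) N <= 2 - / INR (S N).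
Proof.
induction N as [|N IH].
- rewrite sum_O; simpl; lra.
- rewrite sum_Sn; unfold plus; simpl plus.
  apply Rle_trans with (2 - / INR (S N) + / INR (S (S N)) ^ 2); [apply Rplus_le_compat_r, IH|].
  rewrite (S_INR (S N)).
  assert (0 < INR (S N)) by (apply lt_0_INR; lia).
  set (x := INR (S N)) in *.
  assert (/ (x + 1) ^ 2 <= / x - / (x + 1)); [|lra].
  replace (/ x - / (x + 1)) with (/ (x * (x + 1))) by (field; lra).
  apply Rinv_le_contravar; nra.
Qed.

(** Since [1 / (x+1)^2 <= 1 / x - 1 / (x+1)], the squares [(n / k)^2] with [k > n] telescope to a
    sum of at most [n]. *)
Lemma tail_inv_sq (v : nat -> R) D n : (1 <= n)%nat -> (forall k, 0 <= v k) -> 0 <= D ->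
  (forall k, (n < k)%nat -> v k <= D * (INR n / INR k) ^ 2) ->
  ex_series v /\ Series v - sum_n v n <= D * INR n.
Proof.
intros Hn Hv HD H.
assert (Hn0 : 0 < INR n) by (apply lt_0_INR; lia).
assert (T : forall d, sum_n v (n + d) <= sum_n v n + D * INR n ^ 2 * (/ INR n - / INR (n + d))).
{ induction d as [|d IH].
  - rewrite Nat.add_0_r, Rminus_diag, Rmult_0_r, Rplus_0_r; apply Rle_refl.
  - replace (n + S d)%nat with (S (n + d)) by lia; rewrite sum_Sn; unfold plus; simpl plus.
    generalize (H (S (n + d)) ltac:(lia)); rewrite S_INR.
    set (x := INR (n + d)) in *; intros Hk.
    assert (Hx : 0 < x) by (apply lt_0_INR; lia).
    assert (Hi : / (x + 1) ^ 2 <= / x - / (x + 1)).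
    { replace (/ x - / (x + 1)) with (/ (x * (x + 1))) by (field; lra).
      apply Rinv_le_contravar; nra. }
    replace (D * (INR n / (x + 1)) ^ 2) with (D * INR n ^ 2 * / (x + 1) ^ 2) in Hk by (field; lra).
    assert (0 <= D * INR n ^ 2) by (apply Rmult_le_pos; [auto | apply pow_le; lra]).
    assert (D * INR n ^ 2 * / (x + 1) ^ 2 <= D * INR n ^ 2 * (/ x - / (x + 1)))
      by (apply Rmult_le_compat_l; auto).
    change (sum_n v (n + d) + v (S (n + d)) <= sum_n v n + D * INR n ^ 2 * (/ INR n - / (x + 1))).
    lra. }
assert (T2 : forall N, sum_n v N <= sum_n v n + D * INR n).
{ intros N; destruct (le_lt_dec n N) as [L|L].
  - replace N with (n + (N - n))%nat by lia; apply Rle_trans with (1 := T _).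
    assert (0 <= / INR (n + (N - n))) by (left; apply Rinv_0_lt_compat, lt_0_INR; lia).
    assert (0 <= D * INR n ^ 2) by (apply Rmult_le_pos; [auto | apply pow_le; lra]).
    assert (D * INR n ^ 2 * (/ INR n - / INR (n + (N - n))) <= D * INR n ^ 2 * / INR n)
      by (apply Rmult_le_compat_l; lra).
    replace (D * INR n ^ 2 * / INR n) with (D * INR n) in H2 by (field; lra).
    lra.
  - assert (sum_n v N <= sum_n v n).
    { clear - Hv L; induction L as [|m L IH].
      - rewrite sum_Sn; unfold plus; simpl plus; generalize (Hv (S N)); simpl; lra.
      - rewrite sum_Sn; unfold plus; simpl plus; generalize (Hv (S m)); simpl in *; lra. }
    generalize (Rmult_le_pos D (INR n) HD (Rlt_le _ _ Hn0)); lra. }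
destruct (pos_series_bounded v _ Hv T2) as [H1 H2]; split; auto; lra.
Qed.

Lemma is_derive_quadratic (f : R -> R) x l B d : 0 < d ->
  (forall y, Rabs (y - x) < d -> Rabs (f y - f x - (y - x) * l) <= B * (y - x) ^ 2) ->
  is_derive f x l.
Proof.
intros Hd H; apply is_derive_Reals; intros eps He.
set (B' := Rabs B + 1).
assert (HB' : 0 < B') by (unfold B'; generalize (Rabs_pos B); lra).
assert (Hm : 0 < Rmin d (eps / B')) by (apply Rmin_pos; auto; apply Rdiv_lt_0_compat; auto).
exists (mkposreal _ Hm); intros h Hh Hhd; simpl in Hhd.
generalize (Rmin_l d (eps / B')) (Rmin_r d (eps / B')); intros M1 M2.
specialize (H (x + h)).
replace (x + h - x) with h in H by ring.
specialize (H ltac:(lra)).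
replace ((f (x + h) - f x) / h - l) with ((f (x + h) - f x - h * l) / h) by (field; auto).
unfold Rdiv; rewrite Rabs_mult, Rabs_inv.
assert (Hh0 : 0 < Rabs h) by (apply Rabs_pos_lt; auto).
apply Rmult_lt_reg_r with (Rabs h); auto.
rewrite Rmult_assoc, Rinv_l, Rmult_1_r by lra.
apply Rle_lt_trans with (1 := H).
rewrite <- (pow2_abs h).
apply Rle_lt_trans with (B' * (Rabs h) ^ 2).
- apply Rmult_le_compat_r; [apply pow2_ge_0 | unfold B'; generalize (Rle_abs B); lra].
- assert (B' * Rabs h < eps); [|nra].
  apply Rlt_le_trans with (B' * (eps / B')); [apply Rmult_lt_compat_l; lra | right; field; lra].
Qed.

(** * Chebyshev series and their termwise derivatives *)

Definition chebseries (a : nat -> R) (l : nat) (x : R) : R := Series (fun k => a k * Td k l x).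

Definition rapid (a : nat -> R) : Prop :=
  forall l, ex_series (fun k => Rabs (a k) * (2 ^ l * INR (k + l) ^ l)).

Lemma chebseries_term a k l x : -1/2 <= x <= 1/2 ->
  Rabs (a k * Td k l x) <= Rabs (a k) * (2 ^ l * INR (k + l) ^ l).
Proof.
intros Hx; rewrite Rabs_mult; apply Rmult_le_compat_l; [apply Rabs_pos | apply Td_bound, Hx].
Qed.

Lemma ex_chebseries a l x : rapid a -> -1/2 <= x <= 1/2 ->
  ex_series (fun k => a k * Td k l x).
Proof.
intros Ha Hx; apply (series_dominated _ _ (fun k => chebseries_term a k l x Hx) (Ha l)).
Qed.

Lemma Rabs_Series_le (u v : nat -> R) : (forall k, Rabs (u k) <= v k) -> ex_series v ->
  Rabs (Series u) <= Series v.
Proof.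
intros H Hv; destruct (series_dominated u v H Hv) as [Hu Ht].
specialize (Ht 0%nat); rewrite !sum_O in Ht; generalize (H 0%nat); intros H0.
apply Rabs_le_between in Ht; apply Rabs_le_between in H0; apply Rabs_le; lra.
Qed.

(** The second-order Taylor remainder of each term is controlled by the majorant of [Td k (l + 2)].
    Its summability bounds the remainder of the whole series by a multiple of [(y - x)^2]. *)
Lemma is_derive_chebseries a l x : rapid a -> -1/2 < x < 1/2 ->
  is_derive (chebseries a l) x (chebseries a (S l) x).
Proof.
intros Ha Hx.
set (v := fun k => Rabs (a k) * (2 ^ S (S l) * INR (k + S (S l)) ^ S (S l))).
apply is_derive_quadratic with (B := Series v) (d := Rmin (x + 1 / 2) (1 / 2 - x)).
{ apply Rmin_pos; lra. }
intros y Hy.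
generalize (Rmin_l (x + 1 / 2) (1 / 2 - x)) (Rmin_r (x + 1 / 2) (1 / 2 - x)); intros M1 M2.
assert (Hy' : -1/2 <= y <= 1/2) by (apply Rabs_def2 in Hy; lra).
generalize (ex_chebseries a l y Ha Hy') (ex_chebseries a l x Ha ltac:(lra))
  (ex_chebseries a (S l) x Ha ltac:(lra)); intros S1 S2 S3.
unfold chebseries; rewrite <- Series_minus, <- Series_scal_l, <- Series_minus; auto.
2:{ apply (ex_series_minus (fun k => a k * Td k l y)); auto. }
2:{ apply (ex_series_scal (K := R_AbsRing) (y - x) (fun k => a k * Td k (S l) x)); auto. }
rewrite (Rmult_comm (Series v)), <- Series_scal_l.
apply Rabs_Series_le.
2:{ apply (ex_series_scal (K := R_AbsRing) ((y - x) ^ 2) v), (Ha (S (S l))). }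
intros k; unfold v.
replace (a k * Td k l y - a k * Td k l x - (y - x) * (a k * Td k (S l) x))
  with (a k * (Td k l y - Td k l x - (y - x) * Td k (S l) x)) by ring.
rewrite Rabs_mult, (Rmult_comm ((y - x) ^ 2)), Rmult_assoc.
apply Rmult_le_compat_l; [apply Rabs_pos|].
destruct (MVT_gen (Td k l) x y (Td k (S l))) as [c [Hc E]].
{ intros; apply is_derive_Td. }
{ intros z _; apply continuity_pt_filterlim, (ex_derive_continuous (Td k l)); eexists; apply is_derive_Td. }
destruct (MVT_gen (Td k (S l)) x c (Td k (S (S l)))) as [d [Hd E2]].
{ intros; apply is_derive_Td. }
{ intros z _; apply continuity_pt_filterlim, (ex_derive_continuous (Td k (S l))); eexists; apply is_derive_Td. }
rewrite E; replace (Td k (S l) c * (y - x) - (y - x) * Td k (S l) x)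
  with ((Td k (S l) c - Td k (S l) x) * (y - x)) by ring.
rewrite E2, !Rabs_mult.
assert (Hcx : Rabs (c - x) <= Rabs (y - x) /\ -1/2 <= c <= 1/2).
{ revert Hc; unfold Rmin, Rmax; destruct (Rle_dec x y); intros Hc.
  - rewrite !Rabs_right by lra; lra.
  - rewrite !Rabs_left1 by lra; lra. }
assert (Hdx : -1/2 <= d <= 1/2).
{ revert Hd; unfold Rmin, Rmax; destruct (Rle_dec x c); intros Hd; lra. }
rewrite <- (pow2_abs (y - x)).
replace (Rabs (y - x) ^ 2) with (Rabs (y - x) * Rabs (y - x)) by ring.
rewrite <- Rmult_assoc.
apply Rmult_le_compat_r; [apply Rabs_pos|].
apply Rmult_le_compat; try apply Rabs_pos; [apply Td_bound; auto | apply Hcx].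
Qed.

(** * Coefficient decay from derivative bounds *)

Section CoefficientDecay.

Variables (M N : nat -> R) (C s K : R) (b : nat -> R) (n l : nat).
Hypothesis HM : forall k, 0 < M k.
Hypothesis Hs : 0 < s.
Hypothesis HK : 0 <= K.
Hypothesis Hinc : almost_increasing M N C.
Hypothesis Hb : forall k i, (2 * i <= k + 1)%nat -> b k * INR k ^ i <= K * (s ^ i * M i).
Hypothesis M0 : M 0%nat = 1.
Hypothesis Hl : (2 <= l)%nat.
Hypothesis Hln : (2 * l <= n)%nat.

Let L := INR l.
(** [exp (- X) = e C s N_l^(1/l) / n], so [K exp (- l X)] is the bound that [l] derivatives give for
    the [n]-th coefficient. *)
Let X := ln (INR n) - ln s - ln C - 1 - ln (N l) / L.

Let L_pos : 0 < L.
Proof. apply lt_0_INR; lia. Qed.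

Let n_pos : 0 < INR n.
Proof. apply lt_0_INR; lia. Qed.

(** The number [i'] of derivatives spent on the [i]-th coefficient is still free;
    [almost_increasing] trades [M i'] for [N l], so one [X] serves all [i]. *)
Let coef_exp i i' : (1 <= i)%nat -> (1 <= i' <= l)%nat -> (2 * i' <= i + 1)%nat ->
  b i <= K * exp (INR i' * (- X + ln (INR n) - ln (INR i) + ln (INR i') - ln L)).
Proof.
intros Hi Hi' H2.
assert (Pi : 0 < INR i) by (apply lt_0_INR; lia).
assert (Pi' : 0 < INR i') by (apply lt_0_INR; lia).
apply Rmult_le_reg_r with (INR i ^ i'); [apply pow_lt; auto|].
apply Rle_trans with (1 := Hb i i' H2).
rewrite Rmult_assoc; apply Rmult_le_compat_l; auto.
rewrite <- (exp_ln (s ^ i')), <- (exp_ln (M i')), <- (exp_ln (INR i ^ i')), <- !exp_plus;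
  try apply pow_lt; auto.
apply exp_le; rewrite !ln_pow_nat by auto.
generalize (Hinc i' l Hi'); fold L; intros H.
apply Rmult_le_reg_l with L; auto.
apply Rle_trans with (L * (INR i' * ln s) + INR i' * (L * (ln (INR i') - ln L + ln C + 1) + ln (N l))); [lra|].
right; unfold X; field; lra.
Qed.

Hypothesis HX : 0 <= X.

Let coef_K i : b i <= K.
Proof. generalize (Hb i 0 ltac:(lia)); simpl; rewrite M0; lra. Qed.

(** The [i]-th coefficient gets the proportional share of [l i / n] derivatives, rounded down. Then
    [i' / l <= i / n] cancels the logarithms and leaves [exp (- i' X)], and rounding loses at most
    half of the share. The condition [2 l <= n] keeps the share within the range of [Hb]. *)
Lemma coef_low i : (i <= n)%nat -> b i <= 3 * K * exp (- (L * X * INR i / (2 * INR n))).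
Proof.
intros Hi.
assert (E3 : K * exp (1 - L * X * INR i / (2 * INR n)) <= 3 * K * exp (- (L * X * INR i / (2 * INR n)))).
{ unfold Rminus; rewrite exp_plus; set (E := exp (- (L * X * INR i / (2 * INR n)))).
  assert (0 <= K * E) by (apply Rmult_le_pos; [auto | left; apply exp_pos]).
  replace (K * (exp 1 * E)) with (exp 1 * (K * E)) by ring.
  generalize exp_le_3; nra. }
apply Rle_trans with (2 := E3).
destruct (Nat.eq_dec i 0) as [->|Hi0].
{ apply Rle_trans with (1 := coef_K 0); simpl INR.
  replace (1 - L * X * 0 / (2 * INR n)) with 1 by (field; lra).
  generalize (exp_ineq1_le 1); nra. }
assert (Pi : 0 < INR i) by (apply lt_0_INR; lia).
set (q := L * INR i / INR n).
assert (Hq : 0 < q) by (apply Rdiv_lt_0_compat; nra).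
assert (Hqn : q * INR n = L * INR i) by (unfold q; field; lra).
replace (L * X * INR i / (2 * INR n)) with (q * X / 2) by (unfold q; field; lra).
assert (Lq : ln q = ln L + ln (INR i) - ln (INR n)).
{ unfold q; rewrite ln_div, ln_mult; auto; nra. }
destruct (le_lt_dec n (l * i)) as [H|H].
- set (i' := (l * i / n)%nat).
  assert (D1 : (n * i' <= l * i)%nat) by (apply Nat.Div0.mul_div_le).
  assert (D2 : (l * i < n * S i')%nat) by (apply Nat.mul_succ_div_gt; lia).
  assert (D3 : (1 <= i')%nat) by nia.
  assert (D4 : (i' <= l)%nat) by nia.
  assert (D5 : (2 * i' <= i + 1)%nat) by nia.
  apply Rle_trans with (1 := coef_exp i i' ltac:(lia) ltac:(lia) D5).
  apply Rmult_le_compat_l; auto; apply exp_le.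
  assert (Pi' : 1 <= INR i') by (apply (le_INR 1); auto).
  assert (G1 : INR i' <= q).
  { apply Rmult_le_reg_r with (INR n); auto; rewrite Hqn; unfold L.
    rewrite <- !mult_INR; apply le_INR; lia. }
  assert (G2 : q <= INR i' + 1).
  { apply Rmult_le_reg_r with (INR n); auto; rewrite Hqn; unfold L.
    rewrite <- S_INR, <- !mult_INR; apply le_INR; lia. }
  assert (G3 : ln (INR i') <= ln q) by (apply ln_le; lra).
  nra.
- assert (q1 : q <= 1).
  { apply Rmult_le_reg_r with (INR n); auto; rewrite Hqn, Rmult_1_l; unfold L.
    rewrite <- mult_INR; apply le_INR; lia. }
  assert (Q : - (q * ln q) <= 1).
  { generalize (ln_le_sub (/ q) (Rinv_0_lt_compat _ Hq)); rewrite ln_Rinv by auto; intros H1.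
    apply Rmult_le_compat_l with (r := q) in H1; [|lra].
    replace (q * (/ q - 1)) with (1 - q) in H1 by (field; lra); lra. }
  assert (Lq0 : ln q <= 0) by (rewrite <- ln_1; apply ln_le; lra).
  (* When the share [q] is less than one derivative, either one derivative gives
     [exp (- X - ln q) <= exp (- X / 2)], or [X] is so small that [q X / 2 <= - q ln q <= 1] and the
     trivial bound suffices; the factor 3 stands for [e]. *)
  destruct (Rle_lt_dec (- 2 * ln q) X) as [G|G].
  + apply Rle_trans with (1 := coef_exp i 1 ltac:(lia) ltac:(lia) ltac:(lia)).
    apply Rmult_le_compat_l; auto; apply exp_le.
    change (INR 1) with 1; rewrite ln_1; nra.
  + apply Rle_trans with (1 := coef_K i).
    rewrite <- (Rmult_1_r K) at 1; apply Rmult_le_compat_l; auto.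
    rewrite <- exp_0 at 1; apply exp_le.
    assert (q * X <= q * (- 2 * ln q)) by (apply Rmult_le_compat_l; lra); lra.
Qed.

(** Beyond [n] all [l] derivatives are spent, with the additional factor [(n / i)^l]. Only the
    exponent 2 is kept, which is enough for a summable tail. *)
Lemma coef_high i : (n < i)%nat -> b i <= K * exp (- (L * X)) * (INR n / INR i) ^ 2.
Proof.
intros Hi.
assert (Pi : 0 < INR i) by (apply lt_0_INR; lia).
apply Rle_trans with (1 := coef_exp i l ltac:(lia) ltac:(lia) ltac:(lia)).
rewrite Rmult_assoc; apply Rmult_le_compat_l; auto; fold L.
replace (L * (- X + ln (INR n) - ln (INR i) + ln L - ln L))
  with (- (L * X) + L * (ln (INR n) - ln (INR i))) by ring.
rewrite exp_plus; apply Rmult_le_compat_l; [left; apply exp_pos|].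
rewrite <- (exp_ln ((INR n / INR i) ^ 2)) by (apply pow_lt, Rdiv_lt_0_compat; auto).
rewrite ln_pow_nat, ln_div by (auto; apply Rdiv_lt_0_compat; auto).
apply exp_le.
assert (ln (INR n) <= ln (INR i)) by (apply ln_le; [auto | apply le_INR; lia]).
assert (2 <= L) by (apply (le_INR 2); auto).
simpl INR; nra.
Qed.

End CoefficientDecay.

(** * Decay of the coefficients of [f] *)

Lemma RInt_reflect Psi : cont Psi ->
  RInt Psi 0 (2 * PI) = RInt (fun t => Psi t + Psi (2 * PI - t)) 0 PI.
Proof.
intros HC.
assert (HC' : cont (fun t => Psi (-1 * t + 2 * PI))).
{ intros t; apply (continuous_comp (fun t => -1 * t + 2 * PI) Psi); auto.
  apply (ex_derive_continuous (fun t => -1 * t + 2 * PI)); auto_derive; auto. }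
rewrite (RInt_ext (fun t => Psi t + Psi (2 * PI - t)) (fun t => Psi t + Psi (-1 * t + 2 * PI)))
  by (intros; do 2 f_equal; ring).
rewrite RInt_Rplus by auto.
rewrite <- (RInt_Chasles Psi 0 PI (2 * PI)) by (apply cont_ex_RInt; auto).
unfold plus; simpl plus.
replace (RInt Psi PI (2 * PI)) with (RInt (fun t => Psi (-1 * t + 2 * PI)) 0 PI); auto.
rewrite <- (opp_RInt_swap Psi (2 * PI) PI) by (apply cont_ex_RInt; auto).
assert (E := RInt_comp_lin Psi (-1) (2 * PI) 0 PI).
replace (-1 * 0 + 2 * PI) with (2 * PI) in E by ring.
replace (-1 * PI + 2 * PI) with PI in E by ring.
rewrite <- E by (apply cont_ex_RInt; auto).
change (RInt (fun t => Psi (-1 * t + 2 * PI)) 0 PI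
  = - RInt (fun y => -1 * Psi (-1 * y + 2 * PI)) 0 PI).
assert (E3 := RInt_Rscal (-1) _ 0 PI HC'); cbv beta in E3; rewrite E3.
symmetry; Rring.
Qed.

Lemma cos_reflect t : cos (2 * PI - t) = cos t.
Proof. rewrite cos_minus, cos_2PI, sin_2PI; ring. Qed.

Lemma cosk_reflect k t : cos (INR k * (2 * PI - t)) = cos (INR k * t).
Proof. rewrite <- !Td_cos, cos_reflect; auto. Qed.

Lemma sink_reflect k t : sin (INR k * (2 * PI - t)) = - sin (INR k * t).
Proof.
replace (INR k * (2 * PI - t)) with (- (INR k * t) + 2 * INR k * PI) by ring.
rewrite sin_period, sin_neg; auto.
Qed.

Lemma cont_sink k : cont (fun x => sin (INR k * x)).
Proof.
intros x; apply (ex_derive_continuous (fun x => sin (INR k * x))); auto_derive; auto.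
Qed.

Lemma RInt_even_cos h k : cont (fun t => h (cos t)) ->
  RInt (fun t => h (cos t) * cos (INR k * t)) 0 (2 * PI) = 2 * alpha (fun t => h (cos t)) k.
Proof.
intros HC; rewrite RInt_reflect by (apply cont_mult; auto; apply cont_cosk).
unfold alpha; rewrite <- RInt_Rscal by (apply cont_mult; auto; apply cont_cosk).
apply RInt_ext; intros t _; rewrite cos_reflect, cosk_reflect; Rring.
Qed.

Lemma RInt_even_sin h k : cont (fun t => h (cos t)) ->
  RInt (fun t => h (cos t) * sin (INR k * t)) 0 (2 * PI) = 0.
Proof.
intros HC; rewrite RInt_reflect by (apply cont_mult; auto; apply cont_sink).
rewrite (RInt_ext _ (fun _ => 0)).
- rewrite RInt_Rconst; Rring.
- intros t _; rewrite cos_reflect, sink_reflect; Rring.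
Qed.

Lemma fst_sum_n (u : nat -> C) n : fst (sum_n u n) = sum_n (fun k => fst (u k)) n.
Proof. induction n as [|n IH]; [rewrite !sum_O | rewrite !sum_Sn, <- IH]; auto. Qed.

Lemma snd_sum_n (u : nat -> C) n : snd (sum_n u n) = sum_n (fun k => snd (u k)) n.
Proof. induction n as [|n IH]; [rewrite !sum_O | rewrite !sum_Sn, <- IH]; auto. Qed.

Lemma cospoly_real a b n x :
  cospoly (fun k => (a k, b k)) n 0 x =
    (sum_n (fun k => a k * cos (INR k * x)) n, sum_n (fun k => b k * cos (INR k * x)) n).
Proof.
unfold cospoly; apply injective_projections.
- etransitivity; [apply fst_sum_n |]; apply sum_n_ext; intros k; rewrite cosz_real; simpl; Rring.
- etransitivity; [apply snd_sum_n |]; apply sum_n_ext; intros k; rewrite cosz_real; simpl; Rring.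
Qed.

Lemma Cmod_le_sum (z : C) : Cmod z <= Rabs (fst z) + Rabs (snd z).
Proof.
destruct z as [a b]; simpl.
replace (a, b) with (Cplus (RtoC a) (Cmult Ci (RtoC b)))
  by (unfold Cplus, Cmult, Ci, RtoC; simpl; f_equal; ring).
apply Rle_trans with (1 := Cmod_triangle _ _).
rewrite Cmod_mult, !Cmod_R.
replace (Cmod Ci) with 1; [lra|].
unfold Cmod, Ci; simpl; replace (0 * (0 * 1) + 1 * (1 * 1)) with 1 by ring.
symmetry; apply sqrt_1.
Qed.

Section PowerDecay.

Variables (M N : nat -> R) (Cr s K : R).
Hypothesis HM : forall k, 0 < M k.
Hypothesis Hs : 0 < s.
Hypothesis HK : 0 <= K.
Hypothesis Hinc : almost_increasing M N Cr.
Hypothesis M0 : M 0%nat = 1.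

Let X n l := ln (INR n) - ln s - ln Cr - 1 - ln (N l) / INR l.

(** The restriction on [i] ensures that all divisors met in [i] integrations by parts are at least
    [k / 2]. *)
Definition coef_decay (Psi : R -> R) : Prop :=
  forall k i, (2 * i <= k + 1)%nat -> Rabs (fcoef Psi k) * INR k ^ i <= K * (s ^ i * M i).

Lemma truncation h n l : cont (fun t => h (cos t)) -> coef_decay (fun t => h (cos t)) ->
  (2 <= l)%nat -> (2 * l <= n)%nat -> forall t,
  Rabs (h (cos t) - sum_n (fun k => fcoef (fun t => h (cos t)) k * cos (INR k * t)) n)
    <= K * exp (- (INR l * X n l)) * INR n.
Proof.
intros Hc Hd Hl Hln t.
set (Psi := fun t => h (cos t)) in *.
set (b := fun k => Rabs (fcoef Psi k)).
assert (T := tail_inv_sq b (K * exp (- (INR l * X n l))) n ltac:(lia) (fun k => Rabs_pos _)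
   ltac:(apply Rmult_le_pos; [auto | left; apply exp_pos])
   (fun k Hk => coef_high M N Cr s K b n l HM Hs HK Hinc Hd Hl Hln k Hk)).
destruct T as [T1 T2].
(* The cosine series represents [Psi] on [[0, PI]] only; any real [t] is brought there by
   [acos (cos t)], which changes no cosine. *)
assert (Ht : 0 <= acos (cos t) <= PI) by apply acos_bound.
assert (E : forall k, cos (INR k * acos (cos t)) = cos (INR k * t)).
{ intros k; rewrite <- !Td_cos, cos_acos; auto; apply COS_bound. }
assert (EP : h (cos t) = Psi (acos (cos t))) by (unfold Psi; rewrite cos_acos; auto; apply COS_bound).
rewrite EP, (fourier_cos Psi Hc T1 _ Ht).
rewrite (sum_n_ext _ (fun k => fcoef Psi k * cos (INR k * acos (cos t)))) by (intros; rewrite E; auto).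
apply Rle_trans with (2 := T2), cosseries_tail; auto.
Qed.

Definition ccoef (Psi : R -> C) (k : nat) : C :=
  (fcoef (fun t => fst (Psi t)) k, fcoef (fun t => snd (Psi t)) k).

Definition ccont (F : R -> C) : Prop := cont (fun t => fst (F t)) /\ cont (fun t => snd (F t)).

Definition ccoef_decay (F : R -> C) : Prop :=
  coef_decay (fun t => fst (F t)) /\ coef_decay (fun t => snd (F t)).

Lemma ctruncation (h : R -> R * R) n l : ccont (fun t => h (cos t)) -> ccoef_decay (fun t => h (cos t)) ->
  (2 <= l)%nat -> (2 * l <= n)%nat -> forall t,
  Cmod (Cminus (h (cos t)) (cospoly (ccoef (fun t => h (cos t))) n 0 t))
    <= 2 * K * exp (- (INR l * X n l)) * INR n.
Proof.
intros [C1 C2] [D1 D2] Hl Hln t.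
apply Rle_trans with (1 := Cmod_le_sum _).
unfold ccoef; rewrite cospoly_real.
generalize (truncation (fun x => fst (h x)) n l C1 D1 Hl Hln t)
  (truncation (fun x => snd (h x)) n l C2 D2 Hl Hln t); intros T1 T2.
unfold Rminus in *; simpl; lra.
Qed.

(** Up to the stated height the growth [exp (k |y|)] of [cosz k] is cancelled by the decay in
    [coef_low], leaving [n + 1] bounded terms. *)
Lemma cospoly_strip (F : R -> C) n l : ccoef_decay F ->
  (2 <= l)%nat -> (2 * l <= n)%nat -> 0 <= X n l ->
  forall y x, Rabs y <= INR l * X n l / (2 * INR n) ->
  Cmod (cospoly (ccoef F) n y x) <= 6 * K * (INR n + 1).
Proof.
intros [D1 D2] Hl Hln HX y x Hy.
assert (n0 : 0 < INR n) by (apply lt_0_INR; lia).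
replace (6 * K * (INR n + 1)) with (INR (S n) * (6 * K)) by (rewrite S_INR; ring).
rewrite <- sum_n_const; apply Cmod_sum_n_le; intros k Hk.
rewrite Cmod_mult.
set (e := INR l * X n l * INR k / (2 * INR n)).
apply Rle_trans with (6 * K * exp (- e) * exp e).
- apply Rmult_le_compat; try apply Cmod_ge_0.
  + apply Rle_trans with (1 := Cmod_le_sum _); simpl.
    generalize (coef_low M N Cr s K _ n l HM Hs HK Hinc D1 M0 Hl Hln HX k Hk)
      (coef_low M N Cr s K _ n l HM Hs HK Hinc D2 M0 Hl Hln HX k Hk).
    fold (X n l); fold e; lra.
  + apply Rle_trans with (1 := Cmod_cosz k y x), exp_le.
    unfold e; replace (INR l * X n l * INR k / (2 * INR n))
      with (INR k * (INR l * X n l / (2 * INR n))) by (field; lra).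
    apply Rmult_le_compat_l; auto; apply pos_INR.
- rewrite Rmult_assoc, <- exp_plus, Rplus_opp_l, exp_0; lra.
Qed.

Variables (j : nat) (h : R -> R * R) (A0 : R).
Let phi t : C := h (cos t).
Hypothesis Hj : (1 <= j)%nat.
Hypothesis HA0 : 1 <= A0.
Hypothesis HKA : 6 * K <= A0.
Hypothesis Hphi : forall t, Cmod (phi t) <= A0.
Hypothesis Hphij : forall t, Cmod (phi t) ^ j <= A0.
Hypothesis HphiS : forall t, Cmod (phi t) ^ S j <= A0.
Hypothesis Cphi : ccont phi.
Hypothesis Cphij : ccont (fun t => Cpow (phi t) j).
Hypothesis CphiS : ccont (fun t => Cpow (phi t) (S j)).
Hypothesis Dphij : ccoef_decay (fun t => Cpow (phi t) j).
Hypothesis DphiS : ccoef_decay (fun t => Cpow (phi t) (S j)).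

(** [C2] collects the constants of the Bernstein-Walsh hypothesis and [C1] those of the three terms
    of the core estimate; neither depends on [n] or [l]. The exponent [c'] is [1 / (j (j+1))] halved
    twice: once for the growth in the strip, once for the logarithm. *)
Let C2 := 12 * INR (S j) ^ 2 * (2 * A0) ^ S j * K + 1.
Let C1 := PI * (20 + 8 * INR j) * (4 * A0 ^ 2) * C2.
Let c' := / (4 * (INR j * INR (S j))).

Let J1 : 1 <= INR j.
Proof. apply (le_INR 1); auto. Qed.

Let C2_ge1 : 1 <= C2.
Proof.
unfold C2; assert (0 <= 12 * INR (S j) ^ 2 * (2 * A0) ^ S j * K); [|lra].
apply Rmult_le_pos; [apply Rmult_le_pos; [apply Rmult_le_pos; [lra |] |] | auto];
  apply pow_le; [apply pos_INR | lra].
Qed.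

Let C1_ge : 2 * PI * A0 * C2 <= C1.
Proof.
unfold C1; generalize PI_RGT_0; intros.
replace (PI * (20 + 8 * INR j) * (4 * A0 ^ 2) * C2) with ((PI * A0 * C2) * ((20 + 8 * INR j) * (4 * A0))) by ring.
replace (2 * PI * A0 * C2) with (PI * A0 * C2 * 2) by ring.
apply Rmult_le_compat_l; [repeat first [lra | apply Rmult_le_pos] | nra].
Qed.

Lemma RInt_decay lam n l : Cmod lam = 1 -> (2 <= l)%nat -> (2 * l <= n)%nat ->
  Rabs (RInt (fun x => fst (Cmult lam (Cmult (phi x) (Ez (INR n) 0 x)))) 0 (2 * PI))
    <= C1 * INR n ^ 3 * exp (- (c' * (INR l * X n l))).
Proof.
intros Hlam Hl Hln.
assert (n1 : 1 <= INR n) by (apply (le_INR 1); lia).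
assert (l0 : 0 < INR l) by (apply lt_0_INR; lia).
generalize PI_RGT_0; intros HPI.
set (v := fun x => fst (Cmult lam (Cmult (phi x) (Ez (INR n) 0 x)))).
assert (Cv : cont v).
{ intros x; apply continuous_ext with (fun x =>
    fst lam * (fst (phi x) * cos (INR n * x) - snd (phi x) * sin (INR n * x))
    - snd lam * (fst (phi x) * sin (INR n * x) + snd (phi x) * cos (INR n * x))).
  - intros t; unfold v, Ez; rewrite Rmult_0_r, exp_0; simpl; ring.
  - destruct Cphi as [P1 P2].
    revert x; repeat first [apply cont_minus | apply cont_plus | apply cont_mult];
      auto using cont_const, cont_cosk, cont_sink. }
assert (Bv : forall x, Rabs (v x) <= A0).
{ intros x; apply Rle_trans with (1 := Rmax_l _ (Rabs (snd (Cmult lam (Cmult (phi x) (Ez (INR n) 0 x)))))).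
  apply Rle_trans with (1 := Rmax_Cmod _).
  rewrite !Cmod_mult, Hlam, Cmod_Ez, Rmult_0_r, exp_0; generalize (Hphi x); lra. }
assert (Triv : Rabs (RInt v 0 (2 * PI)) <= 2 * PI * A0).
{ replace (2 * PI * A0) with ((2 * PI - 0) * A0) by ring; apply Rabs_RInt_le; auto; lra. }
set (Y := INR l * X n l).
set (E' := exp (- (c' * Y))).
assert (E'0 : 0 < E') by apply exp_pos.
assert (n3 : INR n <= INR n ^ 3) by (apply pow_ge_self; auto).
assert (c'0 : 0 < c') by (apply Rinv_0_lt_compat; rewrite S_INR; nra).
(* The trivial bound of the integral settles the cases [X <= 0] and [rho > 1], where the core
   estimate is not applied. *)
assert (triv2 : 1 <= C2 * INR n * E' -> Rabs (RInt v 0 (2 * PI)) <= C1 * INR n ^ 3 * E').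
{ intros H1; apply Rle_trans with (1 := Triv).
  apply Rle_trans with (2 * PI * A0 * (C2 * INR n * E')); [rewrite <- (Rmult_1_r (2 * PI * A0)) at 1; apply Rmult_le_compat_l; [nra | auto]|].
  replace (2 * PI * A0 * (C2 * INR n * E')) with ((2 * PI * A0 * C2) * INR n * E') by ring.
  apply Rmult_le_compat_r; [lra|]; apply Rmult_le_compat; auto; try lra.
  repeat first [lra | apply Rmult_le_pos]. }
destruct (Rle_lt_dec (X n l) 0) as [HX|HX].
{ apply triv2.
  assert (1 <= E').
  { unfold E'; rewrite <- exp_0; apply exp_le; unfold Y.
    assert (INR l * X n l <= 0) by nra; nra. }
  assert (1 <= C2 * INR n) by nra.
  clearbody C2 E'; nra. }
assert (HY : 0 < Y) by (unfold Y; nra).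
set (kappa := / (2 * (INR j * INR (S j)))).
assert (k0 : 0 < kappa) by (apply Rinv_0_lt_compat; rewrite S_INR; nra).
assert (k1 : kappa <= 1).
{ unfold kappa; rewrite <- Rinv_1; apply Rinv_le_contravar; [lra | rewrite S_INR; nra]. }
(* The power [kappa] reduces [n^(j+3)] to at most [n], with equality for [j = 1]. *)
assert (k3 : kappa * INR (j + 3) <= 1).
{ unfold kappa; apply Rmult_le_reg_l with (2 * (INR j * INR (S j))); [rewrite S_INR; nra|].
  rewrite <- Rmult_assoc, Rinv_r by (rewrite S_INR; nra).
  rewrite plus_INR, (S_INR j); simpl (INR 3); nra. }
(* In [n^(j+3)], one factor comes from the degree, [j + 1] from [A^(j+1)], and one from [delta]. *)
set (rho := C2 * INR n ^ (j + 3) * exp (- (Y / 2))).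
assert (rho0 : 0 < rho).
{ repeat apply Rmult_lt_0_compat; [lra | apply pow_lt; lra | apply exp_pos]. }
set (gam := exp (kappa * ln rho)).
assert (g0 : 0 < gam) by apply exp_pos.
assert (gE : gam <= C2 * INR n * E').
{ unfold gam, E', rho.
  rewrite !ln_mult, ln_exp, ln_pow_nat; try lra; try apply exp_pos; try (apply pow_lt; lra).
  2:{ apply Rmult_lt_0_compat; [lra | apply pow_lt; lra]. }
  rewrite <- (exp_ln (C2 * INR n)) by nra.
  rewrite <- exp_plus; apply exp_le; rewrite ln_mult by lra.
  assert (L1 : 0 <= ln C2) by (rewrite <- ln_1; apply ln_le; lra).
  assert (L2 : 0 <= ln (INR n)) by (rewrite <- ln_1; apply ln_le; lra).
  assert (Ec : c' * Y = kappa * (Y / 2)) by (unfold c', kappa; field; rewrite S_INR; split; lra).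
  rewrite Ec.
  assert (kappa * ln C2 <= ln C2) by nra.
  assert (kappa * INR (j + 3) * ln (INR n) <= ln (INR n)) by nra.
  lra. }
destruct (Rle_lt_dec rho 1) as [Hrho|Hrho].
2:{ apply triv2; apply Rle_trans with (2 := gE); unfold gam; rewrite <- exp_0; apply exp_le.
    apply Rmult_le_pos; [lra | rewrite <- ln_1; apply ln_le; lra]. }
assert (g1 : gam <= 1).
{ unfold gam; rewrite <- exp_0; apply exp_le.
  assert (ln rho <= 0) by (rewrite <- ln_1; apply ln_le; auto); nra. }
assert (grho : gam ^ (2 * (j * S j)) = rho).
{ unfold gam; rewrite <- (exp_ln rho) at 2 by auto.
  rewrite <- (exp_ln (exp (kappa * ln rho) ^ (2 * (j * S j)))) by (apply pow_lt, exp_pos).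
  rewrite ln_pow_nat, ln_exp by apply exp_pos; f_equal.
  rewrite !mult_INR; unfold kappa; simpl (INR 2); field; rewrite S_INR; split; lra. }
(* The square is deliberate: one factor [gam] is kept as the gain, the other absorbs [ln (1 / gam)]
   in the contour shift. *)
set (beta := gam ^ 2).
assert (b0 : 0 < beta <= 1) by (unfold beta; nra).
set (A := A0 * (INR n + 1)).
assert (HA : A0 <= A) by (unfold A; nra).
assert (HA2 : A <= 2 * A0 * INR n) by (unfold A; nra).
set (delta := 2 * K * exp (- Y) * INR n).
(* At this height the Bernstein-Walsh factor is [exp (Y / 2)], half of what [delta] provides. *)
set (y0 := Y / (2 * INR n * INR (S j))).
assert (Sj : 2 <= INR (S j)) by (rewrite S_INR; lra).
assert (y00 : 0 < y0) by (apply Rdiv_lt_0_compat; nra).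
assert (y0Y : y0 <= Y / (2 * INR n)).
{ unfold y0, Rdiv; apply Rmult_le_compat_l; [lra|]; apply Rinv_le_contravar; nra. }
assert (Strip : forall F, ccoef_decay F -> forall y x, Rabs y <= y0 -> Cmod (cospoly (ccoef F) n y x) <= A).
{ intros F HF y x Hy; apply Rle_trans with (6 * K * (INR n + 1)).
  - apply (cospoly_strip F n l); auto; [lra | fold Y; lra].
  - unfold A; apply Rmult_le_compat_r; lra. }
assert (HE : INR (S (S j * (2 * n))) * (INR (2 * S j) * A ^ S j * delta)
    * exp (INR (S j) * INR n * y0) <= beta ^ (j * S j)).
{ unfold beta; rewrite <- pow_mult, grho; unfold rho, delta.
  replace (INR (S j) * INR n * y0) with (Y / 2) by (unfold y0; field; lra).
  replace (exp (- Y)) with (exp (- (Y / 2)) * exp (- (Y / 2)))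
    by (rewrite <- exp_plus; f_equal; field).
  assert (X1 : exp (- (Y / 2)) * exp (Y / 2) = 1)
    by (rewrite <- exp_plus, Rplus_opp_l; apply exp_0).
  set (e := exp (- (Y / 2))) in *.
  assert (e0 : 0 < e) by apply exp_pos.
  replace (INR (S (S j * (2 * n))) * (INR (2 * S j) * A ^ S j * (2 * K * (e * e) * INR n)) * exp (Y / 2))
    with (INR (S (S j * (2 * n))) * (INR (2 * S j) * A ^ S j * (2 * K * INR n)) * e * (e * exp (Y / 2))) by ring.
  rewrite X1, Rmult_1_r; apply Rmult_le_compat_r; [lra|].
  assert (I1 : INR (S (S j * (2 * n))) <= 3 * INR (S j) * INR n).
  { rewrite (S_INR (S j * (2 * n))), !mult_INR; simpl (INR 2); nra. }
  assert (I2 : A ^ S j <= (2 * A0) ^ S j * INR n ^ S j).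
  { rewrite <- Rpow_mult_distr; apply pow_incr; lra. }
  assert (P0 : 0 < A ^ S j) by (apply pow_lt; lra).
  apply Rle_trans with (3 * INR (S j) * INR n * (2 * INR (S j) * ((2 * A0) ^ S j * INR n ^ S j) * (2 * K * INR n))).
  - rewrite mult_INR; simpl (INR 2).
    apply Rmult_le_compat; auto; try apply pos_INR.
    + repeat first [lra | apply Rmult_le_pos].
    + apply Rmult_le_compat_r; [repeat first [lra | apply Rmult_le_pos]|].
      apply Rmult_le_compat_l; lra.
  - replace (INR n ^ (j + 3)) with (INR n ^ S j * (INR n * INR n))
      by (replace (j + 3)%nat with (S j + 2)%nat by lia; rewrite pow_add; ring).
    assert (0 <= INR n ^ S j * (INR n * INR n)) by (apply Rmult_le_pos; [apply pow_le|]; nra).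
    unfold C2; nra. }
assert (Core := core_estimate j n n (ccoef (fun t => Cpow (phi t) j)) (ccoef (fun t => Cpow (phi t) (S j)))
  phi A delta beta y0 lam Hj b0 ltac:(lra) y00 Hlam).
fold v in Core.
assert (Core' : Rabs (RInt v 0 (2 * PI)) <= 2 * PI * (3 * A * beta)
   + 2 * PI * (4 * A * exp (- INR n * (y0 / 2)))
      + PI * (2 * beta) * (2 + ln ((A ^ 2 + 1) / (beta ^ j) ^ 2))).
{ apply Core; clear Core; auto.
  - intros x; generalize (Hphi x); lra.
  - intros x; generalize (Hphij x); lra.
  - intros x; generalize (HphiS x); lra.
  - apply (cont2_fun2 v Cv).
  - intros x; apply (ctruncation (fun x => Cpow (h x) j) n l); auto.
  - intros x; apply (ctruncation (fun x => Cpow (h x) (S j)) n l); auto. }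
clear Core.
apply Rle_trans with (1 := Core').
assert (B1 : exp (- INR n * (y0 / 2)) <= E').
{ unfold E'; apply exp_le; unfold y0, c'.
  replace (- INR n * (Y / (2 * INR n * INR (S j)) / 2)) with (- (/ (4 * INR (S j)) * Y)) by (field; lra).
  apply Ropp_le_contravar, Rmult_le_compat_r; [lra|].
  apply Rinv_le_contravar; nra. }
assert (B2 : beta * ln ((A ^ 2 + 1) / (beta ^ j) ^ 2) <= gam * (A ^ 2 + 4 * INR j)).
{ assert (Q0 : 0 < (beta ^ j) ^ 2) by (apply pow_lt, pow_lt; lra).
  rewrite ln_div by nra.
  rewrite ln_pow_nat, ln_pow_nat by (try apply pow_lt; lra).
  unfold beta at 2; rewrite ln_pow_nat by auto.
  assert (L1 : ln (A ^ 2 + 1) <= A ^ 2) by (generalize (ln_le_sub (A ^ 2 + 1) ltac:(nra)); lra).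
  assert (L2 : - ln gam <= / gam).
  { rewrite <- ln_Rinv by auto; generalize (ln_le_sub (/ gam) (Rinv_0_lt_compat _ g0)); lra. }
  simpl (INR 2).
  assert (L3 : gam * (- ln gam) <= 1).
  { apply Rle_trans with (gam * / gam); [apply Rmult_le_compat_l; lra | rewrite Rinv_r; lra]. }
  assert (L4 : gam * ln (A ^ 2 + 1) <= A ^ 2).
  { assert (0 <= ln (A ^ 2 + 1)) by (rewrite <- ln_1; apply ln_le; nra). nra. }
  assert (L5 : INR j * (gam * (- ln gam)) <= INR j) by nra.
  unfold beta.
  replace (gam ^ 2 * (ln (A ^ 2 + 1) - (1 + 1) * (INR j * ((1 + 1) * ln gam))))
    with (gam * (gam * ln (A ^ 2 + 1) + 4 * (INR j * (gam * (- ln gam))))) by ring.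
  apply Rmult_le_compat_l; lra. }
assert (bg : beta <= gam) by (unfold beta; nra).
assert (AA : A <= A ^ 2) by nra.
assert (A21 : 1 <= A ^ 2) by nra.
set (Z := C2 * INR n * E') in *.
assert (EZ : E' <= Z).
{ unfold Z; rewrite <- (Rmult_1_l E') at 1; apply Rmult_le_compat_r; nra. }
assert (S1 : A * beta <= A ^ 2 * Z) by (apply Rmult_le_compat; lra).
assert (S2 : A * exp (- INR n * (y0 / 2)) <= A ^ 2 * Z).
{ apply Rmult_le_compat; try lra; left; apply exp_pos. }
assert (S3 : beta <= A ^ 2 * Z) by nra.
assert (S4 : gam * A ^ 2 <= A ^ 2 * Z) by (rewrite Rmult_comm; apply Rmult_le_compat_l; lra).
assert (S5 : INR j * gam <= INR j * (A ^ 2 * Z)) by (apply Rmult_le_compat_l; nra).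
apply Rle_trans with (PI * (20 + 8 * INR j) * (A ^ 2 * Z)).
- apply Rle_trans with (PI * (6 * (A * beta) + 8 * (A * exp (- INR n * (y0 / 2))) + 4 * beta + 2 * (beta * ln ((A ^ 2 + 1) / (beta ^ j) ^ 2)))); [right; ring|].
  rewrite Rmult_assoc; apply Rmult_le_compat_l; lra.
- unfold C1, Z.
  replace (PI * (20 + 8 * INR j) * (4 * A0 ^ 2) * C2 * INR n ^ 3 * E')
    with (PI * (20 + 8 * INR j) * ((2 * A0 * INR n) ^ 2 * (C2 * INR n * E'))) by ring.
  apply Rmult_le_compat_l; [apply Rmult_le_pos; lra|].
  apply Rmult_le_compat_r; [fold Z; lra|].
  apply pow_incr; lra.
Qed.

Lemma fcoef_decay : exists C3, 0 <= C3 /\ forall n l, (2 <= l)%nat -> (2 * l <= n)%nat ->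
  Rabs (fcoef (fun t => fst (phi t)) n) <= C3 * INR n ^ 3 * exp (- (c' * (INR l * X n l))) /\
  Rabs (fcoef (fun t => snd (phi t)) n) <= C3 * INR n ^ 3 * exp (- (c' * (INR l * X n l))).
Proof.
exists C1; split.
{ generalize PI_RGT_0; intros; apply Rle_trans with (2 := C1_ge); repeat first [lra | apply Rmult_le_pos]. }
intros n l Hl Hln; destruct Cphi as [P1 P2].
(* The units [1] and [-i] select the real and the imaginary part of [phi]; the sine integrals vanish
   because [phi] is even. *)
assert (I1 := RInt_decay (RtoC 1) n l Cmod_1 Hl Hln).
assert (Hi : Cmod (0, -1) = 1).
{ unfold Cmod; simpl; replace (0 * (0 * 1) + -1 * (-1 * 1)) with 1 by ring; apply sqrt_1. }
assert (I2 := RInt_decay (0, -1) n l Hi Hl Hln).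
assert (E1 : RInt (fun x => fst (Cmult (RtoC 1) (Cmult (phi x) (Ez (INR n) 0 x)))) 0 (2 * PI)
  = 2 * alpha (fun t => fst (phi t)) n).
{ rewrite (RInt_ext _ (fun x => fst (phi x) * cos (INR n * x) - snd (phi x) * sin (INR n * x))).
  2:{ intros t _; unfold Ez; rewrite Rmult_0_r, exp_0; simpl; Rring. }
  rewrite RInt_Rminus by (apply cont_mult; auto using cont_cosk, cont_sink).
  unfold phi at 1 2; rewrite (RInt_even_cos (fun x => fst (h x))), (RInt_even_sin (fun x => snd (h x))) by auto.
  unfold phi; Rring. }
assert (E2 : RInt (fun x => fst (Cmult (0, -1) (Cmult (phi x) (Ez (INR n) 0 x)))) 0 (2 * PI)
  = 2 * alpha (fun t => snd (phi t)) n).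
{ rewrite (RInt_ext _ (fun x => snd (phi x) * cos (INR n * x) + fst (phi x) * sin (INR n * x))).
  2:{ intros t _; unfold Ez; rewrite Rmult_0_r, exp_0; simpl; Rring. }
  rewrite RInt_Rplus by (apply cont_mult; auto using cont_cosk, cont_sink).
  unfold phi at 1 2; rewrite (RInt_even_cos (fun x => snd (h x))), (RInt_even_sin (fun x => fst (h x))) by auto.
  unfold phi; Rring. }
rewrite E1, Rabs_mult, Rabs_right in I1 by lra.
rewrite E2, Rabs_mult, Rabs_right in I2 by lra.
generalize (kap_pos n) (kap_le n); intros k0 k1.
unfold fcoef; rewrite !Rabs_mult, (Rabs_right (kap n)) by lra.
split; [generalize (Rabs_pos (alpha (fun t => fst (phi t)) n)) |
  generalize (Rabs_pos (alpha (fun t => snd (phi t)) n))]; nra.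
Qed.

End PowerDecay.

(** * Complex derivatives and continuity of the base *)

Lemma is_derive_fst (F : R -> R * R) x (l : R * R) :
  is_derive (V := prod_NormedModule R_AbsRing R_NormedModule R_NormedModule) F x l ->
  is_derive (fun t => fst (F t)) x (fst l).
Proof.
intros H; unfold is_derive.
exact (filterdiff_comp F fst _ fst H (filterdiff_linear _ is_linear_fst)).
Qed.

Lemma is_derive_snd (F : R -> R * R) x (l : R * R) :
  is_derive (V := prod_NormedModule R_AbsRing R_NormedModule R_NormedModule) F x l ->
  is_derive (fun t => snd (F t)) x (snd l).
Proof.
intros H; unfold is_derive.
exact (filterdiff_comp F snd _ snd H (filterdiff_linear _ is_linear_snd)).
Qed.

Lemma is_derive_pair (a b : R -> R) x la lb : is_derive a x la -> is_derive b x lb ->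
  is_derive (V := prod_NormedModule R_AbsRing R_NormedModule R_NormedModule)
    (fun t => (a t, b t)) x (la, lb).
Proof.
intros Ha Hb.
apply (filterdiff_comp_2 a b pair (fun y => scal y la) (fun y => scal y lb) pair Ha Hb).
eapply filterdiff_ext_lin; [eapply filterdiff_ext; [|apply filterdiff_id]|]; intros []; auto.
Qed.

Definition ccontinuous (F : R -> C) (x : R) : Prop :=
  continuous (fun t => fst (F t)) x /\ continuous (fun t => snd (F t)) x.

Lemma ccontinuous_eps F x : ccontinuous F x <->
  forall e, 0 < e -> exists d, 0 < d /\ forall y, Rabs (y - x) < d -> Cmod (Cminus (F y) (F x)) < e.
Proof.
assert (comp : forall z : C, Rabs (fst z) <= Cmod z /\ Rabs (snd z) <= Cmod z).
{ intros z; split; apply Rle_trans with (2 := Rmax_Cmod z); [apply Rmax_l | apply Rmax_r]. }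
assert (crit : forall f : R -> R, continuous f x <->
  forall e, 0 < e -> exists d, 0 < d /\ forall y, Rabs (y - x) < d -> Rabs (f y - f x) < e).
{ intros f; split.
  - intros H e He; destruct (H (fun z => Rabs (z - f x) < e)) as [d Hd].
    + exists (mkposreal e He); intros z Hz; exact Hz.
    + exists d; split; [apply cond_pos | exact Hd].
  - intros H P [e He]; destruct (H e (cond_pos e)) as [d [Hd1 Hd2]].
    exists (mkposreal d Hd1); intros y Hy; apply He, Hd2, Hy. }
unfold ccontinuous; rewrite !crit; split.
- intros [H1 H2] e He.
  destruct (H1 (e / 2) ltac:(lra)) as [d1 [D1 E1]]; destruct (H2 (e / 2) ltac:(lra)) as [d2 [D2 E2]].
  exists (Rmin d1 d2); split; [apply Rmin_pos; auto|]; intros y Hy.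
  apply Rle_lt_trans with (1 := Cmod_le_sum _).
  generalize (Rmin_l d1 d2) (Rmin_r d1 d2) (E1 y) (E2 y); unfold Rminus; simpl; intros M1 M2 E1' E2'.
  generalize (E1' ltac:(unfold Rminus in Hy; lra)) (E2' ltac:(unfold Rminus in Hy; lra)); lra.
- intros H; split; intros e He; destruct (H e He) as [d [D E]]; exists d; split; auto; intros y Hy;
    apply Rle_lt_trans with (2 := E y Hy);
    [apply (comp (Cminus (F y) (F x))) | apply (comp (Cminus (F y) (F x)))].
Qed.

(** In [property_D] the function [f] is arbitrary, so continuity has to be extracted from the powers
    before integrals of [f] can be used. At a zero, smallness of [F^j] suffices. Elsewhere [F x ^ j]
    is nonzero, and [(F y - F x) F x ^ j] is a combination of the increments of the two powers. *)
Lemma ccontinuous_of_powers F x j : (1 <= j)%nat ->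
  ccontinuous (fun t => Cpow (F t) j) x -> ccontinuous (fun t => Cpow (F t) (S j)) x ->
  ccontinuous F x.
Proof.
intros Hj H1 H2.
rewrite ccontinuous_eps in H1; rewrite ccontinuous_eps in H2.
apply ccontinuous_eps; intros e He.
destruct (Ceq_dec (F x) (RtoC 0)) as [E|E].
- destruct (H1 (e ^ j) ltac:(apply pow_lt; auto)) as [d [D Hd]].
  exists d; split; auto; intros y Hy; specialize (Hd y Hy).
  rewrite E in *; replace (Cpow (RtoC 0) j) with (RtoC 0) in Hd
    by (destruct j; [lia | simpl; ring]).
  replace (Cminus (Cpow (F y) j) (RtoC 0)) with (Cpow (F y) j) in Hd by ring.
  replace (Cminus (F y) (RtoC 0)) with (F y) by ring.
  rewrite Cmod_Cpow in Hd; apply Rnot_le_lt; intros L.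
  apply (Rlt_irrefl (e ^ j)), Rle_lt_trans with (2 := Hd), pow_incr; lra.
- assert (Hx : 0 < Cmod (F x)) by (apply Cmod_gt_0; auto).
  set (a := Cmod (F x) ^ j); assert (Ha : 0 < a) by (apply pow_lt; auto).
  set (B := a + 2).
  assert (He' : 0 < Rmin 1 (e * a / (1 + B))).
  { apply Rmin_pos; [lra | apply Rdiv_lt_0_compat; unfold B; nra]. }
  set (e' := Rmin 1 (e * a / (1 + B))) in *.
  assert (e1 : e' <= 1) by apply Rmin_l.
  assert (e2 : e' * (1 + B) <= e * a).
  { apply Rle_trans with (e * a / (1 + B) * (1 + B)).
    - apply Rmult_le_compat_r; [unfold B; lra | apply Rmin_r].
    - right; field; unfold B; lra. }
  destruct (H1 e' He') as [d1 [D1 E1]]; destruct (H2 e' He') as [d2 [D2 E2]].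
  exists (Rmin d1 d2); split; [apply Rmin_pos; auto|]; intros y Hy.
  generalize (Rmin_l d1 d2) (Rmin_r d1 d2); intros M1 M2.
  specialize (E1 y ltac:(lra)); specialize (E2 y ltac:(lra)).
  assert (Hy1 : Cmod (F y) ^ j <= a + 1).
  { rewrite <- Cmod_Cpow.
    replace (Cpow (F y) j) with (Cplus (Cpow (F x) j) (Cminus (Cpow (F y) j) (Cpow (F x) j))) by ring.
    apply Rle_trans with (1 := Cmod_triangle _ _); rewrite Cmod_Cpow; fold a; lra. }
  assert (Hy2 : Cmod (F y) <= B).
  { apply Rnot_lt_le; intros L.
    assert (Cmod (F y) <= Cmod (F y) ^ j) by (apply pow_ge_self; auto; unfold B in L; lra).
    unfold B in L; lra. }
  apply Rmult_lt_reg_r with a; auto.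
  unfold a at 1; rewrite <- Cmod_Cpow, <- Cmod_mult.
  replace (Cmult (Cminus (F y) (F x)) (Cpow (F x) j)) with
    (Cminus (Cminus (Cpow (F y) (S j)) (Cpow (F x) (S j)))
      (Cmult (F y) (Cminus (Cpow (F y) j) (Cpow (F x) j)))) by (simpl; ring).
  unfold Cminus at 1; apply Rle_lt_trans with (1 := Cmod_triangle _ _).
  rewrite Cmod_opp, Cmod_mult.
  assert (Cmod (F y) * Cmod (Cminus (Cpow (F y) j) (Cpow (F x) j)) <= B * e').
  { apply Rmult_le_compat; auto; try apply Cmod_ge_0; lra. }
  lra.
Qed.

Lemma pow_le_exp_fact l : INR (l + 5) ^ l <= exp (INR (l + 5)) * INR (fact l).
Proof.
destruct l as [|l'].
{ simpl pow; rewrite Nat.add_0_l; simpl fact; change (INR 1) with 1.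
  rewrite Rmult_1_r; generalize (exp_ineq1_le (INR 5)) (pos_INR 5); lra. }
set (l := S l'); assert (l0 : 0 < INR l) by (apply lt_0_INR; unfold l; lia).
rewrite <- (exp_ln (INR (fact l))) by apply fact_pos.
rewrite <- exp_plus.
rewrite <- (exp_ln (INR (l + 5) ^ l)) by (apply pow_lt, lt_0_INR; lia).
apply exp_le; rewrite ln_pow_nat by (apply lt_0_INR; lia).
generalize (ln_fact_ge l ltac:(unfold l; lia)); intros H.
rewrite plus_INR; simpl (INR 5).
set (f := 1 + 1 + 1 + 1 + 1).
assert (H2 : INR l * (ln (INR l + f) - ln (INR l)) <= f).
{ rewrite <- ln_div by (unfold f; lra).
  generalize (ln_le_sub ((INR l + f) / INR l) ltac:(apply Rdiv_lt_0_compat; unfold f; lra)).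
  replace ((INR l + f) / INR l - 1) with (f / INR l) by (field; lra).
  intros H1; apply Rle_trans with (INR l * (f / INR l)); [apply Rmult_le_compat_l; lra|].
  right; field; lra. }
lra.
Qed.

Lemma le_pow2 l : INR (l + 5) <= 6 * 2 ^ l.
Proof.
induction l as [|l IH]; [simpl; lra|].
replace (S l + 5)%nat with (S (l + 5)) by lia; rewrite S_INR; simpl pow.
assert (1 <= 2 ^ l) by (apply pow_R1_Rle; lra); lra.
Qed.

(** * From coefficient decay to the target weight *)

Section FinalCoefficients.

Variables (N N1 M' : nat -> R) (Cr Cd Cm c' : R) (p : nat).
Hypothesis HN : forall k, 0 < N k.
Hypothesis HN1 : forall k, 0 < N1 k.
Hypothesis HM' : forall k, 0 < M' k.
Hypothesis Hroot : root_to_infty (lowr M').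
Hypothesis HCr : 1 <= Cr.
Hypothesis HCd : 1 <= Cd.
Hypothesis HCm : 1 <= Cm.
Hypothesis Hd : forall l, N (2 ^ p * l)%nat <= Cd ^ (2 ^ p * l) * N1 l ^ (2 ^ p).
Hypothesis Hm : forall i k, (1 <= i + k)%nat -> N1 (i + k)%nat <= Cm ^ (i + k) * (M' i * M' k).
Hypothesis Hp : (1 <= p)%nat.
Hypothesis Hc' : 0 < c'.
Hypothesis Hpc : 1 <= c' * INR (2 ^ p).

Variables (s C3 B0 : R) (b : nat -> R).
Hypothesis Hs : 0 < s.
Hypothesis HC3 : 0 <= C3.
Hypothesis HB0 : 0 <= B0.
Hypothesis Hb0 : forall n, 0 <= b n <= B0.
Hypothesis Hb : forall n l, (2 <= l)%nat -> (2 * l <= n)%nat ->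
  b n <= C3 * INR n ^ 3 * exp (- (c' * (INR l * (ln (INR n) - ln s - ln Cr - 1 - ln (N l) / INR l)))).

Let Theta := Cr * exp 1 * Cd.

Let Theta_pos : 0 < Theta.
Proof. unfold Theta; generalize (exp_pos 1); intros; apply Rmult_lt_0_compat; nra. Qed.

Let p2 : (2 <= 2 ^ p)%nat.
Proof. destruct p as [|q]; [lia|]; simpl; generalize (Nat.pow_nonzero 2 q ltac:(lia)); lia. Qed.

(* The doubling property, iterated until [2 ^ p] beats [1 / c'], removes the power
   [c'] lost in the division. *)
Lemma coef_doubling n l0 : (1 <= l0)%nat -> (2 * (2 ^ p * l0) <= n)%nat ->
  b n * INR n ^ l0 <= (C3 + B0) * INR n ^ 3 * ((s * Theta) ^ l0 * N1 l0).
Proof.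
intros Hl0 Hn.
assert (n1 : 1 <= INR n) by (apply (le_INR 1); lia).
(* [exp Bq] is the wanted bound divided by [n^l0]. If [Bq <= 0], then [l = 2^p l0] gives
   [exp (c' 2^p Bq)], and [c' 2^p >= 1] makes this at most [exp Bq]; if [Bq > 0], boundedness of [b]
   suffices. *)
set (Bq := INR l0 * (ln s + ln Cr + 1 + ln Cd - ln (INR n)) + ln (N1 l0)).
assert (EB : exp Bq * INR n ^ l0 = (s * Theta) ^ l0 * N1 l0).
{ rewrite <- (exp_ln (INR n ^ l0)) by (apply pow_lt; lra).
  rewrite <- (exp_ln ((s * Theta) ^ l0)) by (apply pow_lt; nra).
  rewrite <- (exp_ln (N1 l0)) by auto.
  rewrite <- !exp_plus; f_equal; rewrite !ln_pow_nat by nra.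
  unfold Theta; rewrite !ln_mult, ln_exp; try lra; try apply exp_pos.
  - unfold Bq; ring.
  - generalize (exp_pos 1); nra.
  - exact Theta_pos. }
rewrite <- EB, <- Rmult_assoc.
apply Rmult_le_compat_r; [apply pow_le; lra|].
assert (n3 : 1 <= INR n ^ 3) by (apply pow_R1_Rle; auto).
assert (eB : 0 < exp Bq) by apply exp_pos.
destruct (Rle_lt_dec Bq 0) as [L|L].
- set (l := (2 ^ p * l0)%nat) in *.
  assert (l2 : (2 <= l)%nat) by (unfold l; nia).
  assert (Pl : 0 < INR l) by (apply lt_0_INR; lia).
  assert (El : INR l = INR (2 ^ p) * INR l0) by apply mult_INR.
  apply Rle_trans with (1 := Hb n l l2 Hn).
  rewrite Rmult_assoc, (Rmult_assoc (C3 + B0)).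
  apply Rmult_le_compat; auto.
  + apply Rmult_le_pos; [lra | left; apply exp_pos].
  + lra.
  + apply Rmult_le_compat_l; [lra|]; apply exp_le.
    replace (INR l * (ln (INR n) - ln s - ln Cr - 1 - ln (N l) / INR l)) with
      (INR l * (ln (INR n) - ln s - ln Cr - 1) - ln (N l)) by (field; lra).
    assert (HNl : ln (N l) <= INR l * ln Cd + INR (2 ^ p) * ln (N1 l0)).
    { rewrite <- !ln_pow_nat, <- ln_mult by (try apply pow_lt; auto; lra).
      apply ln_le; auto; apply Hd. }
    assert (c' * (ln (N l) - INR l * (ln (INR n) - ln s - ln Cr - 1)) <= c' * (INR (2 ^ p) * Bq)).
    { apply Rmult_le_compat_l; [lra|]; unfold Bq; rewrite El in *; lra. }
    assert (c' * INR (2 ^ p) * Bq <= 1 * Bq) by nra.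
    lra.
- assert (1 <= exp Bq) by (rewrite <- exp_0; apply exp_le; lra).
  apply Rle_trans with (B0 * 1); [generalize (Hb0 n); lra|].
  apply Rle_trans with (B0 * (INR n ^ 3 * exp Bq)); [apply Rmult_le_compat_l; [lra | nra]|].
  rewrite Rmult_assoc; apply Rmult_le_compat_r; [nra | lra].
Qed.

(** Of the five extra powers of [n], three cancel [n^3] and two make the series summable. Moderate
    growth splits [N1 (l + 5)] into [M' l] and a constant. *)
Lemma coef_large : exists K1, 0 <= K1 /\ forall n l, (2 * (2 ^ p * (l + 5)) <= n)%nat ->
  b n * (2 ^ l * INR (n + l) ^ l) * INR (S n) ^ 2 <= K1 * ((4 * Theta * Cm * s) ^ l * M' l).
Proof.
set (T := s * Theta * Cm).
assert (T0 : 0 < T) by (unfold T; apply Rmult_lt_0_compat; nra).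
exists (4 * ((C3 + B0) * T ^ 5 * M' 5%nat)); split.
{ generalize (HM' 5%nat) (pow_lt T 5 T0); intros.
  repeat first [lra | apply Rmult_le_pos]. }
intros n l Hn.
assert (n1 : 1 <= INR n) by (apply (le_INR 1); nia).
assert (ln_n : (l <= n)%nat) by nia.
generalize (coef_doubling n (l + 5) ltac:(lia) Hn); intros H.
assert (H1 : b n * INR n ^ l * INR n ^ 2 <= (C3 + B0) * ((s * Theta) ^ (l + 5) * N1 (l + 5)%nat)).
{ apply Rmult_le_reg_r with (INR n ^ 3); [apply pow_lt; lra|].
  replace (b n * INR n ^ l * INR n ^ 2 * INR n ^ 3) with (b n * INR n ^ (l + 5)) by (rewrite pow_add; ring).
  lra. }
assert (H2 : (s * Theta) ^ (l + 5) * N1 (l + 5)%nat <= T ^ l * T ^ 5 * (M' l * M' 5%nat)).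
{ rewrite <- pow_add; unfold T; rewrite (Rpow_mult_distr _ Cm), Rmult_assoc.
  apply Rmult_le_compat_l; [apply pow_le; nra | apply Hm; lia]. }
assert (H3 : b n * INR n ^ l * INR n ^ 2 <= (C3 + B0) * (T ^ l * T ^ 5 * (M' l * M' 5%nat))).
{ apply Rle_trans with (1 := H1), Rmult_le_compat_l; lra. }
assert (H4 : INR (n + l) ^ l <= 2 ^ l * INR n ^ l).
{ rewrite <- Rpow_mult_distr; apply pow_incr; split; [apply pos_INR|].
  rewrite plus_INR; assert (INR l <= INR n) by (apply le_INR; auto); lra. }
assert (H5 : INR (S n) ^ 2 <= 4 * INR n ^ 2) by (rewrite S_INR; nra).
assert (P2 : 0 < 2 ^ l) by (apply pow_lt; lra).
apply Rle_trans with (b n * (2 ^ l * (2 ^ l * INR n ^ l)) * (4 * INR n ^ 2)).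
{ apply Rmult_le_compat; auto.
  - apply Rmult_le_pos; [apply Hb0 | apply Rmult_le_pos; [lra | apply pow_le, pos_INR]].
  - apply pow2_ge_0.
  - apply Rmult_le_compat_l; [apply Hb0 | apply Rmult_le_compat_l; lra]. }
replace (4 * Theta * Cm * s) with (2 * 2 * T) by (unfold T; ring).
rewrite !Rpow_mult_distr.
replace (b n * (2 ^ l * (2 ^ l * INR n ^ l)) * (4 * INR n ^ 2)) with
  (4 * (2 ^ l * 2 ^ l) * (b n * INR n ^ l * INR n ^ 2)) by ring.
replace (4 * ((C3 + B0) * T ^ 5 * M' 5%nat) * (2 ^ l * 2 ^ l * T ^ l * M' l)) with
  (4 * (2 ^ l * 2 ^ l) * ((C3 + B0) * (T ^ l * T ^ 5 * (M' l * M' 5%nat)))) by ring.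
apply Rmult_le_compat_l; auto; nra.
Qed.

(** Here [n] is at most a multiple of [l + 5], so [(n + l)^l] is bounded by a geometric factor times
    [l!]. As the roots of [M' l / l!] tend to infinity, [D^l l!] is at most a constant times
    [A^l M' l] for every [A > 0]. Thus a small [s] affects only the constant, as the Beurling case
    requires. *)
Lemma coef_small : exists K2, 0 <= K2 /\ forall n l, (n < 2 * (2 ^ p * (l + 5)))%nat ->
  b n * (2 ^ l * INR (n + l) ^ l) * INR (S n) ^ 2 <= K2 * ((4 * Theta * Cm * s) ^ l * M' l).
Proof.
set (P := INR (2 * 2 ^ p)).
assert (P0 : 0 <= P) by apply pos_INR.
set (D := 2 * (P + 1) * exp 1 * 4).
set (A := 4 * Theta * Cm * s).
assert (A0 : 0 < A).
{ unfold A; repeat first [lra | apply Rmult_lt_0_compat]. }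
assert (D0 : 0 < D) by (unfold D; generalize (exp_pos 1); nra).
destruct (root_to_infty_dominates (lowr M') (lowr_pos M' HM') Hroot (D / A)) as [K3 [HK3 H3]].
{ apply Rdiv_lt_0_compat; auto. }
exists (B0 * (36 * P ^ 2) * exp 5 * K3); split.
{ generalize (exp_pos 5) (pow2_ge_0 P); intros; repeat first [lra | apply Rmult_le_pos]. }
intros n l Hn.
assert (X1 : INR (S n) <= P * INR (l + 5)).
{ unfold P; rewrite <- mult_INR; apply le_INR; lia. }
assert (X2 : INR (n + l) <= (P + 1) * INR (l + 5)).
{ rewrite Rmult_plus_distr_r, Rmult_1_l, plus_INR.
  assert (INR n <= INR (S n)) by (apply le_INR; lia).
  assert (INR l <= INR (l + 5)) by (apply le_INR; lia); lra. }
assert (X3 : INR (n + l) ^ l <= (P + 1) ^ l * (exp 5 * exp 1 ^ l * INR (fact l))).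
{ apply Rle_trans with (((P + 1) * INR (l + 5)) ^ l).
  - apply pow_incr; split; [apply pos_INR | auto].
  - rewrite Rpow_mult_distr; apply Rmult_le_compat_l; [apply pow_le; lra|].
    apply Rle_trans with (1 := pow_le_exp_fact l).
    apply Rmult_le_compat_r; [left; apply fact_pos|]; right.
    rewrite <- (exp_ln (exp 1 ^ l)) by (apply pow_lt, exp_pos).
    rewrite ln_pow_nat, ln_exp, <- exp_plus by apply exp_pos; f_equal.
    rewrite plus_INR; simpl (INR 5); ring. }
assert (X4 : INR (S n) ^ 2 <= 36 * P ^ 2 * 4 ^ l).
{ apply Rle_trans with ((P * (6 * 2 ^ l)) ^ 2).
  - apply pow_incr; split; [apply pos_INR|]; apply Rle_trans with (1 := X1).
    apply Rmult_le_compat_l; auto; apply le_pow2.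
  - right; replace 4 with (2 * 2) by ring; rewrite (Rpow_mult_distr 2 2); ring. }
assert (X5 : D ^ l * INR (fact l) <= K3 * (A ^ l * M' l)).
{ generalize (H3 l); unfold lowr, Rdiv; rewrite Rpow_mult_distr, pow_inv; intros H.
  apply Rmult_le_compat_r with (r := A ^ l * INR (fact l)) in H.
  - replace (D ^ l * / A ^ l * (A ^ l * INR (fact l))) with (D ^ l * INR (fact l)) in H
      by (field; apply pow_nonzero; lra).
    replace (K3 * (M' l * / INR (fact l)) * (A ^ l * INR (fact l))) with (K3 * (A ^ l * M' l)) in H
      by (field; generalize (fact_pos l); lra).
    exact H.
  - apply Rmult_le_pos; [apply pow_le; lra | left; apply fact_pos]. }
assert (P2 : 0 < 2 ^ l) by (apply pow_lt; lra).
apply Rle_trans with (B0 * (2 ^ l * ((P + 1) ^ l * (exp 5 * exp 1 ^ l * INR (fact l)))) * (36 * P ^ 2 * 4 ^ l)).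
{ assert (0 <= INR (n + l) ^ l) by (apply pow_le, pos_INR).
  apply Rmult_le_compat; auto.
  - apply Rmult_le_pos; [apply Hb0 | apply Rmult_le_pos; lra].
  - apply pow2_ge_0.
  - apply Rmult_le_compat; [apply Hb0 | apply Rmult_le_pos; lra | apply Hb0 |].
    apply Rmult_le_compat_l; lra. }
apply Rle_trans with (B0 * (36 * P ^ 2) * exp 5 * (D ^ l * INR (fact l))).
{ right; unfold D; rewrite !Rpow_mult_distr; ring. }
rewrite (Rmult_assoc _ K3); apply Rmult_le_compat_l; auto.
generalize (exp_pos 5) (pow2_ge_0 P); intros; repeat first [lra | apply Rmult_le_pos].
Qed.

Lemma coef_final : exists K, 0 <= K /\ forall n l,
  b n * (2 ^ l * INR (n + l) ^ l) <= K * ((4 * Theta * Cm * s) ^ l * M' l) * / INR (S n) ^ 2.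
Proof.
destruct coef_large as [K1 [HK1 H1]]; destruct coef_small as [K2 [HK2 H2]].
exists (K1 + K2); split; [lra|]; intros n l.
assert (Z : 0 <= (4 * Theta * Cm * s) ^ l * M' l).
{ apply Rmult_le_pos; [apply pow_le; repeat first [lra | apply Rmult_le_pos] | left; auto]. }
assert (S2 : 0 < INR (S n) ^ 2) by (apply pow_lt, lt_0_INR; lia).
apply Rmult_le_reg_r with (INR (S n) ^ 2); auto.
rewrite (Rmult_assoc (_ * _) (/ _)), Rinv_l, Rmult_1_r by lra.
destruct (le_lt_dec (2 * (2 ^ p * (l + 5))) n) as [L|L].
- apply Rle_trans with (1 := H1 n l L), Rmult_le_compat_r; lra.
- apply Rle_trans with (1 := H2 n l L), Rmult_le_compat_r; lra.
Qed.

End FinalCoefficients.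

(** * The division property *)

Lemma alpha_coef_decay M (G : nat -> R -> R) r K sigma :
  0 < r -> 0 < sigma -> M 0%nat = 1 ->
  (forall i u, -1 <= u <= 1 -> is_derive (G i) u (G (S i) u)) ->
  (forall i u, -1 <= u <= 1 -> Rabs (G i u) <= r ^ i * (K * (sigma ^ i * M i))) ->
  coef_decay M (2 * r * sigma) (PI * K) (fun t => G 0%nat (cos t)).
Proof.
intros Hr Hs M0 HG HB k i Hki.
(* The choice is [q = k / 2]. For [k = 0] this is not positive, but then [i = 0] and any small
   positive [q] will do. *)
assert (Hk : exists q, 0 < q /\ q <= INR k - INR i + 1 /\ INR k ^ i <= 2 ^ i * q ^ i).
{ destruct k as [|k].
  - exists (/ 2); replace i with 0%nat by lia; simpl; lra.
  - exists (INR (S k) / 2); assert (0 < INR (S k)) by (apply lt_0_INR; lia).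
    split; [lra | split].
    + apply (le_INR) in Hki; rewrite mult_INR, plus_INR in Hki; simpl (INR 2) in Hki; simpl (INR 1) in Hki; lra.
    + rewrite <- Rpow_mult_distr; right; f_equal; field. }
destruct Hk as (q & Hq & Hqk & Hkq).
generalize (alpha_decay G _ HG HB i 0%nat k q Hq Hqk); rewrite Nat.add_0_l; intros H.
unfold fcoef; rewrite Rabs_mult.
generalize (kap_pos k) (kap_le k) (Rabs_pos (alpha (fun t => G 0%nat (cos t)) k)); intros k0 k1 a0.
rewrite (Rabs_right (kap k)) by lra.
assert (q0 : 0 < q ^ i) by (apply pow_lt; auto).
assert (t0 : 0 < 2 ^ i) by (apply pow_lt; lra).
apply Rle_trans with (Rabs (alpha (fun t => G 0%nat (cos t)) k) * (2 ^ i * q ^ i)).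
- apply Rmult_le_compat; auto; [apply Rmult_le_pos; lra | apply pow_le, pos_INR | nra].
- apply Rle_trans with (2 ^ i * (PI * (r ^ i * (K * (sigma ^ i * M i))))).
  + replace (Rabs (alpha (fun t => G 0%nat (cos t)) k) * (2 ^ i * q ^ i)) with
      (2 ^ i * (Rabs (alpha (fun t => G 0%nat (cos t)) k) * q ^ i)) by ring.
    apply Rmult_le_compat_l; lra.
  + right; rewrite !Rpow_mult_distr; ring.
Qed.

Lemma coef_decay_ext M s K f g : (forall t, f t = g t) -> coef_decay M s K f -> coef_decay M s K g.
Proof.
intros E H k i Hki; unfold fcoef; rewrite <- (alpha_ext f g) by auto; apply H, Hki.
Qed.

Lemma is_derive_rescale (f : R -> R) (r c u l : R) : is_derive f (r * u) l ->
  is_derive (fun u => c * f (r * u)) u (c * r * l).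
Proof.
intros H; eapply is_derive_eq; [| apply (is_derive_scal (fun u => f (r * u)));
  apply (is_derive_comp (V := R_NormedModule) f (fun u => r * u) u l r H); auto_derive; auto; ring].
unfold scal; simpl; unfold mult; simpl; ring.
Qed.

Section Derivatives.

Variables (r : R) (F : R -> C) (g : nat -> R -> C).
Hypothesis Hr : 0 < r.
Hypothesis Hg : derivs_on (fun x => Rabs x < 2 * r) F g.

Let V_of_unit u : -1 <= u <= 1 -> Rabs (r * u) < 2 * r.
Proof.
intros Hu; rewrite Rabs_mult, Rabs_right by lra.
assert (Rabs u <= 1) by (apply Rabs_le; lra); nra.
Qed.

Lemma ccontinuous_derivs x : Rabs x < 2 * r -> ccontinuous F x.
Proof.
intros Hx; destruct Hg as [E D].
assert (L : locally x (fun y => g 0%nat y = F y)).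
{ assert (Hd : 0 < 2 * r - Rabs x) by lra.
  exists (mkposreal _ Hd); intros y Hy; apply E.
  unfold ball in Hy; simpl in Hy; unfold AbsRing_ball, abs, minus, plus, opp in Hy; simpl in Hy.
  replace y with (x + (y + - x)) by ring.
  apply Rle_lt_trans with (1 := Rabs_triang _ _); lra. }
generalize (D 0%nat x Hx); intros D0; split.
- apply continuous_ext_loc with (fun y => fst (g 0%nat y)).
  + apply filter_imp with (2 := L); intros y ->; auto.
  + apply (ex_derive_continuous (fun y => fst (g 0%nat y))); eexists; apply is_derive_fst, D0.
- apply continuous_ext_loc with (fun y => snd (g 0%nat y)).
  + apply filter_imp with (2 := L); intros y ->; auto.
  + apply (ex_derive_continuous (fun y => snd (g 0%nat y))); eexists; apply is_derive_snd, D0.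
Qed.

Lemma ccoef_decay_derivs M K sigma : 0 < sigma -> M 0%nat = 1 ->
  (forall x k, Rabs x < 2 * r -> Cmod (g k x) <= K * (sigma ^ k * M k)) ->
  ccoef_decay M (2 * r * sigma) (PI * K) (fun t => F (r * cos t)).
Proof.
intros Hs M0 HB; destruct Hg as [E D].
assert (B : forall i u, -1 <= u <= 1 ->
  Rmax (Rabs (fst (g i (r * u)))) (Rabs (snd (g i (r * u)))) <= K * (sigma ^ i * M i)).
{ intros i u Hu; apply Rle_trans with (1 := Rmax_Cmod _); apply HB, V_of_unit, Hu. }
assert (rp : forall i, 0 <= r ^ i) by (intros; apply pow_le; lra).
split.
- apply coef_decay_ext with (fun t => r ^ 0 * fst (g 0%nat (r * cos t))).
  { intros t; rewrite E by (apply V_of_unit, COS_bound); simpl; ring. }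
  apply (alpha_coef_decay M (fun i u => r ^ i * fst (g i (r * u)))); auto.
  + intros i u Hu; replace (r ^ S i) with (r ^ i * r) by (simpl; ring).
    apply (is_derive_rescale (fun x => fst (g i x))), is_derive_fst, D, V_of_unit, Hu.
  + intros i u Hu; rewrite Rabs_mult, (Rabs_right (r ^ i)) by (apply Rle_ge; auto).
    apply Rmult_le_compat_l; auto; apply Rle_trans with (2 := B i u Hu), Rmax_l.
- apply coef_decay_ext with (fun t => r ^ 0 * snd (g 0%nat (r * cos t))).
  { intros t; rewrite E by (apply V_of_unit, COS_bound); simpl; ring. }
  apply (alpha_coef_decay M (fun i u => r ^ i * snd (g i (r * u)))); auto.
  + intros i u Hu; replace (r ^ S i) with (r ^ i * r) by (simpl; ring).
    apply (is_derive_rescale (fun x => snd (g i x))), is_derive_snd, D, V_of_unit, Hu.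
  + intros i u Hu; rewrite Rabs_mult, (Rabs_right (r ^ i)) by (apply Rle_ge; auto).
    apply Rmult_le_compat_l; auto; apply Rle_trans with (2 := B i u Hu), Rmax_r.
Qed.

Lemma ccont_rescale : (forall x, Rabs x < 2 * r -> ccontinuous F x) ->
  ccont (fun t => F (r * cos t)).
Proof.
intros HF.
assert (L : forall u, continuous (fun u => r * u) u).
{ intros u; apply (ex_derive_continuous (fun u => r * u)); auto_derive; auto. }
split.
- apply (cont_comp_cos (fun u => fst (F (r * u)))); intros u Hu.
  apply (continuous_comp (fun u => r * u) (fun x => fst (F x))); auto.
  apply HF, V_of_unit, Hu.
- apply (cont_comp_cos (fun u => snd (F (r * u)))); intros u Hu.
  apply (continuous_comp (fun u => r * u) (fun x => snd (F x))); auto.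
  apply HF, V_of_unit, Hu.
Qed.

End Derivatives.

Lemma even_bounded h : cont (fun t => h (cos t)) -> exists B, 0 < B /\ forall t, Rabs (h (cos t)) <= B.
Proof.
intros Hc; destruct (cont_bounded _ Hc) as [B [HB H]].
exists B; split; auto; intros t.
rewrite <- (cos_acos (cos t)) by apply COS_bound; apply H, acos_bound.
Qed.

Lemma fcoef_bounded Psi B n : cont Psi -> (forall t, Rabs (Psi t) <= B) ->
  Rabs (fcoef Psi n) <= PI * B.
Proof.
intros HC HB; unfold fcoef; rewrite Rabs_mult.
generalize (alpha_bound Psi n B HC (fun t _ => HB t)) (kap_pos n) (kap_le n) (Rabs_pos (alpha Psi n)).
intros; rewrite (Rabs_right (kap n)) by lra; nra.
Qed.

Lemma ex_series_inv_sq : ex_series (fun k => / INR (S k) ^ 2) /\ Series (fun k => / INR (S k) ^ 2) <= 2.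
Proof.
apply pos_series_bounded.
- intros k; left; apply Rinv_0_lt_compat, pow_lt, lt_0_INR; lia.
- intros N; apply Rle_trans with (1 := sum_inv_sq N).
  assert (0 < / INR (S N)) by (apply Rinv_0_lt_compat, lt_0_INR; lia); lra.
Qed.

Lemma rapid_of_bound a (K : nat -> R) :
  (forall n l, Rabs (a n) * (2 ^ l * INR (n + l) ^ l) <= K l * / INR (S n) ^ 2) ->
  rapid a /\ forall l x, -1/2 <= x <= 1/2 -> Rabs (chebseries a l x) <= 2 * K l.
Proof.
intros H; destruct ex_series_inv_sq as [S1 S2].
assert (K0 : forall l, 0 <= K l).
{ intros l; generalize (H 0%nat l); simpl INR; rewrite pow1, Rinv_1, Rmult_1_r; intros H0.
  apply Rle_trans with (2 := H0); apply Rmult_le_pos; [apply Rabs_pos|].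
  apply Rmult_le_pos; [apply pow_le; lra | apply pow_le, pos_INR]. }
assert (E : forall l, ex_series (fun n => K l * / INR (S n) ^ 2)).
{ intros l; apply (ex_series_scal (K := R_AbsRing) (K l) (fun n => / INR (S n) ^ 2)), S1. }
split.
- intros l; apply (ex_series_le (K := R_AbsRing) (V := R_CompleteNormedModule)) with (2 := E l).
  intros n; unfold norm; simpl; unfold abs; simpl.
  rewrite Rabs_right; [apply H|]; apply Rle_ge, Rmult_le_pos; [apply Rabs_pos|].
  apply Rmult_le_pos; [apply pow_le; lra | apply pow_le, pos_INR].
- intros l x Hx; apply Rle_trans with (Series (fun n => K l * / INR (S n) ^ 2)).
  + apply Rabs_Series_le; auto; intros n.
    apply Rle_trans with (1 := chebseries_term a n l x Hx), H.
  + rewrite Series_scal_l; generalize (K0 l); nra.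
Qed.

Lemma chebseries_cosseries Psi : cont Psi -> rapid (fcoef Psi) -> forall t, 0 <= t <= PI ->
  chebseries (fcoef Psi) 0 (cos t) = Psi t.
Proof.
intros HC Hr t Ht; rewrite (fourier_cos Psi HC); auto.
- apply Series_ext; intros k; rewrite Td_cos; auto.
- apply ex_series_ext with (2 := Hr 0%nat); intros k; simpl; ring.
Qed.

(** This fixes the number [2 j + 2] of doublings: [2^(2 j + 2)] beats the loss [4 j (j + 1)] of the
    division. *)
Lemma pow4_ge j : (1 <= j)%nat -> 4 * (INR j * INR (S j)) <= INR (2 ^ (2 * j + 2)).
Proof.
intros Hj.
replace (4 * (INR j * INR (S j))) with (INR (4 * (j * S j))) by (rewrite !mult_INR; simpl (INR 4); ring).
apply le_INR; rewrite Nat.pow_add_r, Nat.pow_mul_r; simpl (2 ^ 2)%nat.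
enough (j * S j <= 4 ^ j)%nat by lia.
clear Hj; induction j as [|j IH]; [simpl; lia|].
destruct j as [|j]; [simpl; lia|]; rewrite Nat.pow_succ_r'; nia.
Qed.

Section Division.

Variables (f : R -> C) (j : nat) (r : R) (g1 g2 : nat -> R -> C).
Hypothesis Hj : (1 <= j)%nat.
Hypothesis Hr : 0 < r.
Hypothesis Hg1 : derivs_on (fun x => Rabs x < 2 * r) (fun x => Cpow (f x) j) g1.
Hypothesis Hg2 : derivs_on (fun x => Rabs x < 2 * r) (fun x => Cpow (f x) (S j)) g2.

Let h (u : R) : R * R := f (r * u).
Let phi (t : R) : C := h (cos t).
Let a1 := fcoef (fun t => fst (phi t)).
Let a2 := fcoef (fun t => snd (phi t)).

(** The rescaled Chebyshev series of the derivatives. They do not involve the weights, so in the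
    Beurling case one family of derivatives serves all weights and all [sigma]. *)
Definition quotient_derivs (l : nat) (x : R) : C :=
  ((/ r) ^ l * chebseries a1 l (/ r * x), (/ r) ^ l * chebseries a2 l (/ r * x)).

Let Hf x : Rabs x < 2 * r -> ccontinuous f x.
Proof.
intros Hx; apply (ccontinuous_of_powers f x j Hj);
  eapply ccontinuous_derivs; eauto.
Qed.

Let Cphi : ccont phi.
Proof. exact (ccont_rescale r f Hr Hf). Qed.

Let unit_of x : Rabs x < r / 2 -> -1/2 < / r * x < 1/2.
Proof.
intros Hx; apply Rabs_def2 in Hx.
assert (/ r * r = 1) by (field; lra).
assert (0 < / r) by (apply Rinv_0_lt_compat, Hr).
split; nra.
Qed.

Lemma quotient_derivs_on : rapid a1 -> rapid a2 ->
  derivs_on (fun x => Rabs x < r / 2) f quotient_derivs.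
Proof.
intros R1 R2; destruct Cphi as [C1 C2]; split.
- intros x Hx; generalize (unit_of x Hx); intros Hu.
  assert (E : / r * x = cos (acos (/ r * x))) by (rewrite cos_acos; lra).
  assert (Hb := acos_bound (/ r * x)).
  assert (Ef : f x = phi (acos (/ r * x))).
  { unfold phi, h; rewrite <- E; f_equal; field; lra. }
  unfold quotient_derivs; rewrite E.
  unfold a1, a2; rewrite !chebseries_cosseries by auto.
  rewrite Ef; apply injective_projections; simpl; ring.
- intros l x Hx; generalize (unit_of x Hx); intros Hu.
  apply is_derive_pair; replace ((/ r) ^ S l) with ((/ r) ^ l * / r) by (simpl; ring);
    apply (is_derive_rescale (chebseries _ l)), is_derive_chebseries; auto.
Qed.

(** [A] is chosen before [sigma] and [K]. The Beurling case depends on this order, as it applies the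
    bound with [sigma / A] in place of [sigma]. *)
Lemma quotient_bound M M' : weight_sequence M -> weight_sequence M' ->
  root_to_infty (lowr M') -> linked (2 * j + 2) M M' ->
  exists A, 0 < A /\ forall sigma K, 0 < sigma ->
    (forall x k, Rabs x < 2 * r -> Cmod (g1 k x) <= K * (sigma ^ k * M k)) ->
    (forall x k, Rabs x < 2 * r -> Cmod (g2 k x) <= K * (sigma ^ k * M k)) ->
    rapid a1 /\ rapid a2 /\ exists K', forall x l, Rabs x < r / 2 ->
      Cmod (quotient_derivs l x) <= K' * ((A * sigma) ^ l * M' l).
Proof.
intros WM WM' Hroot (N & N1 & WN & WN1 & (Cr & HCr & Hinc) & (Cd & HCd & Hdbl) & Hmg).
destruct (mg_finite_bound N1 M' (weight_pos _ WN1) (weight_pos _ WM') Hmg) as [Cm [HCm Hm]].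
set (Theta := Cr * exp 1 * Cd).
assert (T0 : 0 < Theta).
{ unfold Theta; generalize (exp_pos 1); intros; apply Rmult_lt_0_compat; nra. }
(* The coefficient bound has base [4 Theta Cm s] with [s = 2 r sigma]; undoing the scaling divides
   by [r], and the radius cancels. *)
exists (8 * Theta * Cm); split; [nra|]; intros sigma K Hs B1 B2.
set (s := 2 * r * sigma).
assert (s0 : 0 < s) by (unfold s; nra).
generalize (weight_pos M WM) (weight_pos N WN) (weight_pos N1 WN1) (weight_pos M' WM');
  intros PM PN PN1 PM'.
assert (M0 := weight_0 M WM).
assert (HPI := PI_RGT_0).
assert (HK : 0 <= K).
{ generalize (B1 0 0%nat ltac:(rewrite Rabs_R0; lra)); rewrite M0, pow_O, !Rmult_1_r; intros H.
  apply Rle_trans with (2 := H), Cmod_ge_0. }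
assert (D1 := ccoef_decay_derivs r _ g1 Hr Hg1 M K sigma Hs M0 B1).
assert (D2 := ccoef_decay_derivs r _ g2 Hr Hg2 M K sigma Hs M0 B2).
assert (CP1 := ccont_rescale r _ Hr (ccontinuous_derivs r _ g1 Hg1)).
assert (CP2 := ccont_rescale r _ Hr (ccontinuous_derivs r _ g2 Hg2)).
destruct Cphi as [C1 C2].
destruct (even_bounded (fun u => fst (h u)) C1) as [b1 [b10 Hb1]].
destruct (even_bounded (fun u => snd (h u)) C2) as [b2 [b20 Hb2]].
assert (Bphi : forall t, Cmod (phi t) <= b1 + b2).
{ intros t; apply Rle_trans with (1 := Cmod_le_sum _); generalize (Hb1 t) (Hb2 t); unfold phi; lra. }
(* One constant above [|phi|], its two powers and [6 PI K], as the core estimate asks for. *)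
set (A0 := (1 + b1 + b2) ^ S j + 6 * (PI * K)).
assert (PK : 0 <= PI * K) by (apply Rmult_le_pos; lra).
assert (Q1 : 1 + b1 + b2 <= (1 + b1 + b2) ^ S j) by (apply pow_ge_self; [lia | lra]).
assert (Bpow : forall i t, (i <= S j)%nat -> Cmod (phi t) ^ i <= A0).
{ intros i t Hi; apply Rle_trans with ((1 + b1 + b2) ^ i).
  - apply pow_incr; split; [apply Cmod_ge_0 | generalize (Bphi t); lra].
  - unfold A0; assert ((1 + b1 + b2) ^ i <= (1 + b1 + b2) ^ S j) by (apply Rle_pow; [lra | auto]); lra. }
destruct (fcoef_decay M N Cr s (PI * K) PM s0 PK Hinc M0 j h A0 Hj) as [C3 [HC3 HD]]; auto.
{ unfold A0; lra. }
{ unfold A0; lra. }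
{ intros t; rewrite <- (pow_1 (Cmod _)); apply (Bpow 1%nat t); lia. }
{ intros t; apply (Bpow j t); lia. }
{ intros t; apply (Bpow (S j) t); lia. }
assert (c0 : 0 < / (4 * (INR j * INR (S j)))).
{ apply Rinv_0_lt_compat; assert (0 < INR j) by (apply lt_0_INR; lia).
  assert (0 < INR (S j)) by (apply lt_0_INR; lia); nra. }
assert (cp : 1 <= / (4 * (INR j * INR (S j))) * INR (2 ^ (2 * j + 2))).
{ generalize (pow4_ge j Hj); revert c0; generalize (4 * (INR j * INR (S j))); intros x Hx Hp.
  apply Rinv_0_lt_compat in Hx; rewrite Rinv_inv in Hx.
  apply Rmult_le_reg_l with x; auto.
  rewrite <- Rmult_assoc, Rinv_r; lra. }
assert (Fin : forall a, (forall n, Rabs (a n) <= PI * (b1 + b2)) ->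
  (forall n l, (2 <= l)%nat -> (2 * l <= n)%nat ->
     Rabs (a n) <= C3 * INR n ^ 3 * exp (- (/ (4 * (INR j * INR (S j))) *
      (INR l * (ln (INR n) - ln s - ln Cr - 1 - ln (N l) / INR l))))) ->
  exists K', 0 <= K' /\ rapid a /\ forall l x, -1/2 <= x <= 1/2 ->
    Rabs (chebseries a l x) <= K' * ((4 * Theta * Cm * s) ^ l * M' l)).
{ intros a Ha Hd.
  destruct (coef_final N N1 M' Cr Cd Cm _ (2 * j + 2) PN PN1 PM' Hroot HCr HCd HCm Hdbl Hm
    ltac:(lia) c0 cp s C3 (PI * (b1 + b2)) (fun n => Rabs (a n)) s0 HC3
    ltac:(apply Rmult_le_pos; lra) (fun n => conj (Rabs_pos _) (Ha n)) Hd) as [K1 [HK1 H1]].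
  destruct (rapid_of_bound a (fun l => K1 * ((4 * Theta * Cm * s) ^ l * M' l)) H1) as [H2 H3].
  exists (2 * K1); split; [lra | split; auto].
  intros l x Hx; generalize (H3 l x Hx); lra. }
destruct (Fin a1) as (K1 & HK1 & R1 & F1).
{ intros n; apply fcoef_bounded; auto; intros t; generalize (Hb1 t); unfold phi; lra. }
{ intros n l Hl Hn; apply (HD n l Hl Hn). }
destruct (Fin a2) as (K2 & HK2 & R2 & F2).
{ intros n; apply fcoef_bounded; auto; intros t; generalize (Hb2 t); unfold phi; lra. }
{ intros n l Hl Hn; apply (HD n l Hl Hn). }
split; [auto | split; [auto|]].
exists (K1 + K2); intros x l Hx; generalize (unit_of x Hx); intros Hu.
apply Rle_trans with (1 := Cmod_le_sum _); unfold quotient_derivs; simpl fst; simpl snd.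
assert (r0 : 0 < (/ r) ^ l) by (apply pow_lt, Rinv_0_lt_compat, Hr).
rewrite !Rabs_mult, (Rabs_right ((/ r) ^ l)) by lra.
replace ((8 * Theta * Cm * sigma) ^ l) with ((/ r) ^ l * (4 * Theta * Cm * s) ^ l).
2:{ rewrite <- Rpow_mult_distr; f_equal; unfold s; field; lra. }
generalize (F1 l (/ r * x) ltac:(lra)) (F2 l (/ r * x) ltac:(lra)); intros F1' F2'.
apply Rle_trans with ((/ r) ^ l * ((K1 + K2) * ((4 * Theta * Cm * s) ^ l * M' l))); [|right; ring].
rewrite <- Rmult_plus_distr_l; apply Rmult_le_compat_l; lra.
Qed.

End Division.

Lemma open_interval c : 0 < c -> open (fun x => Rabs x < c).
Proof.
intros Hc; apply open_ext with (fun x => - c < x /\ x < c).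
- intros x; split; [intros []; apply Rabs_def1; auto | intros H; apply Rabs_def2 in H; lra].
- apply open_and; [apply open_gt | apply open_lt].
Qed.

Lemma open_contains_interval (U1 U2 : R -> Prop) : open U1 -> U1 0 -> open U2 -> U2 0 ->
  exists r, 0 < r /\ forall x, Rabs x <= 2 * r -> U1 x /\ U2 x.
Proof.
intros O1 H1 O2 H2; destruct (O1 0 H1) as [e1 E1]; destruct (O2 0 H2) as [e2 E2].
generalize (cond_pos e1) (cond_pos e2) (Rmin_l e1 e2) (Rmin_r e1 e2); intros p1 p2 m1 m2.
assert (m : 0 < Rmin e1 e2) by (apply Rmin_pos; auto).
exists (Rmin e1 e2 / 4); split; [lra|]; intros x Hx.
assert (B : forall e : posreal, Rmin e1 e2 <= e -> ball 0 e x).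
{ intros e He; unfold ball; simpl; unfold AbsRing_ball, abs, minus, plus, opp; simpl.
  rewrite Ropp_0, Rplus_0_r; lra. }
split; [apply E1 | apply E2]; auto.
Qed.

Lemma rel_compact_interval (U : R -> Prop) r : 0 < r -> (forall x, Rabs x <= 2 * r -> U x) ->
  rel_compact_open_in (fun x => Rabs x < 2 * r) U.
Proof.
intros Hr H; split; [apply open_interval; lra|].
exists (- (2 * r)), (2 * r); split.
- intros x Hx; apply Rabs_def2 in Hx; lra.
- intros x Hx; apply H, Rabs_le, Hx.
Qed.

Lemma derivs_bound_mono (g : nat -> R -> C) (V : R -> Prop) M M' K K' s s' :
  (forall k, 0 < M k <= M' k) -> 0 < s <= s' -> K <= K' -> 0 <= K' ->
  (forall x k, V x -> Cmod (g k x) <= K * (s ^ k * M k)) ->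
  forall x k, V x -> Cmod (g k x) <= K' * (s' ^ k * M' k).
Proof.
intros HM Hs HK HK' H x k Hx; apply Rle_trans with (1 := H x k Hx).
assert (P : 0 < s ^ k) by (apply pow_lt; lra).
assert (s ^ k <= s' ^ k) by (apply pow_incr; lra).
generalize (HM k); intros Hk.
apply Rle_trans with (K' * (s ^ k * M k)).
- apply Rmult_le_compat_r; auto; nra.
- apply Rmult_le_compat_l; auto; apply Rmult_le_compat; lra.
Qed.

Theorem theorem4p2 (W : (nat -> R) -> Prop) :
  weight_matrix W ->
  ((R_regular W /\ R_moderate_growth W) -> property_D (germ_Roumieu W)) /\
  ((B_regular W /\ B_moderate_growth W) -> property_D (germ_Beurling W)).
Proof.
intros HW; generalize (proj1 (proj2 HW)); intros Hw; split.
- intros [Hreg Hmg] f j Hj (U1 & O1 & Z1 & G1) (U2 & O2 & Z2 & G2).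
  destruct (open_contains_interval U1 U2 O1 Z1 O2 Z2) as (r & Hr & HU).
  destruct (G1 _ (rel_compact_interval U1 r Hr (fun x Hx => proj1 (HU x Hx))))
    as (g1 & D1 & M1 & WM1 & s1 & Hs1 & K1 & B1).
  destruct (G2 _ (rel_compact_interval U2 r Hr (fun x Hx => proj2 (HU x Hx))))
    as (g2 & D2 & M2 & WM2 & s2 & Hs2 & K2 & B2).
  set (s := Rmax s1 s2); set (K := Rmax 0 (Rmax K1 K2)).
  assert (Hs : 0 < s1 <= s /\ 0 < s2 <= s).
  { repeat split; auto; [apply Rmax_l | apply Rmax_r]. }
  assert (HK : K1 <= K /\ K2 <= K /\ 0 <= K).
  { unfold K; repeat split; [| | apply Rmax_l]; apply Rle_trans with (2 := Rmax_r 0 _);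
      [apply Rmax_l | apply Rmax_r]. }
  (* The two powers may be controlled by different weights; the total order provides a common
     one. *)
  assert (HM : exists M, W M /\ (forall k, 0 < M1 k <= M k) /\ (forall k, 0 < M2 k <= M k)).
  { generalize (weight_pos M1 (Hw M1 WM1)) (weight_pos M2 (Hw M2 WM2)); intros P1 P2.
    destruct (proj2 (proj2 HW) M1 M2 WM1 WM2) as [L|L]; [exists M2 | exists M1];
      repeat split; auto; lra. }
  destruct HM as (M & WM & L1 & L2).
  destruct (linked_R W HW Hreg Hmg (2 * j + 2) M WM) as (M' & WM' & Hlink).
  destruct (quotient_bound f j r g1 g2 Hj Hr D1 D2 M M' (Hw M WM) (Hw M' WM')
    (proj1 Hreg M' WM') Hlink) as (A & HA & H).
  destruct (H s K) as (R1 & R2 & K' & HK').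
  { lra. }
  { apply (derivs_bound_mono g1 (fun x => Rabs x < 2 * r) M1 M K1 K s1 s); auto; apply Hs || apply HK. }
  { apply (derivs_bound_mono g2 (fun x => Rabs x < 2 * r) M2 M K2 K s2 s); auto; apply Hs || apply HK. }
  exists (fun x => Rabs x < r / 2); split; [apply open_interval; lra | split].
  { rewrite Rabs_R0; lra. }
  destruct (quotient_derivs_on f j r g1 g2 Hj Hr D1 D2 R1 R2) as [E D].
  intros V (_ & a & b & Hab & HV).
  assert (HV' : forall x, V x -> Rabs x < r / 2) by (intros; apply HV, Hab; auto).
  exists (quotient_derivs f r); split; [split; auto|].
  exists M'; split; auto; exists (A * s); split; [nra|].
  exists K'; auto.
- intros [Hreg Hmg] f j Hj (U1 & O1 & Z1 & G1) (U2 & O2 & Z2 & G2).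
  destruct (open_contains_interval U1 U2 O1 Z1 O2 Z2) as (r & Hr & HU).
  destruct (G1 _ (rel_compact_interval U1 r Hr (fun x Hx => proj1 (HU x Hx)))) as (g1 & D1 & B1).
  destruct (G2 _ (rel_compact_interval U2 r Hr (fun x Hx => proj2 (HU x Hx)))) as (g2 & D2 & B2).
  assert (Main : forall M', W M' -> exists A, 0 < A /\ forall sigma, 0 < sigma ->
    rapid (fcoef (fun t => fst (f (r * cos t)))) /\ rapid (fcoef (fun t => snd (f (r * cos t)))) /\
    exists K', forall x l, Rabs x < r / 2 ->
      Cmod (quotient_derivs f r l x) <= K' * ((A * sigma) ^ l * M' l)).
  { intros M' WM'.
    destruct (linked_B W HW Hreg Hmg (2 * j + 2) M' WM') as (M & WM & Hlink).
    destruct (quotient_bound f j r g1 g2 Hj Hr D1 D2 M M' (Hw M WM) (Hw M' WM')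
      (proj1 Hreg M' WM') Hlink) as (A & HA & H).
    exists A; split; auto; intros sigma Hs.
    destruct (B1 M WM sigma Hs) as [K1 HK1]; destruct (B2 M WM sigma Hs) as [K2 HK2].
    set (K := Rmax 0 (Rmax K1 K2)).
    assert (HK : K1 <= K /\ K2 <= K /\ 0 <= K).
    { unfold K; repeat split; [| | apply Rmax_l]; apply Rle_trans with (2 := Rmax_r 0 _);
        [apply Rmax_l | apply Rmax_r]. }
    assert (PM : forall k, 0 < M k <= M k) by (intros k; split; [apply (weight_pos M (Hw M WM)) | lra]).
    apply (H sigma K Hs).
    - apply (derivs_bound_mono g1 (fun x => Rabs x < 2 * r) M M K1 K sigma sigma); auto; lra.
    - apply (derivs_bound_mono g2 (fun x => Rabs x < 2 * r) M M K2 K sigma sigma); auto; lra. }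
  exists (fun x => Rabs x < r / 2); split; [apply open_interval; lra | split].
  { rewrite Rabs_R0; lra. }
  (* Any single weight with [sigma = 1] already gives the rapid decay that makes the series
     differentiable; the matrix is nonempty. *)
  destruct (proj1 HW) as [M0 WM0].
  destruct (Main M0 WM0) as (A0 & _ & H0); destruct (H0 1 ltac:(lra)) as (R1 & R2 & _).
  destruct (quotient_derivs_on f j r g1 g2 Hj Hr D1 D2 R1 R2) as [E D].
  intros V (_ & a & b & Hab & HV).
  assert (HV' : forall x, V x -> Rabs x < r / 2) by (intros; apply HV, Hab; auto).
  exists (quotient_derivs f r); split; [split; auto|].
  intros M' WM' sigma Hs.
  destruct (Main M' WM') as (A & HA & H).
  destruct (H (sigma / A)) as (_ & _ & K' & HK'); [apply Rdiv_lt_0_compat; auto|].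
  replace (A * (sigma / A)) with sigma in HK' by (field; lra).
  exists K'; auto.
Qed.
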